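(* Let $m,n_1,\ldots,n_m\in\mathbb{N}$, $c_1,\ldots,c_m>0$, $N=\sum_{i=1}^m n_i$, and let $\mathcal{Q}$ be a real symmetric matrix on $\mathbb{R}^N=\bigoplus_{i=1}^m\mathbb{R}^{n_i}$. For any nonnegative and even $f_i\in L^1(\mathbb{R}^{n_i})$, $i=1,\ldots,m$, satisfying $$\prod_{i=1}^m f_i(x_i)^{c_i}\le e^{-\langle x,\mathcal{Q}x\rangle}\quad\text{for all } x=(x_1,\ldots,x_m)\in\mathbb{R}^N,$$ it holds that $$\prod_{i=1}^m\Big(\int_{\mathbb{R}^{n_i}}f_i\,dx_i\Big)^{c_i}\le\sup_{A_1,\ldots,A_m}\prod_{i=1}^m\Big(\int_{\mathbb{R}^{n_i}}g_{A_i}\,dx_i\Big)^{c_i},$$ where the supremum (possibly $+\infty$) is taken over all symmetric positive definite $n_i\times n_i$ matrices $A_i$, $i=1,\ldots,m$, such that $\prod_{i=1}^m g_{A_i}(x_i)^{c_i}\le e^{-\langle x,\mathcal{Q}x\rangle}$ for all $x\in\mathbb{R}^N$.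
   Context: For a symmetric positive definite $n\times n$ matrix $A$, $g_A(x):=e^{-\frac12\langle x,Ax\rangle}$, $x\in\mathbb{R}^n$. The decomposition $\mathbb{R}^N=\bigoplus_{i=1}^m\mathbb{R}^{n_i}$ is orthogonal, and $x=(x_1,\ldots,x_m)$ with $x_i\in\mathbb{R}^{n_i}$. *)

(* Defs.v *)
From HB Require Import structures.
From mathcomp Require Import all_boot all_order all_algebra.
From mathcomp Require Import all_classical all_reals all_analysis.

Set Implicit Arguments.
Unset Strict Implicit.
Unset Printing Implicit Defensive.

Import Order.TTheory GRing.Theory Num.Theory.
Import numFieldNormedType.Exports.

Local Open Scope classical_set_scope.
Local Open Scope ring_scope.

(* The image of [lebesgue_measure \x mu] under (x, t) |-> x :: t; it is the
   induction step in the construction of Lebesgue measure on R^n. *)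
Section cons_measure.
Context {R : realType} {n : nat}.
Notation borelR := (measurableTypeR R).

Definition cons_pair (p : borelR * n.-tuple borelR) : n.+1.-tuple borelR :=
  [tuple of p.1 :: p.2].

Lemma measurable_cons_pair : measurable_fun setT cons_pair.
Proof. exact: measurable_cons. Qed.

Variable mu : {sigma_finite_measure set (n.-tuple borelR) -> \bar R}.

Definition cons_measure : set (n.+1.-tuple borelR) -> \bar R :=
  pushforward (lebesgue_measure \x mu)%E cons_pair.

Let cons_measure0 : cons_measure set0 = 0%E.
Proof. by rewrite /cons_measure /pushforward preimage_set0 measure0. Qed.

Let cons_measure_ge0 A : (0 <= cons_measure A)%E.
Proof. by apply: integral_ge0 => x _. Qed.

Let cons_measure_sigma_additive : semi_sigma_additive cons_measure.
Proof.
have mf := measurable_cons_pair.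
exact: (@measure_semi_sigma_additive _ _ _
  (pushforward (lebesgue_measure \x mu)%E cons_pair)).
Qed.

HB.instance Definition _ := isMeasure.Build _ _ _ cons_measure
  cons_measure0 cons_measure_ge0 cons_measure_sigma_additive.

Let cons_measure_sigma_finite : sigma_finite setT cons_measure.
Proof.
have /sigma_finiteP[F [TF ndF Foo]] := sigma_finiteT (@lebesgue_measure R).
have /sigma_finiteP[G [TG ndG Goo]] := sigma_finiteT mu.
pose u (t : n.+1.-tuple borelR) := (thead t, [tuple of behead t]).
have mu_ : measurable_fun setT u.
  apply: measurable_fun_pair; last exact: measurable_behead.
  exact: measurable_tnth.
have uK : cancel cons_pair u by case=> x t; congr pair; apply: val_inj.
exists (fun k => u @^-1` (F k `*` G k)).
  rewrite -preimage_bigcup (_ : \bigcup_k _ = setT) ?preimage_setT//.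
  rewrite -setXTT TF TG predeqE => -[x y]; split.
    by move=> [k _ []/= ? ?]; split; exists k.
  move=> [/= [i _ Fix_] [j _ Gjy]]; exists (maxn i j) => //; split.
  - by move: x Fix_; exact/subsetPset/ndF/leq_maxl.
  - by move: y Gjy; exact/subsetPset/ndG/leq_maxr.
move=> k; have [? ?] := Foo k; have [? ?] := Goo k; split.
  by rewrite -[X in measurable X]setTI; apply: mu_ => //; exact: measurableX.
rewrite /cons_measure /pushforward -comp_preimage.
rewrite (_ : u \o cons_pair = id); last by apply/funext => p; exact: uK.
by rewrite preimage_id product_measure1E// lte_mul_pinfty// ge0_fin_numE.
Qed.

HB.instance Definition _ := @Measure_isSigmaFinite.Build _ _ _
  cons_measure cons_measure_sigma_finite.

End cons_measure.

Section lebesgue_Rn.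
Variable R : realType.

Fixpoint lebesgue_tuple (n : nat) :
    {sigma_finite_measure set (n.-tuple (measurableTypeR R)) -> \bar R} :=
  if n is n'.+1 then cons_measure (lebesgue_tuple n') else \d_[tuple].

(* [lebesgue_tuple n] only measures Borel sets; its completion measures the
   Lebesgue measurable ones. *)
Definition lebesgue_Rn (n : nat) :=
  @completed_measure_extension _ _ _ (lebesgue_tuple n).

Arguments lebesgue_Rn : clear implicits.

HB.instance Definition _ (n : nat) := Measure.on (lebesgue_Rn n).

Definition col_of_tuple (n : nat) (t : n.-tuple R) : 'cV[R]_n :=
  \col_i tnth t i.

Definition integrable_Rn (n : nat) (f : 'cV[R]_n -> R) : Prop :=
  (lebesgue_Rn n).-integrable setT (EFin \o f \o @col_of_tuple n).

(* [Rintegral] is a junk value on functions that are not integrable, so this is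
   only meaningful under [integrable_Rn f] (Gaussians satisfy it). *)
Definition integral_Rn (n : nat) (f : 'cV[R]_n -> R) : R :=
  \int[lebesgue_Rn n]_t f (col_of_tuple t).

End lebesgue_Rn.
Arguments lebesgue_Rn : clear implicits.

Lemma lebesgue_Rn_box (R : realType) (n : nat)
    (B : 'I_n -> set (measurableTypeR R)) :
  (forall i, measurable (B i)) ->
  lebesgue_Rn R n [set t | forall i, B i (tnth t i)] =
    (\prod_(i < n) lebesgue_measure (B i))%E.
Proof.
have mbox n' (B' : 'I_n' -> set (measurableTypeR R)) :
    (forall i, measurable (B' i)) ->
    measurable [set t : n'.-tuple (measurableTypeR R) |
      forall i, B' i (tnth t i)].
  move=> mB.
  rewrite (_ : [set _ | _] = \bigcap_(i in [set` predT])
      ((fun t : n'.-tuple (measurableTypeR R) => tnth t i) @^-1` B' i));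
      last first.
    by apply/seteqP; split => t /= h i //=; exact: h.
  apply: fin_bigcap_measurable => // i _; rewrite -[X in measurable X]setTI.
  by apply: (measurable_tnth (T := measurableTypeR R)) => //.
move=> mB.
rewrite /lebesgue_Rn /completed_measure_extension /= measurable_mu_extE; last exact: mbox.
elim: n B mB => [|n IH] B mB.
  by rewrite big_ord0 /= diracE mem_set// => -[].
rewrite big_ord_recl -(IH (fun i => B (lift ord0 i)))//.
have mb := mbox n (fun i => B (lift ord0 i)) (fun i => mB _).
rewrite -(product_measure1E lebesgue_measure (lebesgue_tuple R n) (mB ord0) mb).
rewrite /= /cons_measure /pushforward; congr product_measure1.
apply/seteqP; split => -[x t] /=.
  by move=> h; split; [exact: (h ord0)|move=> i; have := h (lift ord0 i); rewrite tnthS].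
move=> [h1 h2] i; case: (unliftP ord0 i) => [j ->|->]; last exact: h1.
rewrite tnthS; exact: h2.
Qed.

Section gaussians.
Variable R : realType.

Definition qform (n : nat) (A : 'M[R]_n) (x : 'cV[R]_n) : R :=
  (x^T *m (A *m x)) 0 0.

Definition symmetric_mx (n : nat) (A : 'M[R]_n) : Prop := A^T = A.

Definition posdef_mx (n : nat) (A : 'M[R]_n) : Prop :=
  symmetric_mx A /\ forall x : 'cV[R]_n, x != 0 -> 0 < qform A x.

Definition gaussian (n : nat) (A : 'M[R]_n) (x : 'cV[R]_n) : R :=
  expR (- (2^-1 * qform A x)).

(* The point (x_1, ..., x_m) of R^N is the block column [\mxcol_i x i]. *)
Definition dominated (m : nat) (n : 'I_m -> nat) (c : 'I_m -> R)
    (Q : 'M[R]_(\sum_(i < m) n i)) (f : forall i, 'cV[R]_(n i) -> R) : Prop :=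
  forall x : forall i, 'cV[R]_(n i),
    \prod_(i < m) f i (x i) `^ c i <= expR (- qform Q (\mxcol_i x i)).

End gaussians.

(* Main.v *)
From HB Require Import structures.
From mathcomp Require Import all_boot all_order all_algebra.
From mathcomp Require Import all_classical all_reals all_analysis.
From mathcomp Require Import measurable_realfun ring lra.
Require Import Defs.

(** The functions may be normalized to have integral 1. The claim then reads: the
    least [K] such that [\prod_i f_i ^ c_i <= K * expR (- qform Q x)] for some even
    densities [f_i] is approached by Gaussian densities.

    Doubling keeps near-optimal tuples near-optimal. If [X] and [X'] are independent
    with density [f], then [(X + X') / sqrt 2] has at [x] the density
    [\int f ((x + y) / sqrt 2) * f ((x - y) / sqrt 2) dy]. For fixed [x] the integrand
    is even in [y], whatever [f] is, and by invariance of the form under the rotation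
    by 45 degrees the tuple of these integrands satisfies, after normalization, the
    same kind of constraint. Bounding its constant from below by the optimal one,
    [cost], shows that doubling all the [f_i] turns the constant [K] into at most
    [K ^+ 2 / cost] ([feasible_doubling]). By the central limit theorem, in a
    quantitative form obtained by exchanging one factor at a time
    ([iter_doubling_mean_le]), iterated doubling drives a density towards the Gaussian
    with the same covariance.

    If the diagonal blocks of the form are positive definite, near-optimal tuples are
    compact. Evenness allows the sign of each [x_i] to be flipped, which removes the
    off-diagonal blocks from the constraint ([feasible_ratio]) and places all
    near-optimal densities below fixed Gaussians ([feasible_le_envelope]). Their
    covariances are then bounded, with fourth moments, and nondegenerate
    ([second_moment_floor]), and have a positive definite limit
    ([near_optimal_limit]). The required number [k] of doublings only depends on the
    accuracy wanted, so it may be fixed before a tuple with [K / cost] so close to 1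
    that [(K / cost) ^+ (2 ^ k)] is still close to 1. A density has, close to any
    point, a value no smaller than its average there, so the constraint, with the
    constant [cost], passes to the Gaussian densities with the limiting covariances
    ([gdens_cost]), and homogeneity separates this into the constraint without
    constant and a bound on the integrals ([Gaussian_saturation_block_pos]).

    If some diagonal block takes a negative value, Gaussians may be elongated in that
    direction and the supremum is infinite ([negative_block_unbounded]). If the blocks
    are only semidefinite, a small multiple of the identity is added to the form and
    the functions are truncated and multiplied by a wide Gaussian, which loses
    an arbitrarily small factor ([saturation_up_to_factor]). As the constraint holds at
    every point, Lebesgue measurable functions are replaced by Borel functions below
    them ([even_Borel_minorant]). *)

Set Implicit Arguments.
Unset Strict Implicit.
Unset Printing Implicit Defensive.

Import Order.TTheory GRing.Theory Num.Theory.
Import numFieldNormedType.Exports.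

Local Open Scope classical_set_scope.
Local Open Scope ring_scope.

(** * Integration over column vectors *)

Section vector_integral.
Context {R : realType}.
Local Notation B := (measurableTypeR R).

Definition tuple_of_col (n : nat) (v : 'cV[R]_n) : n.-tuple B :=
  [tuple v i 0 | i < n].

Lemma tuple_of_colK (n : nat) (v : 'cV[R]_n) : col_of_tuple (tuple_of_col v) = v.
Proof. by apply/colP => i; rewrite mxE tnth_mktuple. Qed.

Lemma col_of_tupleK (n : nat) (t : n.-tuple B) : tuple_of_col (col_of_tuple t) = t.
Proof. by apply/eq_from_tnth => i; rewrite tnth_mktuple mxE. Qed.

(** Column vectors carry no sigma-algebra here: measurability is transported from
    tuples, where Lebesgue measure is defined. *)
Definition vmeas d (S : measurableType d) (n : nat) (f : 'cV[R]_n -> S) : Prop :=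
  measurable_fun setT (fun t : n.-tuple B => f (col_of_tuple t)).

Definition Int (n : nat) (f : 'cV[R]_n -> \bar R) : \bar R :=
  (\int[lebesgue_tuple R n]_t f (col_of_tuple t))%E.

(** Lebesgue measure is |s| times its image under [x |-> s * x + b], since the two
    agree on intervals. *)
Lemma lebesgue_affine (s b : R) (f : B -> \bar R) : s != 0 ->
  measurable_fun setT f -> (forall x, 0 <= f x)%E ->
  (\int[lebesgue_measure]_x f (s * x + b)%R = `|s|^-1%:E * \int[lebesgue_measure]_x f x)%E.
Proof.
move=> s0 mf f0.
have s_gt0 : 0 < `|s| by rewrite normr_gt0.
pose phi : B -> B := fun x => s * x + b.
have mphi : measurable_fun setT phi.
  by apply: measurable_funD => //; apply: measurable_funM.
have r0 : 0 <= `|s| by rewrite ltW.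
pose nu' := mscale (NngNum r0) (pushforward lebesgue_measure phi).
pose nu := nu' mphi.
have nuE A : measurable A -> @lebesgue_measure R A = nu A.
  move=> mA; apply: lebesgue_measure_unique => // _ [[x y]] _ <-.
  rewrite /nu /nu' /= /mscale/= /pushforward.
  rewrite lebesgue_measure_itv/= lte_fin.
  have [s_pos|s_neg] : 0 < s \/ s < 0.
    by move: s0; rewrite neq_lt => /orP[]; auto.
  - rewrite [X in (_ * lebesgue_measure X)%E](_ : _ = `]((x - b) / s), ((y - b) / s)]%classic); last first.
      apply/seteqP; split => z /=; rewrite !in_itv/= /phi.
        by rewrite ltr_pdivrMr// ler_pdivlMr// ltrBlDr lerBrDr mulrC.
      by rewrite ltr_pdivrMr// ler_pdivlMr// ltrBlDr lerBrDr mulrC.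
    rewrite lebesgue_measure_itv/= lte_fin ltr_pM2r ?invr_gt0// ltrBlDr subrK.
    case: ifPn => _; last by rewrite mule0.
    rewrite -!EFinB -EFinM; congr EFin.
    by rewrite gtr0_norm// -mulrBl mulrC divfK ?gt_eqF//; ring.
  - rewrite [X in (_ * lebesgue_measure X)%E](_ : _ = `[((y - b) / s), ((x - b) / s)[%classic); last first.
      apply/seteqP; split => z /=; rewrite !in_itv/= /phi andbC.
        by rewrite ltr_ndivlMr// ler_ndivrMr// ltrBlDr lerBrDr mulrC.
      by rewrite ltr_ndivlMr// ler_ndivrMr// ltrBlDr lerBrDr mulrC.
    rewrite lebesgue_measure_itv/= lte_fin ltr_nM2r ?invr_lt0// ltrBlDr subrK.
    case: ifPn => _; last by rewrite mule0.
    rewrite -!EFinB -EFinM; congr EFin.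
    by rewrite ltr0_norm//; field.
have -> : (\int[lebesgue_measure]_x f x = \int[nu]_x f x)%E.
  by apply: eq_measure_integral => A mA _; exact: nuE.
rewrite /nu /nu' ge0_integral_mscale// ge0_integral_pushforward//.
rewrite preimage_setT/= muleA -EFinM mulVf ?gt_eqF// mul1e.
by [].
Qed.

(** Tonelli's theorem for the inductive construction of Lebesgue measure: it
    reduces integrals over R^n.+1 to iterated ones. *)
Lemma ge0_integral_cons (n : nat) (F : n.+1.-tuple B -> \bar R) :
  measurable_fun setT F -> (forall t, 0 <= F t)%E ->
  (\int[lebesgue_tuple R n.+1]_t F t =
   \int[lebesgue_measure]_x \int[lebesgue_tuple R n]_t F [tuple of x :: t])%E.
Proof.
move=> mF F0.
rewrite [LHS](@ge0_integral_pushforward _ _ _ _ _ _ measurable_cons_pair)//.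
rewrite preimage_setT fubini_tonelli1//.
  by apply: measurableT_comp => //; exact: measurable_cons_pair.
by move=> x; exact: F0.
Qed.

Lemma measurable_section_cons (n : nat) (F : n.+1.-tuple B -> \bar R) :
  measurable_fun setT F -> (forall t, 0 <= F t)%E ->
  measurable_fun setT
    (fun x : B => \int[lebesgue_tuple R n]_t F [tuple of x :: t])%E.
Proof.
move=> mF F0.
have mG := measurableT_comp mF (@measurable_cons_pair R n).
exact: (measurable_fun_fubini_tonelli_F _ mG (fun p => F0 (cons_pair p))).
Qed.

Lemma integral_tuple_affine (n : nat) (s : R) (c : n.-tuple B)
    (F : n.-tuple B -> \bar R) : s != 0 ->
  measurable_fun setT F -> (forall t, 0 <= F t)%E ->
  (\int[lebesgue_tuple R n]_t F [tuple (s * tnth t i + tnth c i)%R | i < n] =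
   (`|s|^-1 ^+ n)%:E * \int[lebesgue_tuple R n]_t F t)%E.
Proof.
move=> s0; elim: n c F => [|n IH] c F mF F0.
  rewrite expr0 mul1e; apply: eq_integral => t _; congr F.
  by rewrite tuple0 [RHS]tuple0.
have mcons (x : B) : measurable_fun setT (fun t : n.-tuple B => [tuple of x :: t]).
  by apply: measurable_cons => //; exact: measurable_cst.
have mFx (x : B) : measurable_fun setT (fun t : n.-tuple B => F [tuple of x :: t]).
  exact: measurableT_comp mF (mcons x).
have consE (x : B) (t : n.-tuple B) :
    [tuple s * tnth [tuple of x :: t] i + tnth c i | i < n.+1] =
    [tuple of (s * x + thead c) :: [tuple s * tnth t i + tnth [tuple of behead c] i | i < n]].
  apply/eq_from_tnth => i; rewrite tnth_mktuple.
  case: (unliftP ord0 i) => [j ->|->]; last by rewrite !tnth0.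
  rewrite !tnthS tnth_mktuple; congr (_ + _).
  by rewrite [in LHS](tuple_eta c) tnthS.
have maff : measurable_fun setT
    (fun t : n.+1.-tuple B => [tuple s * tnth t i + tnth c i | i < n.+1]).
  apply/measurable_fun_tnthP => i.
  rewrite (_ : _ \o _ = fun t => s * tnth t i + tnth c i); last first.
    by apply/funext => t /=; rewrite tnth_mktuple.
  apply: measurable_funD => //; apply: measurable_funM => //.
  exact: measurable_tnth.
rewrite ge0_integral_cons//; last by apply: measurableT_comp.
under eq_integral => x _.
  under eq_integral => t _ do rewrite consE.
  rewrite (IH _ _ (mFx (s * x + thead c)) (fun t => F0 _)).
  over.
rewrite [X in (_ * X)%E]ge0_integral_cons//.
have Hm := measurable_section_cons mF F0.
have H0 (x : B) : (0 <= \int[lebesgue_tuple R n]_t F [tuple of x :: t])%E.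
  by apply: integral_ge0 => t _; exact: F0.
have mlin : measurable_fun setT (fun x : B => (s * x + thead c : B)).
  by apply: measurable_funD => //; exact: measurable_funM.
have sn0 : 0 <= `|s|^-1 ^+ n by rewrite exprn_ge0// invr_ge0.
rewrite (ge0_integralZl_EFin _ measurableT (fun x _ => H0 _) (measurableT_comp Hm mlin) sn0).
rewrite (lebesgue_affine (thead c) s0 Hm H0) muleA -EFinM; congr (_%:E * _)%E.
by rewrite exprSr.
Qed.

(** The only change of variables needed: rotations of R^n x R^n are reduced to it
    by exchanging integrals. *)
Lemma Int_affine (n : nat) (s : R) (c : 'cV[R]_n) (f : 'cV[R]_n -> \bar R) :
  s != 0 -> vmeas f -> (forall x, 0 <= f x)%E ->
  Int (fun x => f (s *: x + c)) = ((`|s|^-1 ^+ n)%:E * Int f)%E.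
Proof.
move=> s0 mf f0; rewrite /Int -(@integral_tuple_affine _ _ (tuple_of_col c))//.
apply: eq_integral => t _; congr f; apply/colP => i.
by rewrite !mxE tnth_mktuple tnth_mktuple.
Qed.

(** Joint measurability, the hypothesis of Tonelli's theorem in two vector
    variables. *)
Definition vmeas2 d (S : measurableType d) (n : nat)
    (f : 'cV[R]_n -> 'cV[R]_n -> S) : Prop :=
  measurable_fun setT (fun p : n.-tuple B * n.-tuple B =>
    f (col_of_tuple p.1) (col_of_tuple p.2)).

Lemma vmeas2_lin d (S : measurableType d) (n : nat) (f : 'cV[R]_n -> S) (a b : R) :
  vmeas f -> vmeas2 (fun x y => f (a *: x + b *: y)).
Proof.
move=> mf; pose phi (p : n.-tuple B * n.-tuple B) : n.-tuple B :=
  [tuple a * tnth p.1 i + b * tnth p.2 i | i < n].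
have mphi : measurable_fun setT phi.
  apply/measurable_fun_tnthP => i.
  rewrite (_ : _ \o _ = fun p : n.-tuple B * n.-tuple B =>
      a * tnth p.1 i + b * tnth p.2 i); last first.
    by apply/funext => t /=; rewrite tnth_mktuple.
  apply: measurable_funD; apply: measurable_funM => //.
    by apply: (measurableT_comp (measurable_tnth i)).
  by apply: (measurableT_comp (measurable_tnth i)).
rewrite /vmeas2 (_ : (fun _ => _) = (fun t => f (col_of_tuple t)) \o phi).
  exact: measurableT_comp.
apply/funext => p /=; congr f; apply/colP => i.
by rewrite !mxE tnth_mktuple.
Qed.

Lemma vmeas2_section d (S : measurableType d) (n : nat)
    (f : 'cV[R]_n -> 'cV[R]_n -> S) (x : 'cV[R]_n) :
  vmeas2 f -> vmeas (f x).
Proof.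
move=> mf; rewrite -(tuple_of_colK x).
exact: (measurableT_comp mf (@pair1_measurable _ _ _ _ (tuple_of_col x))).
Qed.

Lemma vmeas2C d (S : measurableType d) (n : nat) (f : 'cV[R]_n -> 'cV[R]_n -> S) :
  vmeas2 f -> vmeas2 (fun x y => f y x).
Proof.
move=> mf.
exact: (measurableT_comp mf (@measurable_swap _ _ _ _)).
Qed.

Lemma vmeas2_fst d (S : measurableType d) (n : nat) (f : 'cV[R]_n -> S) :
  vmeas f -> vmeas2 (fun x _ => f x).
Proof. by move=> mf; exact: (measurableT_comp mf measurable_fst). Qed.

Lemma vmeas2_snd d (S : measurableType d) (n : nat) (f : 'cV[R]_n -> S) :
  vmeas f -> vmeas2 (fun _ x => f x).
Proof. by move=> mf; exact: (measurableT_comp mf measurable_snd). Qed.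

Lemma vmeas_affine d (S : measurableType d) (n : nat) (f : 'cV[R]_n -> S) (s : R)
    (c : 'cV[R]_n) :
  vmeas f -> vmeas (fun x => f (s *: x + c)).
Proof.
move=> /(vmeas2_lin s 1)/vmeas2C/(vmeas2_section c).
by rewrite scale1r.
Qed.

Lemma Int_swap (n : nat) (f : 'cV[R]_n -> 'cV[R]_n -> \bar R) :
  vmeas2 f -> (forall x y, 0 <= f x y)%E ->
  Int (fun x => Int (f x)) = Int (fun y => Int (fun x => f x y)).
Proof.
move=> mf f0.
by rewrite /Int (fubini_tonelli _ mf).
Qed.

Lemma vmeas_Int (n : nat) (f : 'cV[R]_n -> 'cV[R]_n -> \bar R) :
  vmeas2 f -> (forall x y, 0 <= f x y)%E -> vmeas (fun x => Int (f x)).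
Proof.
by move=> mf f0; exact: (measurable_fun_fubini_tonelli_F _ mf).
Qed.

End vector_integral.

(** * Euclidean norm, quadratic forms and isotropic Gaussian integrals *)

Section vector_functions.
Context {R : realType}.
Local Notation B := (measurableTypeR R).

Definition nsq (n : nat) (x : 'cV[R]_n) : R := \sum_i x i 0 ^+ 2.

Definition dot (n : nat) (x y : 'cV[R]_n) : R := \sum_i x i 0 * y i 0.

Lemma nsq_ge0 n (x : 'cV[R]_n) : 0 <= nsq x.
Proof. by apply: sumr_ge0 => i _; exact: sqr_ge0. Qed.

Lemma nsqE n (x : 'cV[R]_n) : nsq x = dot x x.
Proof. by apply: eq_bigr => i _; rewrite expr2. Qed.

Lemma dotC n (x y : 'cV[R]_n) : dot x y = dot y x.
Proof. by apply: eq_bigr => i _; rewrite mulrC. Qed.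

Lemma dotDl n (x y z : 'cV[R]_n) : dot (x + y) z = dot x z + dot y z.
Proof. by rewrite -big_split; apply: eq_bigr => i _; rewrite !mxE mulrDl. Qed.

Lemma dotZl n (a : R) (x z : 'cV[R]_n) : dot (a *: x) z = a * dot x z.
Proof. by rewrite mulr_sumr; apply: eq_bigr => i _; rewrite !mxE mulrA. Qed.

Lemma dotDr n (x y z : 'cV[R]_n) : dot z (x + y) = dot z x + dot z y.
Proof. by rewrite !(dotC z) dotDl. Qed.

Lemma dotZr n (a : R) (x z : 'cV[R]_n) : dot z (a *: x) = a * dot z x.
Proof. by rewrite !(dotC z) dotZl. Qed.

Lemma dotNl n (x z : 'cV[R]_n) : dot (- x) z = - dot x z.
Proof. by rewrite -scaleN1r dotZl mulN1r. Qed.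

Lemma dotNr n (x z : 'cV[R]_n) : dot z (- x) = - dot z x.
Proof. by rewrite !(dotC z) dotNl. Qed.

Lemma nsqD n (x y : 'cV[R]_n) : nsq (x + y) = nsq x + 2 * dot x y + nsq y.
Proof. by rewrite !nsqE dotDl !dotDr (dotC y x); ring. Qed.

Lemma nsqZ n (a : R) (x : 'cV[R]_n) : nsq (a *: x) = a ^+ 2 * nsq x.
Proof. by rewrite !nsqE dotZl dotZr mulrA expr2. Qed.

Lemma nsqN n (x : 'cV[R]_n) : nsq (- x) = nsq x.
Proof. by rewrite -scaleN1r nsqZ sqrrN expr1n mul1r. Qed.

Lemma nsq_eq0 n (x : 'cV[R]_n) : (nsq x == 0) = (x == 0).
Proof.
rewrite psumr_eq0; last by move=> i _; exact: sqr_ge0.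
apply/allP/eqP => [h|->].
  by apply/colP => i; have /(_ (mem_index_enum i)) := h i; rewrite sqrf_eq0 mxE => /eqP.
by move=> i _; rewrite mxE expr0n eqxx.
Qed.

Lemma nsq_gt0 n (x : 'cV[R]_n) : (0 < nsq x) = (x != 0).
Proof. by rewrite lt_def nsq_ge0 andbT nsq_eq0. Qed.

Lemma nsq0 n : nsq (0 : 'cV[R]_n) = 0.
Proof. by apply/eqP; rewrite nsq_eq0. Qed.

(** Nonnegativity of [nsq (nsq y *: x - dot x y *: y)]. *)
Lemma dot_CauchySchwarz n (x y : 'cV[R]_n) : dot x y ^+ 2 <= nsq x * nsq y.
Proof.
have [->|y0] := eqVneq y 0.
  by rewrite nsq0 mulr0 -(scale0r (0 : 'cV[R]_n)) dotZr mul0r expr0n.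
have ny : 0 < nsq y by rewrite nsq_gt0.
have := nsq_ge0 (nsq y *: x + (- dot x y) *: y).
rewrite nsqD !nsqZ dotZl dotZr => h.
have : 0 <= nsq y * (nsq x * nsq y - dot x y ^+ 2) by nra.
by rewrite pmulr_rge0// subr_ge0.
Qed.

Lemma dot_le n (t : R) (x y : 'cV[R]_n) : 0 < t ->
  2 * `|dot x y| <= t * nsq x + nsq y / t.
Proof.
move=> t0.
have e1 := nsq_ge0 (t *: x + y); have e2 := nsq_ge0 (t *: x - y).
rewrite nsqD nsqZ dotZl in e1; rewrite nsqD nsqZ nsqN dotZl dotNr in e2.
rewrite -(ler_pM2l t0) mulrDr [t * (nsq y / t)]mulrC divfK ?gt_eqF//.
by case: (ger0P (dot x y)) => _; nra.
Qed.

Lemma coord_sqr_le n (x : 'cV[R]_n) i : x i 0 ^+ 2 <= nsq x.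
Proof. by rewrite /nsq (bigD1 i)//= lerDl sumr_ge0// => j _; exact: sqr_ge0. Qed.

Lemma qformE n (A : 'M[R]_n) (x : 'cV[R]_n) : qform A x = dot x (A *m x).
Proof. by rewrite /qform mxE; apply: eq_bigr => i _; rewrite mxE. Qed.

Lemma dot_mulmx n (A : 'M[R]_n) (x y : 'cV[R]_n) : dot x (A *m y) = dot (A^T *m x) y.
Proof.
rewrite /dot; under eq_bigr do rewrite mxE mulr_sumr.
rewrite exchange_big; apply: eq_bigr => j _.
rewrite [(A^T *m x) j 0]mxE mulr_suml.
by apply: eq_bigr => i _; rewrite [A^T j i]mxE; ring.
Qed.

Lemma dot_sym n (A : 'M[R]_n) (x y : 'cV[R]_n) : symmetric_mx A ->
  dot x (A *m y) = dot y (A *m x).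
Proof. by move=> sA; rewrite dot_mulmx sA dotC. Qed.

Lemma qform_sum n (A : 'M[R]_n) (x : 'cV[R]_n) :
  qform A x = \sum_i \sum_j A i j * (x i 0 * x j 0).
Proof.
rewrite qformE; apply: eq_bigr => i _; rewrite mxE mulr_sumr.
by apply: eq_bigr => j _; rewrite mulrCA.
Qed.

Lemma qform0 n (A : 'M[R]_n) : qform A 0 = 0.
Proof. by rewrite qform_sum big1// => i _; rewrite big1// => j _; rewrite mxE mul0r mulr0. Qed.

Lemma qform_add_scalar n (A : 'M[R]_n) (a : R) x :
  qform (A + a%:M) x = qform A x + a * nsq x.
Proof. by rewrite !qformE mulmxDl dotDr mul_scalar_mx dotZr nsqE. Qed.

Lemma qform_scalar n (a : R) (x : 'cV[R]_n) : qform a%:M x = a * nsq x.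
Proof. by rewrite qformE mul_scalar_mx dotZr -nsqE. Qed.

Lemma qformZ n (A : 'M[R]_n) (a : R) (x : 'cV[R]_n) :
  qform A (a *: x) = a ^+ 2 * qform A x.
Proof. by rewrite !qformE -scalemxAr dotZl dotZr mulrA expr2. Qed.

Lemma qformN n (A : 'M[R]_n) (x : 'cV[R]_n) : qform A (- x) = qform A x.
Proof. by rewrite -scaleN1r qformZ sqrrN expr1n mul1r. Qed.

Lemma qformD n (A : 'M[R]_n) (x y : 'cV[R]_n) :
  qform A (x + y) = qform A x + (dot x (A *m y) + dot y (A *m x)) + qform A y.
Proof. by rewrite !qformE mulmxDr dotDl !dotDr; ring. Qed.

Lemma qform_parallelogram n (A : 'M[R]_n) (x y : 'cV[R]_n) :
  qform A (x + y) + qform A (x - y) = 2 * (qform A x + qform A y).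
Proof. by rewrite !qformD qformN mulmxN dotNl dotNr; ring. Qed.

(** With [s = 1 / sqrt 2] the map (x, y) |-> (s (x + y), s (x - y)) is a rotation by
    45 degrees of R^n x R^n, under which A + A is invariant. *)
Lemma qform_rotate n (A : 'M[R]_n) (s : R) (x y : 'cV[R]_n) : s ^+ 2 = 2^-1 ->
  qform A (s *: (x + y)) + qform A (s *: (x - y)) = qform A x + qform A y.
Proof.
move=> s2; rewrite !qformZ -mulrDr qform_parallelogram s2 mulrA.
by rewrite mulVf ?mul1r// pnatr_eq0.
Qed.

(** The sum of the absolute values of the entries is a crude but sufficient bound
    for the operator norm. *)
Lemma qform_le n (A : 'M[R]_n) :
  exists2 L, 0 <= L & forall x, `|qform A x| <= L * nsq x.
Proof.
exists (\sum_i \sum_j `|A i j|).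
  by apply: sumr_ge0 => i _; apply: sumr_ge0.
move=> x; rewrite qform_sum mulr_suml; apply: (le_trans (ler_norm_sum _ _ _)).
apply: ler_sum => i _; rewrite mulr_suml; apply: (le_trans (ler_norm_sum _ _ _)).
apply: ler_sum => j _; rewrite normrM ler_wpM2l//.
have hi := coord_sqr_le x i; have hj := coord_sqr_le x j.
have e1 := sqr_ge0 (x i 0 + x j 0); have e2 := sqr_ge0 (x i 0 - x j 0).
by case: (ger0P (x i 0 * x j 0)) => _; nra.
Qed.

Lemma qform_near n (A : 'M[R]_n) (x : 'cV[R]_n) (e : R) : 0 < e ->
  exists2 r, 0 < r & forall y, nsq (y - x) < r -> `|qform A y - qform A x| <= e.
Proof.
move=> e0; have [L L0 hL] := qform_le A.
pose u := A *m x + A^T *m x.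
pose t := e / (nsq u + 1).
have u0 := nsq_ge0 u.
have t0 : 0 < t by rewrite divr_gt0// ltr_wpDl.
have tu : t * nsq u <= e.
  by rewrite /t mulrAC ler_pdivrMr ?ltr_wpDl// ler_wpM2l ?(ltW e0)// lerDl.
exists (e / (t^-1 + 2 * L + 1)).
  by rewrite divr_gt0// ltr_wpDl// addr_ge0// ?invr_ge0 ?(ltW t0)// mulr_ge0.
have ti0 : 0 < t^-1 by rewrite invr_gt0.
move=> y; rewrite -{2}[y](subrK x); move: (y - x) => z.
rewrite ltr_pdivlMr; last by rewrite ltr_wpDl// addr_ge0// ?(ltW ti0)// mulr_ge0.
move=> hz.
have -> : qform A (z + x) - qform A x = dot u z + qform A z.
  rewrite qformD /u dotDl.
  by rewrite (dot_mulmx A x z) (dotC z (A *m x)); ring.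
have h1 := dot_le u z t0; have h2 := hL z.
have := ler_normD (dot u z) (qform A z).
have z0 := nsq_ge0 z.
rewrite [nsq z / t]mulrC in h1.
nra.
Qed.

Lemma vmeas_coord n (i : 'I_n) : vmeas (fun x : 'cV[R]_n => x i 0 : B).
Proof.
rewrite /vmeas (_ : (fun _ => _) = (@tnth _ _)^~ i); last first.
  by apply/funext => t; rewrite mxE.
exact: measurable_tnth.
Qed.

Lemma vmeas_nsq n : vmeas (@nsq n : 'cV[R]_n -> B).
Proof.
apply: measurable_sum => i; apply: measurable_funX; exact: vmeas_coord.
Qed.

Lemma vmeas_dot n (y : 'cV[R]_n) : vmeas ((fun x => dot x y) : 'cV[R]_n -> B).
Proof.
apply: measurable_sum => i; apply: measurable_funM; first exact: vmeas_coord.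
exact: measurable_cst.
Qed.

Lemma vmeas_qform n (A : 'M[R]_n) : vmeas (qform A : 'cV[R]_n -> B).
Proof.
rewrite (_ : qform A = fun x => \sum_i \sum_j A i j * (x i 0 * x j 0)); last first.
  by apply/funext => x; rewrite qform_sum.
apply: measurable_sum => i; apply: measurable_sum => j.
apply: measurable_funM; first exact: measurable_cst.
by apply: measurable_funM; exact: vmeas_coord.
Qed.

Lemma vmeas_EFin n (f : 'cV[R]_n -> R) :
  vmeas (f : _ -> B) -> vmeas (fun x => (f x)%:E).
Proof. by move=> mf; apply/measurable_EFinP. Qed.

Lemma Int_ge0 n (f : 'cV[R]_n -> \bar R) : (forall x, 0 <= f x)%E -> (0 <= Int f)%E.
Proof. by move=> f0; apply: integral_ge0 => t _. Qed.

Lemma le_Int n (f g : 'cV[R]_n -> \bar R) : (forall x, 0 <= f x)%E ->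
  vmeas f -> vmeas g -> (forall x, f x <= g x)%E -> (Int f <= Int g)%E.
Proof. by move=> f0 mf mg fg; apply: ge0_le_integral. Qed.

Lemma eq_Int n (f g : 'cV[R]_n -> \bar R) : f =1 g -> Int f = Int g.
Proof. by move=> fg; apply: eq_integral => t _; exact: fg. Qed.

Lemma IntZl n (k : R) (f : 'cV[R]_n -> \bar R) : 0 <= k -> (forall x, 0 <= f x)%E ->
  vmeas f -> Int (fun x => k%:E * f x)%E = (k%:E * Int f)%E.
Proof. by move=> k0 f0 mf; apply: ge0_integralZl_EFin. Qed.

Lemma IntD n (f g : 'cV[R]_n -> \bar R) : (forall x, 0 <= f x)%E ->
  (forall x, 0 <= g x)%E -> vmeas f -> vmeas g ->
  Int (fun x => f x + g x)%E = (Int f + Int g)%E.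
Proof. by move=> f0 g0 mf mg; apply: ge0_integralD. Qed.

Lemma Int_translate n (c : 'cV[R]_n) (f : 'cV[R]_n -> \bar R) :
  vmeas f -> (forall x, 0 <= f x)%E -> Int (fun x => f (x + c)) = Int f.
Proof.
move=> mf f0; have := @Int_affine R n 1 c f (oner_neq0 _) mf f0.
rewrite normr1 invr1 expr1n mul1e => <-.
by apply: eq_Int => x; rewrite scale1r.
Qed.

Lemma Int_opp n (f : 'cV[R]_n -> \bar R) :
  vmeas f -> (forall x, 0 <= f x)%E -> Int (fun x => f (- x)) = Int f.
Proof.
move=> mf f0; have m1 : (-1 : R) != 0 by rewrite oppr_eq0 oner_neq0.
have := @Int_affine R n (-1) 0 f m1 mf f0.
rewrite normrN1 invr1 expr1n mul1e => <-.
by apply: eq_Int => x; rewrite addr0 scaleN1r.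
Qed.

Lemma nsq_cons n (x : B) (t : n.-tuple B) :
  nsq (col_of_tuple [tuple of x :: t]) = x ^+ 2 + nsq (col_of_tuple t).
Proof.
rewrite /nsq big_ord_recl mxE tnth0; congr (_ + _).
by apply: eq_bigr => i _; rewrite !mxE tnthS.
Qed.

Lemma integral_expR_sqr (l : R) : 0 < l ->
  (\int[@lebesgue_measure R]_x (expR (- (l * x ^+ 2)))%:E < +oo)%E.
Proof.
move=> l0; pose s := Num.sqrt l; have s0 : 0 < s by rewrite sqrtr_gt0.
have mg : measurable_fun setT (EFin \o (@gauss_fun R) : B -> \bar R).
  by apply/measurable_EFinP; exact: measurable_gauss_fun.
have h := @lebesgue_affine R s 0 (EFin \o @gauss_fun R) (lt0r_neq0 s0) mg _.
rewrite (eq_integral (fun x : B => (EFin \o @gauss_fun R) (s * x + 0))).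
  rewrite h//; last by move=> x; rewrite lee_fin expR_ge0.
  by rewrite integralT_gauss -EFinM ltry.
by move=> x _ /=; rewrite /gauss_fun addr0 exprMn sqr_sqrtr// ltW.
Qed.

Lemma vmeas_gauss n (l : R) : vmeas (fun x : 'cV[R]_n => (expR (- (l * nsq x)))%:E).
Proof.
apply/measurable_EFinP; apply: measurableT_comp => //.
by apply: measurableT_comp => //; apply: measurable_funM => //; exact: vmeas_nsq.
Qed.

Lemma Int_gauss_fin n (l : R) : 0 < l ->
  (Int (fun x : 'cV[R]_n => (expR (- (l * nsq x)))%:E) < +oo)%E.
Proof.
move=> l0.
have g0 k (x : 'cV[R]_k) : (0 <= (expR (- (l * nsq x)))%:E)%E by rewrite lee_fin expR_ge0.
elim: n => [|n IH].
  by rewrite /Int (integral_dirac _ _ (@vmeas_gauss 0 l))// diracT mul1e ltry.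
rewrite /Int ge0_integral_cons; last 2 first.
- exact: vmeas_gauss.
- by move=> t; rewrite lee_fin expR_ge0.
pose J := Int (fun x : 'cV[R]_n => (expR (- (l * nsq x)))%:E).
rewrite (eq_integral (fun x : B => (expR (- (l * x ^+ 2)))%:E * J)%E); last first.
  move=> x _; rewrite /J -IntZl ?expR_ge0//; last exact: vmeas_gauss.
  by apply: eq_integral => t _; rewrite nsq_cons mulrDr opprD expRD EFinM.
have me : measurable_fun setT (fun x : B => (expR (- (l * x ^+ 2)))%:E).
  apply/measurable_EFinP; apply: measurableT_comp => //.
  by apply: measurableT_comp => //; apply: measurable_funM => //; exact: measurable_funX.
rewrite (ge0_integralZr _ _ me)//; last by apply: Int_ge0.
rewrite muleC lte_mul_pinfty ?integral_expR_sqr//; first by apply: Int_ge0.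
by rewrite ge0_fin_numE//; apply: Int_ge0.
Qed.

End vector_functions.

(** * Lebesgue measurable functions and Borel functions *)

Section completion.
Local Open Scope ereal_scope.
Context d (T : measurableType d) (R : realType).
Variable mu : {sigma_finite_measure set T -> \bar R}.
Local Notation cT := (caratheodory_type (mu^*)%mu).
Local Notation cmu := (@completed_measure_extension _ _ _ mu).

Lemma measurable_cara (A : set T) : measurable A -> (measurable : set (set cT)) A.
Proof. by move=> mA; apply: sub_caratheodory; exact: sub_sigma_algebra. Qed.

Lemma measurable_fun_cara d' (S : measurableType d') (f : T -> S) :
  measurable_fun setT f -> measurable_fun setT (f : cT -> S).
Proof. by move=> mf _ B mB; apply: measurable_cara; exact: mf. Qed.

(** The identity is measurable from the completed sigma-algebra to the Borel one and
    pushes the completed measure to the original one. *)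
Lemma completed_integral (f : T -> \bar R) : measurable_fun setT f ->
  (forall x, 0 <= f x) -> \int[cmu]_x f x = \int[mu]_x f x.
Proof.
move=> mf f0.
pose phi : cT -> T := fun x => x.
have mphi : measurable_fun setT phi := measurable_fun_cara (@measurable_id _ T setT).
have h := @ge0_integral_pushforward _ _ _ _ _ phi mphi cmu setT f measurableT mf (fun x _ => f0 x).
rewrite preimage_setT in h; rewrite -[LHS]h.
apply: eq_measure_integral => A mA _.
exact: (@measurable_mu_extE _ _ _ mu A mA).
Qed.

Lemma outer_Borel_hull_fin (X : set T) : (mu^*)%mu X < +oo ->
  exists2 V, measurable V & X `<=` V /\ mu V <= (mu^*)%mu X.
Proof.
move=> Xoo.
have Xfin : (mu^*)%mu X \is a fin_num.
  by rewrite ge0_fin_numE//; exact: outer_measure_ge0.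
have cov (k : nat) : exists U : set T, [/\ measurable U, X `<=` U &
    mu U <= (mu^*)%mu X + (k.+1%:R^-1)%:E].
  have k0 : (0 < k.+1%:R^-1 :> R)%R by rewrite invr_gt0.
  have [_ [F [mF XF] <-] /ltW h] := lb_ereal_inf_adherent k0 Xfin.
  exists (\bigcup_j F j); split => //; first by apply: bigcupT_measurable => j; exact: (mF j).
  by apply: le_trans h; apply: measure_sigma_subadditive => //; apply: bigcupT_measurable.
pose U k := projT1 (cid (cov k)).
have UP k : [/\ measurable (U k), X `<=` U k &
    mu (U k) <= (mu^*)%mu X + (k.+1%:R^-1)%:E] by rewrite /U; case: cid.
exists (\bigcap_k U k).
  by apply: bigcapT_measurable => k; have [] := UP k.
split; first by move=> x Xx k _; have [_ + _] := UP k; exact.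
apply/lee_addgt0Pr => e e0.
have /filter_ex[k /= hk] := near_infty_natSinv_lt (PosNum e0).
have [mU _ h] := UP k.
apply: (@le_trans _ _ (mu (U k))).
  apply: le_measure; rewrite ?inE//.
    by apply: bigcapT_measurable => j; have [] := UP j.
  by move=> x; apply.
by apply: (le_trans h); rewrite leeD2l// lee_fin ltW.
Qed.

(** The complement of a Borel hull of the complement of [E], which is the union of
    hulls of its pieces of finite measure. *)
Lemma Borel_kernel (E : set cT) : (measurable : set (set cT)) E ->
  exists2 A : set T, measurable A & A `<=` E /\ cmu (E `\` A) = 0.
Proof.
move=> mE; have mX : (measurable : set (set cT)) (~` E) by exact: measurableC.
have [F TF Ffin] := sigma_finiteT mu.
have mF i : (measurable : set (set cT)) (F i).
  by apply: measurable_cara; have [] := Ffin i.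
have hull i : exists2 V : set T, d.-measurable V & (~` E `&` F i) `<=` V /\
    cmu (V `\` (~` E `&` F i)) = 0.
  have [mFi Fi] := Ffin i.
  have Xoo : (mu^*)%mu (~` E `&` F i) < +oo.
    apply: (@le_lt_trans _ _ ((mu^*)%mu (F i))).
      by apply: le_outer_measure; exact: subIsetr.
    by rewrite measurable_mu_extE.
  have [V mV [XV hV]] := outer_Borel_hull_fin Xoo.
  exists V => //; split => //.
  have mcV := measurable_cara mV.
  have mXF : (measurable : set (set cT)) (~` E `&` F i) by exact: measurableI.
  have Vle : cmu V <= cmu (~` E `&` F i).
    by rewrite /completed_measure_extension measurable_mu_extE.
  rewrite measureD//=; last first.
    by apply: (le_lt_trans Vle).
  rewrite setIidr//.
  apply/eqP; rewrite eq_le; apply/andP; split.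
    by rewrite sube_le0.
  rewrite sube_ge0; last first.
    by rewrite fin_numElt Xoo (lt_le_trans _ (outer_measure_ge0 (mu^*)%mu _))//.
  by apply: le_outer_measure.
pose V i := projT1 (cid2 (hull i)).
have VP i : d.-measurable (V i) /\ ((~` E `&` F i) `<=` V i /\
    cmu (V i `\` (~` E `&` F i)) = 0) by rewrite /V; case: cid2.
have mV : d.-measurable (\bigcup_i V i) by apply: bigcupT_measurable => i; case: (VP i).
exists (~` (\bigcup_i V i)); first exact: measurableC.
split.
  move=> x /= nV; apply: contrapT => nE; apply: nV.
  have : [set: T] x by [].
  rewrite TF => -[i _ Fx]; exists i => //.
  by have [_ [h _]] := VP i; apply: h.
apply/eqP; rewrite eq_le measure_ge0 andbT.
apply: (@le_trans _ _ ((mu^*)%mu (\bigcup_i (V i `\` (~` E `&` F i))))).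
  apply: le_outer_measure => x [Ex /contrapT[i _ Vx]]; exists i => //; split => //.
  by move=> [].
apply: (le_trans (outer_measure_sigma_subadditive _ _)).
by rewrite eseries0// => i _ _; have [_ [_ h]] := VP i.
Qed.

(** Each rational superlevel set of [f] contains a Borel set of the same measure;
    [h] is the function whose superlevel sets are the unions of these sets, and it
    differs from [f] on a countable union of null sets. *)
Lemma Borel_minorant (f : T -> R) : measurable_fun setT (f : cT -> R) ->
  (forall x, 0 <= f x)%R ->
  exists h : T -> R, [/\ measurable_fun setT h, (forall x, 0 <= h x <= f x)%R &
    \int[mu]_x (h x)%:E = \int[cmu]_x (f x)%:E].
Proof.
move=> mf f0.
pose e (k : nat) : rat := odflt 0%R (unpickle k).
have eK q : e (pickle q) = q by rewrite /e pickleK.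
pose E (k : nat) : set cT := [set x | ratr (e k) < f x]%R.
have mE k : (measurable : set (set cT)) (E k).
  rewrite (_ : E k = setT `&` f @^-1` `]ratr (e k), +oo[%classic).
    by apply: mf.
  by apply/seteqP; split => x /=; rewrite in_itv/= andbT //; tauto.
pose A q := projT1 (cid2 (Borel_kernel (mE q))).
have AP q : measurable (A q) /\ (A q `<=` E q /\ cmu (E q `\` A q) = 0).
  by rewrite /A; case: cid2.
(* the level sets of h are the unions of the Borel kernels of those of f *)
pose S x : set R := [set r | r = 0 \/ exists2 k, A k x & r = ratr (e k)]%R.
have Sub x r : S x r -> (r <= f x)%R.
  move=> [->//|[q Aq ->]]; have [_ [h _]] := AP q; exact/ltW/h.
have Shas x : has_sup (S x).
  by split; [exists 0%R; left|exists (f x) => r; exact: Sub].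
pose h x := sup (S x).
have h0 x : (0 <= h x)%R by apply: ub_le_sup; [case: (Shas x)|left].
have hf x : (h x <= f x)%R.
  by apply: ge_sup; [case: (Shas x)|move=> r; exact: Sub].
have mh : measurable_fun setT h.
  apply: (measurability _ (RGenOInfty.measurableE R)).
  move=> _ [_ [a ->] <-]; rewrite setTI.
  rewrite (_ : _ @^-1` _ = [set x | a < 0]%R `|`
      \bigcup_(k in [set k | a < ratr (e k)]%R) A k).
    apply: measurableU.
      by have [a0|a0] := ltP a 0%R;
        [rewrite (_ : [set _ | _] = setT)//; apply/seteqP; split|
         rewrite (_ : [set _ | _] = set0)//; apply/seteqP; split => //= x; rewrite ltNge a0].
    by apply: bigcup_measurable => q _; case: (AP q).
  apply/seteqP; split => x /=; rewrite in_itv/= andbT.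
    move=> ah; have [r Sr ar] := sup_gt (proj1 (Shas x)) ah.
    by move: Sr ar => [-> a0|[q Aq -> aq]]; [left|right; exists q].
  move=> [a0|[q /= aq Aq]]; first exact: (lt_le_trans a0 (h0 x)).
  by apply: (lt_le_trans aq); apply: ub_le_sup; [case: (Shas x)|right; exists q].
exists h; split => //.
  by move=> x; rewrite h0 hf.
rewrite -completed_integral//; last exact/measurable_EFinP.
apply: ge0_ae_eq_integral; first exact: measurableT.
- by apply/measurable_EFinP; exact: measurable_fun_cara.
- exact/measurable_EFinP.
- by move=> x _; rewrite lee_fin.
- by move=> x _; rewrite lee_fin.
apply: (@negligibleS _ _ _ _ (\bigcup_k (E k `\` A k))); last first.
  apply: negligible_bigcup => k; apply/negligibleP; last by have [_ []] := AP k.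
  by apply: measurableD => //; apply: measurable_cara; case: (AP k).
move=> x /= /not_implyP[_ hfx].
have hltf : (h x < f x)%R.
  by rewrite lt_neqAle hf andbT; apply/eqP => eq_hf; apply: hfx; rewrite eq_hf.
have [q] := rat_in_itvoo hltf; rewrite in_itv/= => /andP[hq qf].
exists (pickle q) => //; rewrite /E/= eK; split => // Aq.
suff : (ratr q <= h x)%R by rewrite leNgt hq.
by apply: ub_le_sup; [case: (Shas x)|right; exists (pickle q) => //; rewrite eK].
Qed.

End completion.

Section euclidean_integrals.
Context {R : realType}.
Local Notation B := (measurableTypeR R).

Lemma integral_Rn_Int n (f : 'cV[R]_n -> R) : (forall x, 0 <= f x) ->
  vmeas (f : _ -> B) -> integral_Rn f = fine (Int (fun x => (f x)%:E)).
Proof.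
move=> f0 mf; rewrite /integral_Rn /Rintegral; congr fine.
rewrite (@completed_integral _ _ _ (lebesgue_tuple R n)
  (fun t => (f (col_of_tuple t))%:E))//.
  by apply/measurable_EFinP.
by move=> t; rewrite lee_fin.
Qed.

(** Null sets are discarded from below, so that pointwise upper bounds on [f]
    are inherited at every point. *)
Lemma even_Borel_minorant n (f : 'cV[R]_n -> R) : (forall x, 0 <= f x) ->
  (forall x, f (- x) = f x) -> integrable_Rn f ->
  exists h : 'cV[R]_n -> R, [/\ vmeas (h : _ -> B), (forall x, 0 <= h x <= f x),
    (forall x, h (- x) = h x) & ((integral_Rn f)%:E <= Int (fun x => (h x)%:E))%E].
Proof.
move=> f0 fN fint.
have mf := measurable_int _ fint.
have [h [mh hf hint]] := @Borel_minorant _ _ _ (lebesgue_tuple R n)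
   (f \o @col_of_tuple R n) (proj1 (measurable_EFinP _ _) mf) (fun t => f0 _).
pose hh (x : 'cV[R]_n) := h (tuple_of_col x).
have mhh : vmeas (hh : _ -> B).
  by rewrite /vmeas /hh; under eq_fun do rewrite col_of_tupleK.
have mhN : vmeas ((fun x => hh (- x)) : _ -> B).
  have := vmeas_affine (-1) 0 mhh.
  by under eq_fun do rewrite addr0 scaleN1r.
exists (fun x => Num.max (hh x) (hh (- x))); split.
- exact: measurable_maxr.
- move=> x; rewrite le_max ge_max.
  have /andP[h0 h1] := hf (tuple_of_col x).
  have /andP[h0' h1'] := hf (tuple_of_col (- x)).
  rewrite /hh h0 /=; move: h1 h1' => /=; rewrite !tuple_of_colK fN => -> ->.
  by [].
- by move=> x; rewrite opprK maxC.
apply: (@le_trans _ _ (Int (fun x => (hh x)%:E))); last first.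
  apply: le_Int.
  - by move=> x; rewrite lee_fin; have /andP[] := hf (tuple_of_col x).
  - exact: vmeas_EFin.
  - by apply: vmeas_EFin; exact: measurable_maxr.
  - by move=> x; rewrite lee_fin le_max lexx.
rewrite /Int /hh; under eq_integral do rewrite col_of_tupleK.
rewrite hint /integral_Rn /Rintegral fineK//.
exact: integrable_fin_num.
Qed.

(** Half of the exponent absorbs the polynomial, so all moments of Gaussians are
    finite. *)
Lemma poly_gauss_le (l s : R) : 0 < l -> 0 <= s ->
  (1 + s) ^+ 2 * expR (- (l * s)) <= (1 + 4 / l) ^+ 2 * expR (- (l / 2 * s)).
Proof.
move=> l0 s0.
have e1 : 1 + l / 4 * s <= expR (l / 4 * s) by exact: expR_ge1Dx.
have l40 : 0 <= 4 / l by rewrite divr_ge0// ltW.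
have e2 : 1 + s <= (1 + 4 / l) * expR (l / 4 * s).
  apply: le_trans (ler_wpM2l _ e1); last by rewrite addr_ge0.
  have : 4 / l * (l / 4 * s) = s by field; rewrite gt_eqF.
  have : 0 <= l / 4 * s by rewrite mulr_ge0// divr_ge0// ltW.
  nra.
have -> : - (l / 2 * s) = l / 4 * s + l / 4 * s - l * s by lra.
rewrite [expR (_ - _)]expRD mulrA ler_wpM2r ?expR_ge0// expRD -expr2 -exprMn.
by rewrite ler_pXn2r// ?nnegrE ?addr_ge0// mulr_ge0 ?expR_ge0 ?addr_ge0.
Qed.

Lemma vmeas_poly_gauss n (l : R) :
  vmeas (fun x : 'cV[R]_n => ((1 + nsq x) ^+ 2 * expR (- (l * nsq x)))%:E).
Proof.
apply/measurable_EFinP; apply: measurable_funM.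
  by apply: measurable_funX; apply: measurable_funD => //; exact: vmeas_nsq.
by apply/measurable_EFinP; exact: vmeas_gauss.
Qed.

Lemma Int_poly_gauss_fin n (l : R) : 0 < l ->
  (Int (fun x : 'cV[R]_n => ((1 + nsq x) ^+ 2 * expR (- (l * nsq x)))%:E) < +oo)%E.
Proof.
move=> l0.
apply: (@le_lt_trans _ _ (Int (fun x : 'cV[R]_n =>
    (((1 + 4 / l) ^+ 2)%:E * (expR (- (l / 2 * nsq x)))%:E)%E))).
  apply: le_Int.
  - by move=> x; rewrite lee_fin mulr_ge0 ?expR_ge0 ?sqr_ge0.
  - exact: vmeas_poly_gauss.
  - by apply: measurable_funeM; exact: vmeas_gauss.
  - by move=> x; rewrite -EFinM lee_fin poly_gauss_le// nsq_ge0.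
have l20 : 0 < l / 2 by rewrite divr_gt0.
rewrite IntZl ?sqr_ge0//; last exact: vmeas_gauss.
by rewrite lte_mul_pinfty ?Int_gauss_fin// lee_fin sqr_ge0.
Qed.

Lemma measurable_box n (D : 'I_n -> set B) : (forall i, measurable (D i)) ->
  measurable [set t : n.-tuple B | forall i, D i (tnth t i)].
Proof.
move=> mD; rewrite (_ : [set _ | _] = \bigcap_(i in [set` predT])
    ((fun t : n.-tuple B => tnth t i) @^-1` D i)); last first.
  by apply/seteqP; split => t /= h i //=; exact: h.
apply: fin_bigcap_measurable => // i _; rewrite -[X in measurable X]setTI.
by apply: (measurable_tnth (T := B)).
Qed.

Lemma lebesgue_tuple_box n (D : 'I_n -> set B) : (forall i, measurable (D i)) ->
  lebesgue_tuple R n [set t | forall i, D i (tnth t i)] =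
    (\prod_(i < n) lebesgue_measure (D i))%E.
Proof.
move=> mD; rewrite -(lebesgue_Rn_box mD).
by apply/esym; apply: measurable_mu_extE; exact: measurable_box.
Qed.

Lemma Int_gt0 n (f : 'cV[R]_n -> \bar R) (x0 : 'cV[R]_n) (r a : R) :
  0 < r -> 0 < a -> vmeas f -> (forall x, 0 <= f x)%E ->
  (forall x, nsq (x - x0) < r -> (a%:E <= f x)%E) -> (0 < Int f)%E.
Proof.
move=> r0 a0 mf f0 fa.
pose d := Num.min 1 (r / n.+1%:R).
have d0 : 0 < d by rewrite lt_min ltr01 divr_gt0.
have d1 : d <= 1 by rewrite ge_min lexx.
have dr : d * n.+1%:R <= r.
  by rewrite -ler_pdivlMr// ge_min lexx orbT.
pose D (i : 'I_n) : set B := `]x0 i 0 - d, x0 i 0 + d[%classic.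
have mD i : measurable (D i) by exact: measurable_itv.
have mbox := measurable_box mD.
pose E : set (n.-tuple B) := [set t | forall i, D i (tnth t i)].
have muE : (0 < lebesgue_tuple R n E)%E.
  rewrite lebesgue_tuple_box// (eq_bigr (fun=> (d + d)%:E)); last first.
    move=> i _; rewrite lebesgue_measure_itv/= lte_fin ltrD2l gtrN//.
    by rewrite -EFinB; congr EFin; ring.
  rewrite prodEFin lte_fin prodr_gt0// => i _; exact: addr_gt0.
apply: (@lt_le_trans _ _ (\int[lebesgue_tuple R n]_(t in E) (cst a%:E t))%E).
  by rewrite integral_cst// mule_gt0.
apply: (@le_trans _ _ (\int[lebesgue_tuple R n]_(t in E) f (col_of_tuple t))%E); last first.
  by apply: ge0_subset_integral.
apply: ge0_le_integral => //.
- by move=> t _; rewrite lee_fin ltW.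
- exact: measurable_funS mf.
move=> t Et; apply: fa.
apply: (@le_lt_trans _ _ (d * n%:R)); last first.
  by apply: (lt_le_trans _ dr); rewrite ltr_pM2l// ltr_nat.
rewrite mulr_natr -[in leRHS](card_ord n) -sumr_const.
apply: ler_sum => i _; rewrite !mxE.
have := Et i; rewrite /D /= in_itv/= => /andP[h1 h2].
have : 0 <= (d - (tnth t i - x0 i 0)) * (d + (tnth t i - x0 i 0)).
  by rewrite mulr_ge0//; lra.
nra.
Qed.

(** By Tonelli: if [e] is not along the first axis, the sections are hyperplanes again;
    otherwise all sections but one are empty. *)
Lemma hyperplane_null n (e : 'cV[R]_n) (c : R) : e != 0 ->
  lebesgue_tuple R n [set t | dot (col_of_tuple t) e = c] = 0%E.
Proof.
elim: n e c => [|n IH] e c e0.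
  by move: e0; rewrite (_ : e = 0) ?eqxx//; apply/colP => -[].
have mH k (v : 'cV[R]_k) (b : R) :
    measurable [set t : k.-tuple B | dot (col_of_tuple t) v = b].
  rewrite (_ : [set _ | _] = setT `&` (fun t => dot (col_of_tuple t) v) @^-1` [set b]).
    by apply: (vmeas_dot v) => //; exact: measurable_set1.
  by apply/seteqP; split => t /=; tauto.
pose e' : 'cV[R]_n := \col_i e (lift ord0 i) 0.
have dotE (x : B) (t : n.-tuple B) :
    dot (col_of_tuple [tuple of x :: t]) e = x * e ord0 0 + dot (col_of_tuple t) e'.
  rewrite /dot big_ord_recl !mxE tnth0; congr (_ + _).
  by apply: eq_bigr => i _; rewrite !mxE tnthS.
pose H : set (n.+1.-tuple B) := [set t | dot (col_of_tuple t) e = c].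
have mHe : measurable H by exact: mH.
have mF : measurable_fun setT (fun t : n.+1.-tuple B => (\1_H t : R)%:E).
  exact/measurable_EFinP/measurable_indic.
have F0 (t : n.+1.-tuple B) : (0 <= (\1_H t : R)%:E)%E by rewrite lee_fin.
rewrite -/H -[H]setIT -integral_indic// (ge0_integral_cons mF F0).
pose p : B := c / e ord0 0.
have inner (x : B) : x != p ->
    (\int[lebesgue_tuple R n]_t (\1_H [tuple of x :: t])%:E = 0)%E.
  move=> xp.
  pose K : set (n.-tuple B) := [set t | dot (col_of_tuple t) e' = c - x * e ord0 0].
  rewrite (eq_integral (fun t => (\1_K t)%:E)); last first.
    move=> t _; rewrite !indicE; congr (_%:R%:E); congr nat_of_bool.
    apply/idP/idP; rewrite !inE /H /K/= dotE => h; first by rewrite -h addrC addKr.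
    by rewrite h addrC subrK.
  rewrite integral_indic ?setIT//; last exact: mH.
  have [e'0|e'0] := eqVneq e' 0; last exact: IH.
  have e00 : e ord0 0 != 0.
    apply: contra e0 => /eqP e00; apply/eqP/colP => i; rewrite [RHS]mxE.
    case: (unliftP ord0 i) => [j ->|->//].
    by move/colP : e'0 => /(_ j); rewrite !mxE.
  rewrite (_ : K = set0) ?measure0//; apply/seteqP; split => // t.
  rewrite /K/= e'0 -(scale0r 0) dotZr mul0r => /eqP; rewrite eq_sym subr_eq0 => /eqP ce.
  by move: xp; rewrite /p ce mulfK ?eqxx.
rewrite (@ge0_negligible_integral _ _ _ _ setT [set p])//; last 3 first.
- exact: (measurable_section_cons mF F0).
- by move=> x _; apply: integral_ge0 => t _; rewrite lee_fin.
- exact: lebesgue_measure_set1.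
by apply: integral0_eq => x [_ /eqP xp]; exact: inner.
Qed.

End euclidean_integrals.

(** * Self-convolution of even densities *)

Section doubling_map.
Context {R : realType}.
Local Notation B := (measurableTypeR R).

Definition isqrt2 : R := (Num.sqrt 2)^-1.

Lemma isqrt2_gt0 : 0 < isqrt2.
Proof. by rewrite invr_gt0 sqrtr_gt0. Qed.

Lemma isqrt2_sqr : isqrt2 ^+ 2 = 2^-1.
Proof. by rewrite exprVn sqr_sqrtr. Qed.

Lemma isqrt2_neq0 : isqrt2 != 0.
Proof. by rewrite gt_eqF// isqrt2_gt0. Qed.

(** Boundedness makes the convolution of a density with itself finite at every
    point. *)
Definition even_density n (f : 'cV[R]_n -> R) : Prop :=
  [/\ vmeas (f : _ -> B), (forall x, 0 <= f x), (forall x, f (- x) = f x),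
      (exists b, forall x, f x <= b) & Int (fun x => (f x)%:E) = 1%E].

(** If [X] and [X'] are independent with density [f] then [doubling f] is the density
    of [(X + X') / sqrt 2]. *)
Definition doubling n (f : 'cV[R]_n -> R) (x : 'cV[R]_n) : R :=
  fine (Int (fun y => (f (isqrt2 *: (x + y)) * f (isqrt2 *: (x - y)))%:E)).

Lemma vmeas2_rot n (f : 'cV[R]_n -> R) : vmeas (f : _ -> B) ->
  vmeas2 ((fun x y => f (isqrt2 *: (x + y)) * f (isqrt2 *: (x - y))) : _ -> _ -> B).
Proof.
move=> mf; have m1 := vmeas2_lin isqrt2 isqrt2 mf; have m2 := vmeas2_lin isqrt2 (- isqrt2) mf.
rewrite (_ : (fun _ => _) = fun x y : 'cV[R]_n =>
    f (isqrt2 *: x + isqrt2 *: y) * f (isqrt2 *: x + - isqrt2 *: y)).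
  exact: measurable_funM.
by apply/funext => x; apply/funext => y; rewrite !scalerDr scaleNr scalerN.
Qed.

Lemma vmeas_rot n (f : 'cV[R]_n -> R) (x : 'cV[R]_n) : vmeas (f : _ -> B) ->
  vmeas (fun y => (f (isqrt2 *: (x + y)) * f (isqrt2 *: (x - y)))%:E).
Proof.
by move=> mf; apply: vmeas_EFin; exact: (vmeas2_section x (vmeas2_rot mf)).
Qed.

Lemma fiber_le n (f : 'cV[R]_n -> R) (b : R) (x : 'cV[R]_n) :
  vmeas (f : _ -> B) -> (forall x, 0 <= f x) -> (forall x, f x <= b) ->
  Int (fun x => (f x)%:E) = 1%E ->
  (Int (fun y => (f (isqrt2 *: (x + y)) * f (isqrt2 *: (x - y)))%:E) <=
   (b * (isqrt2^-1 ^+ n))%:E)%E.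
Proof.
move=> mf f0 fb f1.
have b0 : 0 <= b := le_trans (f0 0) (fb 0).
have mg : vmeas (fun y => (f (isqrt2 *: y + isqrt2 *: x))%:E).
  by apply: vmeas_EFin; exact: (vmeas_affine isqrt2 (isqrt2 *: x) mf).
apply: (@le_trans _ _ (Int (fun y => b%:E * (f (isqrt2 *: y + isqrt2 *: x))%:E)%E)).
  apply: le_Int.
  - by move=> y; rewrite lee_fin mulr_ge0.
  - exact: vmeas_rot.
  - exact: measurable_funeM.
  - move=> y; have -> : isqrt2 *: y + isqrt2 *: x = isqrt2 *: (x + y) by rewrite scalerDr addrC.
    by rewrite -EFinM lee_fin mulrC ler_wpM2r.
rewrite IntZl//; last by move=> y; rewrite lee_fin.
rewrite (@Int_affine _ _ isqrt2 (isqrt2 *: x) (fun y => (f y)%:E) isqrt2_neq0)//; last exact: vmeas_EFin.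
by rewrite f1 mule1 gtr0_norm ?isqrt2_gt0// -EFinM.
Qed.

Section of_density.
Variables (n : nat) (f : 'cV[R]_n -> R).
Hypothesis df : even_density f.

Lemma fiber_fin (x : 'cV[R]_n) :
  Int (fun y => (f (isqrt2 *: (x + y)) * f (isqrt2 *: (x - y)))%:E) \is a fin_num.
Proof.
have [mf f0 _ [b fb] f1] := df.
rewrite ge0_fin_numE; first by apply: (le_lt_trans (fiber_le x mf f0 fb f1)); rewrite ltry.
by apply: Int_ge0 => y; rewrite lee_fin mulr_ge0.
Qed.

Lemma doublingE (x : 'cV[R]_n) :
  (doubling f x)%:E = Int (fun y => (f (isqrt2 *: (x + y)) * f (isqrt2 *: (x - y)))%:E).
Proof. by rewrite /doubling fineK// fiber_fin. Qed.

Lemma vmeas_doubling : vmeas (doubling f : _ -> B).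
Proof.
have [mf f0 _ _ _] := df.
apply/measurable_EFinP.
rewrite (_ : _ \o _ = fun t => Int (fun y =>
  (f (isqrt2 *: (col_of_tuple t + y)) * f (isqrt2 *: (col_of_tuple t - y)))%:E)); last first.
  by apply/funext => t /=; exact: doublingE.
apply: (@vmeas_Int _ _ (fun x y => (f (isqrt2 *: (x + y)) * f (isqrt2 *: (x - y)))%:E)).
  by apply/measurable_EFinP; exact: vmeas2_rot.
by move=> x y; rewrite lee_fin mulr_ge0.
Qed.

Lemma doubling_ge0 x : 0 <= doubling f x.
Proof.
have [_ f0 _ _ _] := df.
by rewrite -lee_fin doublingE; apply: Int_ge0 => y; rewrite lee_fin mulr_ge0.
Qed.

(** The rotation (u, v) |-> ((u + v) / sqrt 2, (u - v) / sqrt 2) preserves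
    Lebesgue measure; only the dilations and translations of each factor are
    used, since Fubini's theorem turns the rotation into two shears. *)
Lemma Int_doubling (psi : 'cV[R]_n -> R) : vmeas (psi : _ -> B) -> (forall x, 0 <= psi x) ->
  Int (fun x => (psi x * doubling f x)%:E) =
  Int (fun v => Int (fun u => (psi (isqrt2 *: (u + v)) * f u * f v)%:E)).
Proof.
have [mf f0 _ _ _] := df => mpsi psi0.
pose c := (`|isqrt2|^-1 ^+ n)%:E.
have r20 := isqrt2_gt0.
have mlin a b : vmeas2 ((fun x y => f (a *: x + b *: y)) : _ -> _ -> B).
  exact: vmeas2_lin.
have m3 : vmeas2 (fun x v => (psi x * f v * f (2 * isqrt2 *: x - v))%:E).
  apply/measurable_EFinP; apply: measurable_funM; last first.
    have := mlin (2 * isqrt2) (-1).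
    by rewrite /vmeas2; under eq_fun do rewrite scaleN1r.
  apply: measurable_funM; first exact: (vmeas2_fst mpsi).
  exact: (vmeas2_snd mf).
have p3 x v : (0 <= (psi x * f v * f (2 * isqrt2 *: x - v))%:E)%E.
  by rewrite lee_fin !mulr_ge0.
have step1 x : (psi x * doubling f x)%:E =
    (c * Int (fun v => (psi x * f v * f (2 * isqrt2 *: x - v))%:E))%E.
  rewrite EFinM doublingE -IntZl//; last 2 first.
  - by move=> y; rewrite lee_fin mulr_ge0.
  - exact: vmeas_rot.
  rewrite /c -(@Int_affine _ _ isqrt2 (isqrt2 *: x) _ isqrt2_neq0)//; last exact: (vmeas2_section x m3).
  apply: eq_Int => y; rewrite -EFinM mulrA; congr (_ * f _ * f _)%:E.
    by rewrite scalerDr addrC.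
  by apply/colP => i; rewrite !mxE; ring.
have step2 v : Int (fun x => (psi x * f v * f (2 * isqrt2 *: x - v))%:E) =
    ((`|2 * isqrt2|^-1 ^+ n)%:E * Int (fun u => (psi (isqrt2 *: (u + v)) * f u * f v)%:E))%E.
  rewrite -(@Int_affine _ _ (2 * isqrt2) (- v) (fun u => (psi (isqrt2 *: (u + v)) * f u * f v)%:E)).
  - apply: eq_Int => x; rewrite subrK scalerA (_ : isqrt2 * (2 * isqrt2) = 1) ?scale1r.
      by congr (_%:E); ring.
    by rewrite mulrCA -expr2 isqrt2_sqr divff.
  - by rewrite mulf_neq0 ?isqrt2_neq0.
  - apply/measurable_EFinP; apply: measurable_funM; last exact: measurable_cst.
    apply: measurable_funM => //.
    have := vmeas_affine isqrt2 (isqrt2 *: v) mpsi.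
    by rewrite /vmeas; under eq_fun do rewrite -scalerDr.
  - by move=> u; rewrite lee_fin !mulr_ge0.
have k1 : 0 <= `|isqrt2|^-1 ^+ n by rewrite exprn_ge0// invr_ge0.
have k2 : 0 <= `|2 * isqrt2|^-1 ^+ n by rewrite exprn_ge0// invr_ge0.
rewrite (eq_Int step1) (IntZl k1 (fun x => Int_ge0 (p3 x)) (vmeas_Int m3 p3)).
rewrite Int_swap// (eq_Int step2).
have m4 : vmeas2 (fun v u => (psi (isqrt2 *: (u + v)) * f u * f v)%:E).
  apply/measurable_EFinP; apply: measurable_funM; last exact: (vmeas2_fst mf).
  apply: measurable_funM; last exact: (vmeas2_snd mf).
  have := vmeas2_lin isqrt2 isqrt2 mpsi.
  by rewrite /vmeas2; under eq_fun do rewrite -scalerDr addrC.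
have p4 v u : (0 <= (psi (isqrt2 *: (u + v)) * f u * f v)%:E)%E.
  by rewrite lee_fin !mulr_ge0.
rewrite (IntZl k2 (fun v => Int_ge0 (p4 v)) (vmeas_Int m4 p4)).
rewrite muleA -EFinM -exprMn -invfM -normrM mulrCA -expr2 isqrt2_sqr divff// normr1.
by rewrite invr1 expr1n mul1e.
Qed.

Lemma even_density_doubling : even_density (doubling f).
Proof.
have [mf f0 fN [b fb] f1] := df.
split; [exact: vmeas_doubling|exact: doubling_ge0| | |].
- move=> x; rewrite /doubling; congr fine; apply: eq_Int => y.
  by rewrite -opprD scalerN fN [X in f (_ *: X)](_ : _ = - (x - y)) ?scalerN ?fN 1?mulrC// opprB addrC.
- exists (b * (isqrt2^-1 ^+ n)) => x; rewrite -lee_fin doublingE.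
  exact: fiber_le.
have := @Int_doubling (fun=> 1) (measurable_cst _) (fun=> ler01).
under eq_Int do rewrite mul1r.
move=> ->; rewrite -f1; apply: eq_Int => v.
under eq_Int do rewrite mul1r mulrC EFinM.
rewrite IntZl//; last exact: vmeas_EFin.
by rewrite f1 mule1.
Qed.

End of_density.
End doubling_map.

(** * A central limit theorem for the doubling map *)

Section central_limit.
Context {R : realType}.
Local Notation B := (measurableTypeR R).

(** Bounded functions with a second-order Taylor expansion whose symmetrized
    remainder is of fourth order, uniformly in the base point; only the
    symmetrized expansion matters against even densities. *)
Definition test_fun n (M2 M4 : R) (psi : 'cV[R]_n -> R) : Prop :=
  [/\ vmeas (psi : _ -> B), (forall x, 0 <= psi x <= 1) &
    forall x, exists2 H : 'M[R]_n, (forall i j, `|H i j| <= M2) &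
      forall y, `|psi (x + y) + psi (x - y) - 2 * psi x - qform H y| <=
                M4 * nsq y ^+ 2].

Lemma test_fun_half n (M2 M4 : R) (psi : 'cV[R]_n -> R) (v : 'cV[R]_n) :
  test_fun M2 M4 psi ->
  test_fun (M2 / 2) (M4 / 4) (fun u => psi (isqrt2 *: (u + v))).
Proof.
move=> [mpsi psi01 tpsi]; split => //.
  have := vmeas_affine isqrt2 (isqrt2 *: v) mpsi.
  by rewrite /vmeas; under eq_fun do rewrite -scalerDr.
move=> x; have [H HM hH] := tpsi (isqrt2 *: (x + v)).
exists (2^-1 *: H).
  move=> i j; rewrite mxE normrM ger0_norm ?invr_ge0// mulrC.
  by rewrite ler_wpM2r ?invr_ge0.
move=> y; have := hH (isqrt2 *: y).
rewrite nsqZ qformZ isqrt2_sqr.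
have -> : qform (2^-1 *: H) y = 2^-1 * qform H y.
  by rewrite !qformE -scalemxAl dotZr.
rewrite -scalerDr -scalerBr (addrAC x v y) (addrAC x v (- y)).
by rewrite (_ : M4 / 4 * nsq y ^+ 2 = M4 * (2^-1 * nsq y) ^+ 2)//; field.
Qed.

(** Extended-real valued, since the moments are not known to be finite a priori. *)
Definition mean n (f psi : 'cV[R]_n -> R) : \bar R := Int (fun x => (psi x * f x)%:E).

Section mixing.
Variables (n : nat) (psi f g h : 'cV[R]_n -> R) (e : R).
Hypotheses (mpsi : vmeas (psi : _ -> B)) (psi0 : forall x, 0 <= psi x).
Hypotheses (df : even_density f) (dg : even_density g) (dh : even_density h).

Let mix (p q : 'cV[R]_n -> R) :=
  Int (fun v => Int (fun u => (psi (isqrt2 *: (u + v)) * p u * q v)%:E)).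

Let mixm (p q : 'cV[R]_n -> R) : even_density p -> even_density q ->
  vmeas2 (fun v u => (psi (isqrt2 *: (u + v)) * p u * q v)%:E).
Proof.
move=> [mf _ _ _ _] [mh _ _ _ _].
apply/measurable_EFinP; apply: measurable_funM; last exact: (vmeas2_fst mh).
apply: measurable_funM; last exact: (vmeas2_snd mf).
have := vmeas2_lin isqrt2 isqrt2 mpsi.
by rewrite /vmeas2; under eq_fun do rewrite -scalerDr addrC.
Qed.

Let mix_ge0 (p q : 'cV[R]_n -> R) : even_density p -> even_density q ->
  forall v u, (0 <= (psi (isqrt2 *: (u + v)) * p u * q v)%:E)%E.
Proof. by move=> [_ p0 _ _ _] [_ q0 _ _ _] v u; rewrite lee_fin !mulr_ge0. Qed.

Lemma mixC : mix f h = mix h f.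
Proof.
rewrite /mix Int_swap; last 2 first.
- exact: mixm.
- exact: mix_ge0.
apply: eq_Int => v; apply: eq_Int => u; congr (_%:E).
by rewrite (addrC v u) mulrAC.
Qed.

(** One factor of the self-convolution is replaced, at a fixed value [v] of the
    other variable. *)
Lemma mix_le : 0 <= e ->
  (forall v, mean f (fun u => psi (isqrt2 *: (u + v)))
     <= mean g (fun u => psi (isqrt2 *: (u + v))) + e%:E)%E ->
  (mix f h <= mix g h + e%:E)%E.
Proof.
move=> e0 fg.
have [mf f0 _ _ f1] := df; have [mg g0 _ _ g1] := dg; have [mh h0 _ _ h1] := dh.
have mv v : vmeas ((fun u => psi (isqrt2 *: (u + v))) : _ -> B).
  have := vmeas_affine isqrt2 (isqrt2 *: v) mpsi.
  by rewrite /vmeas; under eq_fun do rewrite -scalerDr.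
have pull k v : even_density k ->
    Int (fun u => (psi (isqrt2 *: (u + v)) * k u * h v)%:E) =
    ((h v)%:E * mean k (fun u => psi (isqrt2 *: (u + v))))%E.
  move=> [mk k0 _ _ _]; rewrite /mean -IntZl//; last 2 first.
  - by move=> u; rewrite lee_fin mulr_ge0.
  - by apply: vmeas_EFin; exact: (measurable_funM (mv v) mk).
  by apply: eq_Int => u; rewrite -EFinM; congr (_%:E); ring.
have i0 k v (dk : even_density k) :
  (0 <= Int (fun u => (psi (isqrt2 *: (u + v)) * k u * h v)%:E))%E.
  by apply: Int_ge0; exact: mix_ge0.
have im k (dk : even_density k) :
  vmeas (fun v => Int (fun u => (psi (isqrt2 *: (u + v)) * k u * h v)%:E)).
  exact: (vmeas_Int (mixm dk dh) (mix_ge0 dk dh)).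
have mh' : vmeas (fun v => (h v)%:E) by exact: vmeas_EFin.
have h0' v : (0 <= (h v)%:E)%E by rewrite lee_fin.
apply: (@le_trans _ _ (Int (fun v =>
    Int (fun u => (psi (isqrt2 *: (u + v)) * g u * h v)%:E) + e%:E * (h v)%:E)%E)).
  apply: le_Int.
  - by move=> v; exact: i0.
  - exact: im.
  - by apply: emeasurable_funD; [exact: im|exact: measurable_funeM].
  - move=> v; rewrite !pull// [(e%:E * _)%E]muleC.
    apply: (@le_trans _ _ ((h v)%:E * (mean g (fun u => psi (isqrt2 *: (u + v))) + e%:E))%E).
      by rewrite lee_wpmul2l.
    rewrite ge0_muleDr// ?lee_fin//.
    by apply: Int_ge0 => u; rewrite lee_fin mulr_ge0.
rewrite IntD//; last 4 first.
- by move=> v; exact: i0.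
- by move=> v; rewrite -EFinM lee_fin mulr_ge0.
- exact: im.
- exact: measurable_funeM.
by rewrite IntZl// h1 mule1.
Qed.

End mixing.

(** Lindeberg's exchange argument: [f * f] is changed into [f * g], then into [g * g].
    Each exchange tests against [u |-> psi ((u + v) / sqrt 2)], whose second-order
    term is half, and whose fourth-order term is a quarter, of that of [psi]. *)
Lemma doubling_mean_le n (f g : 'cV[R]_n -> R) (M2 M4 e : R) :
  even_density f -> even_density g -> 0 <= e ->
  (forall psi, test_fun (M2 / 2) (M4 / 4) psi -> (mean f psi <= mean g psi + e%:E)%E) ->
  forall psi, test_fun M2 M4 psi -> (mean (doubling f) psi <= mean (doubling g) psi + (2 * e)%:E)%E.
Proof.
move=> df dg e0 fg psi tpsi.
have [mpsi psi01 _] := tpsi.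
have psi0 x : 0 <= psi x by case/andP: (psi01 x).
have fg' v := fg _ (test_fun_half v tpsi).
rewrite /mean (Int_doubling df)// (Int_doubling dg)//.
apply: (le_trans (mix_le mpsi psi0 df dg df e0 fg')).
rewrite (mixC mpsi psi0 dg df).
apply: (@le_trans _ _ (Int (fun v => Int (fun u =>
  (psi (isqrt2 *: (u + v)) * g u * g v)%:E)) + e%:E + e%:E)%E).
  by rewrite leeD2r//; exact: mix_le.
by rewrite -addeA -EFinD (_ : e + e = 2 * e)//; ring.
Qed.

Lemma even_density_iter n (f : 'cV[R]_n -> R) k :
  even_density f -> even_density (iter k (@doubling R n) f).
Proof. by move=> df; elim: k => //= k; exact: even_density_doubling. Qed.

(** Two exchanges per step: the covariance error [M2 * a] is reproduced (2 times 1/2),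
    the remainder [M4 * D] is halved (2 times 1/4). *)
Lemma iter_doubling_mean_le n (f g : 'cV[R]_n -> R) (a D : R) : 0 <= a -> 0 <= D ->
  even_density f -> even_density g ->
  (forall M2 M4 psi, 0 <= M2 -> 0 <= M4 -> test_fun M2 M4 psi ->
     (mean f psi <= mean g psi + (M2 * a + M4 * D)%:E)%E) ->
  forall k M2 M4 psi, 0 <= M2 -> 0 <= M4 -> test_fun M2 M4 psi ->
     (mean (iter k (@doubling R n) f) psi <=
      mean (iter k (@doubling R n) g) psi + (M2 * a + M4 * (D / 2 ^+ k))%:E)%E.
Proof.
move=> a0 D0 df dg base; elim=> [|k IH] M2 M4 psi M20 M40 tpsi.
  by rewrite expr0 divr1; exact: base.
rewrite (_ : M2 * a + M4 * (D / 2 ^+ k.+1) =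
  2 * (M2 / 2 * a + M4 / 4 * (D / 2 ^+ k))); last first.
  by rewrite exprS; field; rewrite expf_neq0.
apply: doubling_mean_le tpsi.
- exact: even_density_iter.
- exact: even_density_iter.
- by rewrite addr_ge0// !mulr_ge0// invr_ge0 exprn_ge0.
by move=> phi tphi; apply: IH => //; rewrite divr_ge0.
Qed.

End central_limit.

(** * Covariance and fourth moment control the means of test functions *)

Section moments.
Context {R : realType}.
Local Notation B := (measurableTypeR R).

Definition has_expect n (f phi : 'cV[R]_n -> R) : Prop :=
  (lebesgue_tuple R n).-integrable setT
    (fun t => (phi (col_of_tuple t) * f (col_of_tuple t))%:E).

(** Real-valued, for linear computations under [has_expect]. *)
Definition expect n (f phi : 'cV[R]_n -> R) : R :=
  \int[lebesgue_tuple R n]_t (phi (col_of_tuple t) * f (col_of_tuple t)).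

Definition cov n (f : 'cV[R]_n -> R) (i j : 'I_n) : R :=
  expect f (fun x => x i 0 * x j 0).

Definition covmx n (f : 'cV[R]_n -> R) : 'M[R]_n := \matrix_(i, j) cov f i j.

Lemma covmx_sym n (f : 'cV[R]_n -> R) : symmetric_mx (covmx f).
Proof.
apply/matrixP => i j; rewrite !mxE /cov; congr (expect f _).
by apply/funext => x; rewrite mulrC.
Qed.

Lemma expectD n (f phi psi : 'cV[R]_n -> R) : has_expect f phi -> has_expect f psi ->
  has_expect f (fun x => phi x + psi x) /\ expect f (fun x => phi x + psi x) = expect f phi + expect f psi.
Proof.
move=> L L'; split.
  by rewrite /has_expect; under eq_fun do rewrite mulrDl EFinD; exact: integrableD.
by rewrite /expect -RintegralD//; apply: eq_Rintegral => t _; rewrite mulrDl.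
Qed.

Lemma expectZ n (f phi : 'cV[R]_n -> R) (k : R) : has_expect f phi ->
  has_expect f (fun x => k * phi x) /\ expect f (fun x => k * phi x) = k * expect f phi.
Proof.
move=> L; split.
  by rewrite /has_expect; under eq_fun do rewrite -mulrA EFinM; exact: integrableZl.
by rewrite /expect -RintegralZl//; apply: eq_Rintegral => t _; rewrite mulrA.
Qed.

Lemma expect_sum n (f : 'cV[R]_n -> R) (I : Type) (s : seq I) (phi : I -> 'cV[R]_n -> R) :
  (forall i, has_expect f (phi i)) ->
  has_expect f (fun x => \sum_(i <- s) phi i x) /\
  expect f (fun x => \sum_(i <- s) phi i x) = \sum_(i <- s) expect f (phi i).
Proof.
move=> L; elim: s => [|i s [IH1 IH2]].
  split.
    rewrite /has_expect; under eq_fun do rewrite big_nil mul0r.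
    exact: integrable0.
  rewrite big_nil /expect; under eq_Rintegral do rewrite big_nil mul0r.
  by rewrite Rintegral_cst// mul0r.
have [h1 h2] := expectD (L i) IH1.
have e : (fun x => \sum_(j <- i :: s) phi j x) = fun x => phi i x + \sum_(j <- s) phi j x.
  by apply/funext => x; rewrite big_cons.
by rewrite e big_cons; split => //; rewrite h2 IH2.
Qed.

Lemma expect_le n (f phi psi : 'cV[R]_n -> R) : has_expect f phi -> has_expect f psi ->
  (forall x, phi x * f x <= psi x * f x) -> expect f phi <= expect f psi.
Proof. by move=> L L' h; apply: le_Rintegral. Qed.

Lemma mean_expect n (f phi : 'cV[R]_n -> R) : has_expect f phi -> mean f phi = (expect f phi)%:E.
Proof. by move=> L; rewrite /mean /Int /expect /Rintegral fineK//; exact: integrable_fin_num. Qed.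

Section fourth_moment.
Variables (n : nat) (f : 'cV[R]_n -> R) (D : R).
Hypothesis df : even_density f.
Hypothesis fD : (mean f (fun x => (nsq x ^+ 2)%R) <= D%:E)%E.

Lemma has_expect_bound (phi : 'cV[R]_n -> R) (K : R) : vmeas (phi : _ -> B) ->
  (forall x, `|phi x| <= K * (1 + nsq x ^+ 2)) -> has_expect f phi.
Proof.
have [mf f0 _ _ f1] := df => mphi hphi.
have mn2 : vmeas ((fun x => nsq x ^+ 2) : 'cV[R]_n -> B).
  by apply: measurable_funX; exact: vmeas_nsq.
have mnf : vmeas ((fun x => nsq x ^+ 2 * f x) : 'cV[R]_n -> B) := measurable_funM mn2 mf.
have mdom : vmeas (fun x => (f x)%:E + (nsq x ^+ 2 * f x)%:E)%E.
  exact: (emeasurable_funD (vmeas_EFin mf) (vmeas_EFin mnf)).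
have p2 x : (0 <= (nsq x ^+ 2 * f x)%:E)%E by rewrite lee_fin mulr_ge0 ?sqr_ge0.
have p1 x : (0 <= (f x)%:E)%E by rewrite lee_fin.
have K0 : 0 <= K.
  have := le_trans (normr_ge0 _) (hphi 0).
  by rewrite nsq0 expr0n addr0 mulr1.
have Ldom : (lebesgue_tuple R n).-integrable setT (fun t =>
    K%:E * ((f (col_of_tuple t))%:E +
            (nsq (col_of_tuple t) ^+ 2 * f (col_of_tuple t))%:E))%E.
  apply: integrableZl => //; apply/integrableP; split => //.
  under eq_integral do rewrite gee0_abs ?adde_ge0//.
  have -> : (\int[lebesgue_tuple R n]_t ((f (col_of_tuple t))%:E +
     (nsq (col_of_tuple t) ^+ 2 * f (col_of_tuple t))%:E) =
     Int (fun x => (f x)%:E) + mean f (fun x => (nsq x ^+ 2)%R))%E.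
    by rewrite -(IntD p1 p2 (vmeas_EFin mf) (vmeas_EFin mnf)).
  by rewrite f1; apply: (le_lt_trans (leeD2l _ fD)); rewrite -EFinD ltry.
apply: (le_integrable measurableT _ _ Ldom).
  exact: (@vmeas_EFin _ _ (fun x => phi x * f x) (measurable_funM mphi mf)).
move=> t _; rewrite -EFinD -EFinM /= lee_fin.
rewrite normrM (ger0_norm (f0 _)) [leRHS]ger0_norm; last first.
  by rewrite mulr_ge0// addr_ge0// mulr_ge0// sqr_ge0.
have := ler_wpM2r (f0 (col_of_tuple t)) (hphi (col_of_tuple t)).
by rewrite -mulrA mulrDl mul1r.
Qed.

Lemma expect_cst (c : R) : expect f (fun=> c) = c.
Proof.
have [_ _ _ _ f1] := df.
have L : has_expect f (fun=> 1).
  apply: (@has_expect_bound _ 1); first exact: measurable_cst.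
  by move=> x; rewrite normr1 mul1r lerDl sqr_ge0.
have [_ h] := expectZ c L.
have -> : expect f (fun=> c) = expect f (fun=> c * 1) by rewrite mulr1.
rewrite h (_ : expect f (fun=> 1) = 1) ?mulr1//.
apply: EFin_inj; rewrite -mean_expect// /mean -[RHS]f1.
by apply: eq_Int => x; rewrite mul1r.
Qed.

Lemma has_expect_nsq2 : has_expect f (fun x => nsq x ^+ 2).
Proof.
apply: (@has_expect_bound _ 1); first by apply: measurable_funX; exact: vmeas_nsq.
by move=> x; rewrite mul1r ger0_norm ?sqr_ge0// lerDr.
Qed.

Lemma has_expect_coord2 i j : has_expect f (fun x => x i 0 * x j 0).
Proof.
apply: (@has_expect_bound _ 1); first by apply: measurable_funM; exact: vmeas_coord.
move=> x; rewrite mul1r.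
have hi := coord_sqr_le x i; have hj := coord_sqr_le x j.
have e1 := sqr_ge0 (x i 0 + x j 0); have e2 := sqr_ge0 (x i 0 - x j 0).
have e3 := sqr_ge0 (nsq x - 1); have n0 := nsq_ge0 x.
by case: (ger0P (x i 0 * x j 0)) => _; nra.
Qed.

Lemma expect_qform (H : 'M[R]_n) :
  has_expect f (qform H) /\ expect f (qform H) = \sum_i \sum_j H i j * cov f i j.
Proof.
have [h1 h2] := expect_sum (index_enum 'I_n) (fun i =>
  (expect_sum (index_enum 'I_n) (fun j => (expectZ (H i j) (has_expect_coord2 i j)).1)).1).
have e : qform H = fun x => \sum_i \sum_j H i j * (x i 0 * x j 0).
  by apply/funext => x; rewrite qform_sum.
rewrite e; split => //; rewrite h2; apply: eq_bigr => i _.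
rewrite (expect_sum (index_enum 'I_n) (fun j => (expectZ (H i j) (has_expect_coord2 i j)).1)).2.
by apply: eq_bigr => j _; rewrite (expectZ (H i j) (has_expect_coord2 i j)).2.
Qed.

Lemma expect_dot_sqr (v : 'cV[R]_n) :
  has_expect f (fun x => dot x v ^+ 2) /\ expect f (fun x => dot x v ^+ 2) = qform (covmx f) v.
Proof.
have e : (fun x => dot x v ^+ 2) = qform (v *m v^T).
  apply/funext => x; rewrite qform_sum expr2 {1}/dot mulr_suml; apply: eq_bigr => k _.
  rewrite /dot mulr_sumr; apply: eq_bigr => l _.
  by rewrite mxE big_ord1 !mxE; ring.
have [h1 h2] := expect_qform (v *m v^T).
rewrite e; split => //; rewrite h2 qform_sum.
apply: eq_bigr => k _; apply: eq_bigr => l _.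
by rewrite mxE big_ord1 !mxE mulrC.
Qed.

Lemma cov_le i j : `|cov f i j| <= 1 + D.
Proof.
have L := has_expect_coord2 i j.
have Lc : has_expect f (fun=> 1).
  apply: (@has_expect_bound _ 1); first exact: measurable_cst.
  by move=> x; rewrite normr1 mul1r lerDl sqr_ge0.
have [LA EA] := expectD Lc has_expect_nsq2.
have [LN EN] := expectZ (-1) LA.
have [_ f0 _ _ _] := df.
have D1 : 1 + expect f (fun x => nsq x ^+ 2) <= 1 + D.
  by rewrite lerD2l -lee_fin -mean_expect//; exact: has_expect_nsq2.
have b (x : 'cV[R]_n) : `|x i 0 * x j 0| <= 1 + nsq x ^+ 2.
  have hi := coord_sqr_le x i; have hj := coord_sqr_le x j.
  have e1 := sqr_ge0 (x i 0 + x j 0); have e2 := sqr_ge0 (x i 0 - x j 0).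
  have e3 := sqr_ge0 (nsq x - 1); have n0 := nsq_ge0 x.
  by case: (ger0P (x i 0 * x j 0)) => _; nra.
apply: le_trans D1; rewrite -[X in X + _]expect_cst -EA ler_norml.
rewrite -[X in X <= _]mulN1r -EN.
by apply/andP; split; apply: expect_le => // x; apply: ler_wpM2r => //;
  have := b x; rewrite ler_norml ?mulN1r => /andP[].
Qed.

(** Evenness removes the odd part of [psi]. *)
Lemma expect_test_fun (M2 M4 : R) (psi : 'cV[R]_n -> R) : test_fun M2 M4 psi ->
  forall H : 'M[R]_n,
  (forall y, `|psi y + psi (- y) - 2 * psi 0 - qform H y| <= M4 * nsq y ^+ 2) ->
  `|2 * expect f psi - 2 * psi 0 - \sum_i \sum_j H i j * cov f i j| <=
    M4 * expect f (fun x => nsq x ^+ 2).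
Proof.
move=> [mpsi psi01 _] H hH.
have [mf f0 fN _ f1] := df.
have psi0 x : 0 <= psi x by case/andP: (psi01 x).
have bdd1 (phi : 'cV[R]_n -> R) : (forall x, 0 <= phi x <= 1) ->
    forall x, `|phi x| <= 1 * (1 + nsq x ^+ 2).
  move=> h x; have /andP[h0 h1] := h x.
  by rewrite ger0_norm// mul1r (le_trans h1)// lerDl sqr_ge0.
have L : has_expect f psi by apply: has_expect_bound (bdd1 _ psi01).
have mpsiN : vmeas ((fun x => psi (- x)) : _ -> B).
  have := vmeas_affine (-1) 0 mpsi.
  by rewrite /vmeas; under eq_fun do rewrite addr0 scaleN1r.
have LN : has_expect f (fun x => psi (- x)) by apply: has_expect_bound (bdd1 _ (fun x => psi01 (- x))).
have EN : expect f (fun x => psi (- x)) = expect f psi.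
  apply: EFin_inj; rewrite -!mean_expect// /mean.
  rewrite -[RHS](@Int_opp _ _ (fun x => (psi x * f x)%:E)).
  - by apply: eq_Int => x; rewrite fN.
  - by apply: vmeas_EFin; exact: (measurable_funM mpsi mf).
  - by move=> x; rewrite lee_fin mulr_ge0.
have [Lq Eq] := expect_qform H.
have Lc : has_expect f (fun=> - (2 * psi 0)).
  apply: (@has_expect_bound _ (`|2 * psi 0|)); first exact: measurable_cst.
  by move=> x; rewrite normrN ler_peMr// lerDl sqr_ge0.
have [L2 E2] := expectD L LN.
have [L3 E3] := expectD L2 Lc.
have [L4 E4] := expectZ (-1) Lq.
have [L5 E5] := expectD L3 L4.
have [L6 E6] := expectZ M4 has_expect_nsq2.
have [L7 E7] := expectZ (- M4) has_expect_nsq2.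
rewrite -Eq.
have -> : 2 * expect f psi - 2 * psi 0 - expect f (qform H) =
   expect f (fun x => psi x + psi (- x) + - (2 * psi 0) + -1 * qform H x).
  by rewrite E5 E4 E3 E2 EN expect_cst; ring.
rewrite ler_norml -mulNr -E6 -E7; apply/andP; split; apply: expect_le => // x;
  apply: ler_wpM2r => //; have := hH x; rewrite ler_norml => /andP[]; lra.
Qed.

End fourth_moment.

(** Base case of the exchange argument: by evenness a mean is determined up to the
    fourth moment by the value and the Hessian of the test function at 0. *)
Lemma mean_test_fun_le n (f g : 'cV[R]_n -> R) (a D : R) :
  even_density f -> even_density g ->
  (mean f (fun x => (nsq x ^+ 2)%R) <= D%:E)%E ->
  (mean g (fun x => (nsq x ^+ 2)%R) <= D%:E)%E ->
  \sum_i \sum_j `|cov f i j - cov g i j| <= a ->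
  forall M2 M4 psi, 0 <= M2 -> 0 <= M4 -> test_fun M2 M4 psi ->
     (mean f psi <= mean g psi + (M2 * a + M4 * D)%:E)%E.
Proof.
move=> df dg fD gD hcov M2 M4 psi M20 M40 tpsi.
have [mpsi psi01 hx] := tpsi.
have [H HM hH] := hx 0.
have hH' y : `|psi y + psi (- y) - 2 * psi 0 - qform H y| <= M4 * nsq y ^+ 2.
  by have := hH y; rewrite add0r sub0r.
have ef := expect_test_fun df fD tpsi hH'.
have eg := expect_test_fun dg gD tpsi hH'.
have Lp (k : 'cV[R]_n -> R) : even_density k ->
    (mean k (fun x => (nsq x ^+ 2)%R) <= D%:E)%E -> has_expect k psi.
  move=> dk kD; apply: (has_expect_bound dk kD (K := 1)) => // x.
  have /andP[h0 h1] := psi01 x.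
  by rewrite ger0_norm// mul1r (le_trans h1)// lerDl sqr_ge0.
rewrite (mean_expect (Lp _ df fD)) (mean_expect (Lp _ dg gD)) -EFinD lee_fin.
have fD' : expect f (fun x => nsq x ^+ 2) <= D.
  by rewrite -lee_fin -mean_expect//; exact: (has_expect_nsq2 df fD).
have gD' : expect g (fun x => nsq x ^+ 2) <= D.
  by rewrite -lee_fin -mean_expect//; exact: (has_expect_nsq2 dg gD).
have hs : `|\sum_i \sum_j H i j * cov f i j - \sum_i \sum_j H i j * cov g i j| <= M2 * a.
  apply: (@le_trans _ _ (M2 * \sum_i \sum_j `|cov f i j - cov g i j|)); last first.
    exact: ler_wpM2l.
  rewrite -sumrB mulr_sumr; apply: (le_trans (ler_norm_sum _ _ _)).
  apply: ler_sum => i _; rewrite -sumrB mulr_sumr; apply: (le_trans (ler_norm_sum _ _ _)).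
  by apply: ler_sum => j _; rewrite -mulrBr normrM ler_wpM2r.
have fD2 := ler_wpM2l M40 fD'; have gD2 := ler_wpM2l M40 gD'.
have a0 : 0 <= M2 * a := le_trans (normr_ge0 _) hs.
move: ef eg hs; rewrite !ler_norml => /andP[f1 f2] /andP[g1 g2] /andP[s1 s2].
lra.
Qed.

End moments.

(** * Gaussian densities *)

Section positive_definite.
Context {R : realType}.

Lemma posdef_ge0 n (A : 'M[R]_n) x : posdef_mx A -> 0 <= qform A x.
Proof.
move=> [_ pA]; have [->|x0] := eqVneq x 0; last exact/ltW/pA.
by rewrite qform0.
Qed.

Lemma posdef_scalar n (a : R) : 0 < a -> posdef_mx (a%:M : 'M[R]_n).
Proof.
move=> a0; split; first exact: tr_scalar_mx.
by move=> x x0; rewrite qform_scalar mulr_gt0// nsq_gt0.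
Qed.

Lemma posdef_unitmx n (A : 'M[R]_n) : posdef_mx A -> A \in unitmx.
Proof.
move=> [sA pA]; rewrite -row_free_unit -kermx_eq0.
apply: contraT => /rowV0Pn[v /sub_kermxP vA v0].
have vT0 : v^T != 0 by rewrite -(inj_eq trmx_inj) trmxK trmx0.
have := pA _ vT0; rewrite /qform trmxK mulmxA vA mul0mx mxE.
by rewrite ltxx.
Qed.

Lemma posdef_invmx n (A : 'M[R]_n) : posdef_mx A -> posdef_mx (invmx A).
Proof.
move=> dA; have uA := posdef_unitmx dA; have [sA pA] := dA; split.
  by rewrite /symmetric_mx trmx_inv sA.
move=> x x0; have -> : qform (invmx A) x = qform A (invmx A *m x).
  by rewrite !qformE mulKVmx// dotC.
apply: pA; apply: contra x0 => /eqP h.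
by rewrite -[x](mulKVmx uA) h mulmx0.
Qed.

Lemma posdef_CauchySchwarz n (A : 'M[R]_n) (x y : 'cV[R]_n) : posdef_mx A ->
  dot x (A *m y) ^+ 2 <= qform A x * qform A y.
Proof.
move=> dA; have [sA pA] := dA.
have [->|y0] := eqVneq y 0.
  rewrite mulmx0 -{1}(scale0r (0 : 'cV[R]_n)) dotZr mul0r expr0n/=.
  by rewrite mulr_ge0// posdef_ge0.
have ny := pA _ y0.
have := posdef_ge0 (qform A y *: x + (- dot x (A *m y)) *: y) dA.
rewrite qformD !qformZ -!scalemxAr !dotZl !dotZr (dot_sym y x sA) => h.
have : 0 <= qform A y * (qform A x * qform A y - dot x (A *m y) ^+ 2) by nra.
by rewrite pmulr_rge0// subr_ge0.
Qed.

(* |x|^4 = <A^-1 x, A x>^2 <= <x, A^-1 x> <x, A x> *)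
Lemma posdef_coercive n (A : 'M[R]_n) : posdef_mx A ->
  exists2 k, 0 < k & forall x, k * nsq x <= qform A x.
Proof.
move=> dA; have uA := posdef_unitmx dA.
have [L L0 hL] := qform_le (invmx A).
exists (L + 1)^-1; first by rewrite invr_gt0 ltr_wpDl.
move=> x; rewrite mulrC ler_pdivrMr ?ltr_wpDl//.
have [->|x0] := eqVneq x 0.
  by rewrite nsq0 mulr_ge0// ?addr_ge0// posdef_ge0.
have := posdef_CauchySchwarz (invmx A *m x) x dA.
rewrite dot_mulmx (proj1 dA) mulKVmx// -nsqE.
have -> : qform A (invmx A *m x) = qform (invmx A) x.
  by rewrite !qformE mulKVmx// dotC.
have nx : 0 < nsq x by rewrite nsq_gt0.
have := hL x; have := posdef_ge0 x dA; rewrite ler_norml => q0 /andP[_ h1] h2.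
have h3 : nsq x ^+ 2 <= L * nsq x * qform A x.
  by apply: (le_trans h2); rewrite ler_wpM2r.
have : nsq x * nsq x <= nsq x * (L * qform A x) by rewrite -expr2; nra.
by rewrite ler_pM2l// => h4; nra.
Qed.

Lemma qform_inj n (M N : 'M[R]_n) : symmetric_mx M -> symmetric_mx N ->
  (forall v, qform M v = qform N v) -> M = N.
Proof.
move=> sM sN h.
have pol (K : 'M[R]_n) u v : symmetric_mx K ->
    2 * dot u (K *m v) = qform K (u + v) - qform K u - qform K v.
  by move=> sK; rewrite qformD (dot_sym v u sK); ring.
have ent (K : 'M[R]_n) i j : dot (delta_mx i 0) (K *m delta_mx j 0) = K i j.
  rewrite /dot (bigD1 i)//= big1; last first.
    by move=> k ki; rewrite mxE (negbTE ki) mul0r.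
  by rewrite -colE !mxE !eqxx mul1r addr0.
apply/matrixP => i j; rewrite -!ent.
by apply: (@mulfI _ 2); rewrite ?pnatr_eq0// !pol// !h.
Qed.

End positive_definite.

Section gaussian_density.
Context {R : realType}.
Local Notation B := (measurableTypeR R).

Lemma vmeas_gaussian n (A : 'M[R]_n) : vmeas (gaussian A : _ -> B).
Proof.
apply: measurableT_comp => //; apply: measurableT_comp => //.
by apply: measurable_funM => //; exact: vmeas_qform.
Qed.

Lemma gaussian_ge0 n (A : 'M[R]_n) x : 0 <= gaussian A x.
Proof. exact: expR_ge0. Qed.

Lemma gaussian_gt0 n (A : 'M[R]_n) x : 0 < gaussian A x.
Proof. exact: expR_gt0. Qed.

Lemma gaussianN n (A : 'M[R]_n) x : gaussian A (- x) = gaussian A x.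
Proof. by rewrite /gaussian qformN. Qed.

Lemma Int_gaussian_gt0 n (A : 'M[R]_n) : (0 < Int (fun x => (gaussian A x)%:E))%E.
Proof.
have [r r0 hr] := qform_near A 0 (@ltr01 R).
apply: (@Int_gt0 _ _ _ 0 r (expR (- (2^-1 * (qform A 0 + 1))))) => //.
- exact: expR_gt0.
- exact: (vmeas_EFin (vmeas_gaussian A)).
- by move=> x; rewrite lee_fin gaussian_ge0.
move=> x /hr; rewrite lee_fin ler_expR lerN2 ler_pM2l ?invr_gt0//.
by rewrite ler_norml => /andP[_]; rewrite lerBlDr addrC.
Qed.

(** Uniform in [f], so that near-optimal tuples have bounded moments. *)
Lemma gauss_fourth_moment k (l S : R) : 0 < l -> 0 < S -> exists D : R,
  forall f : 'cV[R]_k -> R, even_density f ->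
    (forall x, f x <= S * expR (- (l * nsq x))) ->
    (mean f (fun x => (nsq x ^+ 2)%R) <= D%:E)%E.
Proof.
move=> l0 S0.
pose F := Int (fun x : 'cV[R]_k => ((1 + nsq x) ^+ 2 * expR (- (l * nsq x)))%:E).
have F0 : (0 <= F)%E.
  by apply: Int_ge0 => x; rewrite lee_fin mulr_ge0 ?expR_ge0 ?sqr_ge0.
exists (S * fine F) => f [mf f0 _ _ _] fS.
rewrite EFinM fineK; last by rewrite ge0_fin_numE// Int_poly_gauss_fin.
have p0 (x : 'cV[R]_k) : (0 <= ((1 + nsq x) ^+ 2 * expR (- (l * nsq x)))%:E)%E.
  by rewrite lee_fin mulr_ge0 ?expR_ge0 ?sqr_ge0.
rewrite /F -(IntZl (ltW S0) p0 (@vmeas_poly_gauss R k l)).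
apply: le_Int.
- by move=> x; rewrite lee_fin mulr_ge0 ?sqr_ge0.
- apply: (@vmeas_EFin _ _ (fun x => nsq x ^+ 2 * f x)).
  by apply: measurable_funM => //; apply: measurable_funX; exact: vmeas_nsq.
- by apply: measurable_funeM; exact: vmeas_poly_gauss.
move=> x; rewrite -EFinM lee_fin mulrCA.
apply: ler_pM; rewrite ?sqr_ge0//.
by rewrite lerXn2r ?nnegrE ?addr_ge0 ?nsq_ge0// lerDr.
Qed.

Section posdef.
Variables (n : nat) (A : 'M[R]_n).
Hypothesis dA : posdef_mx A.

Lemma gaussian_le_gauss : exists2 l, 0 < l &
  forall x, gaussian A x <= expR (- (l * nsq x)).
Proof.
have [k k0 hk] := posdef_coercive dA.
exists (k / 2); first by rewrite divr_gt0.
by move=> x; rewrite ler_expR lerN2; have := hk x; lra.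
Qed.

Lemma gaussian_le1 x : gaussian A x <= 1.
Proof.
by rewrite -expR0 ler_expR oppr_le0 mulr_ge0// ?invr_ge0// posdef_ge0.
Qed.

Lemma Int_gaussian_fin : (Int (fun x => (gaussian A x)%:E) < +oo)%E.
Proof.
have [l l0 hl] := gaussian_le_gauss.
apply: le_lt_trans (Int_gauss_fin n l0); apply: le_Int.
- by move=> x; rewrite lee_fin gaussian_ge0.
- exact: (vmeas_EFin (vmeas_gaussian A)).
- exact: vmeas_gauss.
- by move=> x; rewrite lee_fin.
Qed.

Lemma integral_gaussian_gt0 : 0 < integral_Rn (gaussian A).
Proof.
rewrite integral_Rn_Int; [|exact: gaussian_ge0|exact: vmeas_gaussian].
by rewrite fine_gt0// Int_gaussian_gt0 Int_gaussian_fin.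
Qed.

Lemma Int_gaussianE : Int (fun x => (gaussian A x)%:E) = (integral_Rn (gaussian A))%:E.
Proof.
rewrite integral_Rn_Int; [|exact: gaussian_ge0|exact: vmeas_gaussian].
by rewrite fineK// ge0_fin_numE ?Int_gaussian_fin// ltW// Int_gaussian_gt0.
Qed.

Definition gdens (x : 'cV[R]_n) : R := (integral_Rn (gaussian A))^-1 * gaussian A x.

Let Z0 := integral_gaussian_gt0.

Let iZ0 : 0 <= (integral_Rn (gaussian A))^-1.
Proof. by rewrite invr_ge0 ltW. Qed.

Lemma vmeas_gdens : vmeas (gdens : _ -> B).
Proof.
by apply: measurable_funM; [exact: measurable_cst|exact: vmeas_gaussian].
Qed.

Lemma even_density_gdens : even_density gdens.
Proof.
split.
- exact: vmeas_gdens.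
- by move=> x; rewrite mulr_ge0// gaussian_ge0.
- by move=> x; rewrite /gdens gaussianN.
- exists (integral_Rn (gaussian A))^-1 => x.
  by rewrite ler_piMr// gaussian_le1.
under eq_Int do rewrite EFinM.
rewrite IntZl//.
- by rewrite Int_gaussianE -EFinM mulVf ?gt_eqF.
- by move=> x; rewrite lee_fin gaussian_ge0.
- exact: (vmeas_EFin (vmeas_gaussian A)).
Qed.

(** Centred Gaussians are the fixed points of the doubling map: the exponent is
    invariant under the rotation. *)
Lemma doubling_gdens : doubling gdens = gdens.
Proof.
have [mg g0 gN gb g1] := even_density_gdens.
apply/funext => x; apply: EFin_inj; rewrite (doublingE even_density_gdens).
transitivity (Int (fun y => (gdens x)%:E * (gdens y)%:E)%E).
  apply: eq_Int => y; rewrite -EFinM; congr (_%:E).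
  rewrite /gdens mulrACA [RHS]mulrACA; congr (_ * _).
  rewrite /gaussian -!expRD; congr expR.
  by rewrite -!opprD -!mulrDr (qform_rotate A _ _ isqrt2_sqr).
rewrite IntZl//; last exact: vmeas_EFin.
by rewrite g1 mule1.
Qed.

Lemma gdens_fourth_moment : exists D, (mean gdens (fun x => (nsq x ^+ 2)%R) <= D%:E)%E.
Proof.
have [l l0 hl] := gaussian_le_gauss.
have S0 : 0 < (integral_Rn (gaussian A))^-1 by rewrite invr_gt0.
have [D hD] := gauss_fourth_moment n l0 S0; exists D; apply: hD.
  exact: even_density_gdens.
by move=> x; rewrite ler_wpM2l.
Qed.

End posdef.
End gaussian_density.

(** * The covariance of a Gaussian *)

Section gaussian_covariance.
Context {R : realType}.
Local Notation B := (measurableTypeR R).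

(** Differentiating the moment generating function twice at 0, with an explicit
    remainder: the constant 27 comes from [z ^+ 3 <= 27 * expR z], so that the
    remainder is integrable against a Gaussian. *)
Lemma cosh_approx (t z : R) : 0 < t -> t <= 1 ->
  `|expR (t * z) + expR (- (t * z)) - 2 - t ^+ 2 * z ^+ 2| <=
    27 * t ^+ 3 * (expR (2 * z) + expR (- (2 * z))).
Proof.
move=> t0 t1.
wlog z0 : z / 0 <= z.
  move=> wl; have [/wl//|/ltW z0] := leP 0 z.
  have := wl (- z); rewrite oppr_ge0 => /(_ z0).
  rewrite !mulrN !opprK sqrrN.
  by rewrite [expR (- (t * z)) + _]addrC [expR (- (2 * z)) + _]addrC.
have cube : z ^+ 3 <= 27 * expR z.
  have h : 1 + z / 3 <= expR (z / 3) by exact: expR_ge1Dx.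
  have h0 : 0 <= z / 3 by rewrite divr_ge0.
  have : (z / 3) ^+ 3 <= expR (z / 3) ^+ 3 by rewrite lerXn2r ?nnegrE ?expR_ge0//; lra.
  rewrite -expRM_natl mulr_natl -[in X in expR X]mulr_natr divfK ?pnatr_eq0//.
  by rewrite expr_div_n -[3 ^+ 3]natrX ler_pdivrMr// mulrC.
set E := expR z in cube.
have E1 : 1 <= E by rewrite -expR0 ler_expR.
have sq : expR (2 * z) = E ^+ 2 by rewrite expRM_natl.
have sqN : 0 <= expR (- (2 * z)) by exact: expR_ge0.
set y := t * z.
have y0 : 0 <= y by rewrite mulr_ge0// ltW.
have yz : y <= z by rewrite /y ler_piMl.
set a := expR (y / 2).
have a0 : 0 < a by exact: expR_gt0.
set b := expR (- (y / 2)).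
have b0 : 0 < b by exact: expR_gt0.
have ab : a * b = 1 by rewrite -expRD subrr expR0.
have aa : expR y = a ^+ 2 by rewrite -expRM_natl mulrC divfK ?pnatr_eq0.
have bb : expR (- y) = b ^+ 2 by rewrite -expRM_natl mulrN mulrC divfK ?pnatr_eq0.
have h1 : 1 + y <= a ^+ 2 by rewrite -aa expR_ge1Dx.
have h2 : 1 - y <= b ^+ 2 by rewrite -bb expR_ge1Dx.
have aE : a ^+ 2 <= E by rewrite -aa ler_expR.
(* a - b = a (1 - b^2) = b (a^2 - 1) *)
have d1 : a - b <= a * y.
  have <- : a * (1 - b ^+ 2) = a - b.
    by rewrite mulrBr mulr1 expr2 mulrA ab mul1r.
  by rewrite ler_wpM2l ?(ltW a0)//; lra.
have d2 : b * y <= a - b.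
  have <- : b * (a ^+ 2 - 1) = a - b.
    by rewrite mulrBr mulr1 expr2 mulrCA mulrA ab mul1r.
  by rewrite ler_wpM2l ?(ltW b0)//; lra.
have d0 : 0 <= a - b by apply: le_trans d2; rewrite mulr_ge0// ltW.
have eqd : expR y + expR (- y) - 2 = (a - b) ^+ 2.
  have -> : (a - b) ^+ 2 = a ^+ 2 + b ^+ 2 - 2 * (a * b) by ring.
  by rewrite aa bb ab mulr1.
have up : (a - b) ^+ 2 <= a ^+ 2 * y ^+ 2.
  by rewrite -exprMn ler_pXn2r ?nnegrE// mulr_ge0// ltW.
have lo : b ^+ 2 * y ^+ 2 <= (a - b) ^+ 2.
  by rewrite -exprMn ler_pXn2r ?nnegrE// mulr_ge0// ltW.
have y2 := sqr_ge0 y.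
(* e^y <= 1 + y e^y *)
have ey : a ^+ 2 <= 1 + y * E.
  have : a ^+ 2 * (1 - y) <= 1.
    by apply: (@le_trans _ _ (a ^+ 2 * b ^+ 2)); [rewrite ler_wpM2l ?sqr_ge0|rewrite -exprMn ab expr1n].
  have : y * a ^+ 2 <= y * E by rewrite ler_wpM2l.
  lra.
have y3 : y ^+ 3 = t ^+ 3 * z ^+ 3 by rewrite exprMn.
have t3 : 0 <= t ^+ 3 by rewrite exprn_ge0// ltW.
have z3 : 0 <= z ^+ 3 by rewrite exprn_ge0.
have big : y ^+ 3 * E <= 27 * t ^+ 3 * E ^+ 2.
  rewrite y3; have : t ^+ 3 * (z ^+ 3 * E) <= t ^+ 3 * (27 * E * E).
    by rewrite ler_wpM2l// ler_wpM2r// (le_trans _ E1).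
  lra.
have big0 : y ^+ 3 <= y ^+ 3 * E by rewrite ler_peMr// exprn_ge0.
have rhs : 27 * t ^+ 3 * E ^+ 2 <= 27 * t ^+ 3 * (expR (2 * z) + expR (- (2 * z))).
  by rewrite sq mulrDr lerDl mulr_ge0// mulr_ge0.
apply: le_trans rhs; rewrite eqd -exprMn -/y ler_norml.
have u2 : a ^+ 2 * y ^+ 2 <= (1 + y * E) * y ^+ 2 by rewrite ler_wpM2r.
have l2 : (1 - y) * y ^+ 2 <= b ^+ 2 * y ^+ 2 by rewrite ler_wpM2r.
have eq3 : y ^+ 3 = y * y ^+ 2 by rewrite exprS.
apply/andP; split.
  have : (1 - y) * y ^+ 2 = y ^+ 2 - y ^+ 3 by rewrite eq3; ring.
  lra.
have : (1 + y * E) * y ^+ 2 = y ^+ 2 + y ^+ 3 * E by rewrite eq3; ring.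
lra.
Qed.

Lemma expR_approx (y : R) : 0 <= y -> `|expR y - 1 - y| <= y ^+ 2 * expR y.
Proof.
move=> y0.
have h1 : 1 + y <= expR y by exact: expR_ge1Dx.
have h2 : 1 - y <= expR (- y) by exact: expR_ge1Dx.
have h3 : expR y * (1 - y) <= 1.
  by apply: (@le_trans _ _ (expR y * expR (- y))); [rewrite ler_wpM2l ?expR_ge0|rewrite -expRD subrr expR0].
rewrite ger0_norm; last lra.
have h4 : y * (expR y * (1 - y)) <= y * 1 by rewrite ler_wpM2l.
nra.
Qed.

Lemma eq_of_small (x y C : R) : 0 <= C ->
  (forall t, 0 < t -> t <= 1 -> `|x - y| <= t * C) -> x = y.
Proof.
move=> C0 h; apply/eqP; rewrite -subr_eq0 -normr_le0; apply/ler_addgt0Pr => e e0.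
rewrite add0r; pose t := Num.min 1 (e / (C + 1)).
have C1 : 0 < C + 1 by rewrite ltr_wpDl.
have t0 : 0 < t by rewrite lt_min ltr01 divr_gt0.
apply: (le_trans (h t t0 _)); first by rewrite ge_min lexx.
apply: (@le_trans _ _ (t * (C + 1))); first by rewrite ler_wpM2l ?lerDl// ltW.
by rewrite -ler_pdivlMr// ge_min lexx orbT.
Qed.

Variables (n : nat) (A : 'M[R]_n).
Hypothesis dA : posdef_mx A.
Local Notation G := (gdens A).

Lemma has_expect_ge0 (f phi : 'cV[R]_n -> R) : vmeas (f : _ -> B) -> vmeas (phi : _ -> B) ->
  (forall x, 0 <= f x) -> (forall x, 0 <= phi x) -> (mean f phi < +oo)%E -> has_expect f phi.
Proof.
move=> mf mphi f0 phi0 fin; apply/integrableP; split.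
  exact: (@vmeas_EFin _ _ (fun x => phi x * f x) (measurable_funM mphi mf)).
by under eq_integral do rewrite gee0_abs ?lee_fin ?mulr_ge0//.
Qed.

(** Completing the square turns the moment generating function into a translate
    of the density. *)
Lemma gdens_mgf (a : 'cV[R]_n) (t : R) :
  has_expect G (fun x => expR (t * dot x (A *m a))) /\
  expect G (fun x => expR (t * dot x (A *m a))) = expR (t ^+ 2 * qform A a / 2).
Proof.
have [mG G0 GN _ G1] := even_density_gdens dA.
have mZ : vmeas (fun x => (G x)%:E) by exact: vmeas_EFin.
have e : mean G (fun x => expR (t * dot x (A *m a))) =
    (expR (t ^+ 2 * qform A a / 2))%:E.
  rewrite -[RHS]mule1 -[in RHS]G1.
  rewrite -(@Int_translate _ _ ((- t) *: a) (fun x => (G x)%:E))//.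
  have pG x : (0 <= (G (x + - t *: a))%:E)%E by rewrite lee_fin.
  have mGt : vmeas (fun x => (G (x + - t *: a))%:E).
    have := vmeas_affine 1 ((- t) *: a) mZ.
    by rewrite /vmeas; under eq_fun do rewrite scale1r.
  rewrite -(IntZl (expR_ge0 _) pG mGt).
  apply: eq_Int => x; rewrite -EFinM; congr (_%:E); rewrite /gdens [LHS]mulrCA [RHS]mulrCA; congr (_ * _).
  rewrite /gaussian -!expRD; congr expR.
  rewrite qformD qformZ -!scalemxAr dotZr dotZl (dot_sym a x (proj1 dA)).
  by field.
have L : has_expect G (fun x => expR (t * dot x (A *m a))).
  have mexp : vmeas ((fun x => expR (t * dot x (A *m a))) : _ -> B).
    apply: measurableT_comp => //; apply: measurable_funM => //; exact: vmeas_dot.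
  by apply: (has_expect_ge0 mG mexp G0 (fun x => expR_ge0 _)); rewrite e ltry.
by split => //; apply: EFin_inj; rewrite -mean_expect.
Qed.

(** Compare the second-order terms in [t] of both sides of [gdens_mgf] for [t] and
    [- t]. *)
Lemma gdens_second_moment (a : 'cV[R]_n) :
  expect G (fun x => dot x (A *m a) ^+ 2) = qform A a.
Proof.
have [D hD] := gdens_fourth_moment dA.
have dG := even_density_gdens dA.
have [mG G0 GN _ G1] := dG.
set s := qform A a.
have s0 : 0 <= s by exact: posdef_ge0.
pose v := A *m a.
have L2 : has_expect G (fun x => dot x v ^+ 2).
  apply: (has_expect_bound dG hD (K := nsq v)).
    by apply: measurable_funX; exact: vmeas_dot.
  move=> x; rewrite ger0_norm ?sqr_ge0//.
  apply: (le_trans (dot_CauchySchwarz x v)).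
  rewrite mulrC ler_wpM2l ?nsq_ge0//.
  by have := sqr_ge0 (nsq x - 1); have := nsq_ge0 x; nra.
apply: (@eq_of_small _ _ (54 * expR (2 * s) + s ^+ 2 / 2 * expR (s / 2))).
  by rewrite addr_ge0 ?mulr_ge0 ?expR_ge0 ?divr_ge0 ?sqr_ge0.
move=> t t0 t1.
have approx x : - (27 * t ^+ 3) * (expR (2 * dot x v) + expR (- 2 * dot x v)) <=
    expR (t * dot x v) + expR (- t * dot x v) + - 2 + - t ^+ 2 * dot x v ^+ 2 <=
    27 * t ^+ 3 * (expR (2 * dot x v) + expR (- 2 * dot x v)).
  by rewrite !mulNr -ler_norml; exact: cosh_approx.
have [Lp Ep] := gdens_mgf a t; have [Lm Em] := gdens_mgf a (- t).
have [Lp2 Ep2] := gdens_mgf a 2; have [Lm2 Em2] := gdens_mgf a (- 2).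
have [La Ea] := expectD Lp Lm.
have Lc : has_expect G (fun=> - 2).
  apply: (has_expect_bound dG hD (K := 2)); first exact: measurable_cst.
  by move=> x; rewrite normrN ger0_norm// ler_peMr// lerDl sqr_ge0.
have [Lb Eb] := expectD La Lc.
have [Lz Ez] := expectZ (- t ^+ 2) L2.
have [Ld Ed] := expectD Lb Lz.
have [Lr Err] := expectD Lp2 Lm2.
have [Lq Eq] := expectZ (27 * t ^+ 3) Lr.
have [Lq' Eq'] := expectZ (- (27 * t ^+ 3)) Lr.
have main : `|2 * expR (t ^+ 2 * s / 2) - 2 - t ^+ 2 * expect G (fun x => dot x v ^+ 2)| <=
    54 * t ^+ 3 * expR (2 * s).
  have -> : 2 * expR (t ^+ 2 * s / 2) - 2 - t ^+ 2 * expect G (fun x => dot x v ^+ 2) =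
      expect G (fun x => expR (t * dot x v) + expR (- t * dot x v) + - 2 +
         - t ^+ 2 * dot x v ^+ 2).
    by rewrite Ed Ez Eb (expect_cst dG hD) Ea Ep Em sqrrN -/s; ring.
  have eR : 54 * t ^+ 3 * expR (2 * s) =
      27 * t ^+ 3 * expect G (fun x => expR (2 * dot x v) + expR (- 2 * dot x v)).
    rewrite Err Ep2 Em2 sqrrN -/s (_ : 2 ^+ 2 * s / 2 = 2 * s); first by ring.
    by field.
  rewrite eR ler_norml -mulNr -Eq -Eq'; apply/andP; split.
    apply: (expect_le Lq' Ld) => x; apply: (ler_wpM2r (G0 x)).
    by case/andP: (approx x).
  apply: (expect_le Ld Lq) => x; apply: (ler_wpM2r (G0 x)).
  by case/andP: (approx x).
have y0 : 0 <= t ^+ 2 * s / 2 by rewrite divr_ge0// mulr_ge0// sqr_ge0.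
have := expR_approx y0; set y := t ^+ 2 * s / 2 in main y0 * => hy.
have ys : expR y <= expR (s / 2).
  rewrite ler_expR /y ler_wpM2r ?invr_ge0//.
  by rewrite ler_piMl// expr_le1// ltW.
have hy2 : `|2 * expR y - 2 - t ^+ 2 * s| <= t ^+ 3 * (s ^+ 2 / 2 * expR (s / 2)).
  have -> : 2 * expR y - 2 - t ^+ 2 * s = 2 * (expR y - 1 - y) by rewrite /y; field.
  rewrite normrM ger0_norm//.
  apply: (@le_trans _ _ (2 * (y ^+ 2 * expR (s / 2)))).
    by rewrite ler_wpM2l// (le_trans hy)// ler_wpM2l ?sqr_ge0.
  have -> : 2 * (y ^+ 2 * expR (s / 2)) = t ^+ 3 * (t * (s ^+ 2 / 2 * expR (s / 2))).
    by rewrite /y; field.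
  rewrite ler_wpM2l ?exprn_ge0 ?(ltW t0)//.
  by rewrite ler_piMl// mulr_ge0 ?expR_ge0// divr_ge0 ?sqr_ge0.
have t20 : 0 < t ^+ 2 by rewrite exprn_gt0.
rewrite -(ler_pM2l t20) -[X in X * `|_|](ger0_norm (ltW t20)) -normrM.
have -> : t ^+ 2 * (expect G (fun x => dot x v ^+ 2) - s) =
   (2 * expR y - 2 - t ^+ 2 * s) - (2 * expR y - 2 - t ^+ 2 * expect G (fun x => dot x v ^+ 2)).
  by ring.
apply: (le_trans (ler_normB _ _)).
have -> : t ^+ 2 * (t * (54 * expR (2 * s) + s ^+ 2 / 2 * expR (s / 2))) =
  t ^+ 3 * (s ^+ 2 / 2 * expR (s / 2)) + 54 * t ^+ 3 * expR (2 * s) by ring.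
exact: lerD.
Qed.

Lemma cov_gdens i j : cov G i j = invmx A i j.
Proof.
have [D hD] := gdens_fourth_moment dA.
have dG := even_density_gdens dA.
have uA := posdef_unitmx dA.
suff -> : invmx A = covmx G by rewrite mxE.
apply: qform_inj.
- exact: (proj1 (posdef_invmx dA)).
- exact: covmx_sym.
move=> v; rewrite -(expect_dot_sqr dG hD v).2.
have -> : qform (invmx A) v = qform A (invmx A *m v).
  by rewrite !qformE mulKVmx// dotC.
by rewrite -gdens_second_moment mulKVmx.
Qed.

End gaussian_covariance.

(** * Polynomial bump functions *)

Section bump.
Context {R : realType}.
Local Notation B := (measurableTypeR R).

Let pos (u : R) : R := Num.max 0 u.

Let pos_ge0 u : 0 <= pos u.
Proof. by rewrite le_max lexx. Qed.

Let posP u : (0 <= u /\ pos u = u) \/ (u <= 0 /\ pos u = 0).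
Proof. by rewrite /pos; have [h|h] := leP 0 u; [left|right; split => //; exact: ltW]. Qed.

(** The fourth power makes the positive part three times differentiable with a
    Lipschitz third derivative, so the Taylor remainder is of fourth order. *)
Lemma pos4_taylor (u s : R) : 0 <= u ->
  `|pos (u + s) ^+ 4 - (u ^+ 4 + 4 * u ^+ 3 * s + 6 * u ^+ 2 * s ^+ 2 + 4 * u * s ^+ 3)| <=
    s ^+ 4.
Proof.
move=> u0.
have e : (u + s) ^+ 4 = u ^+ 4 + 4 * u ^+ 3 * s + 6 * u ^+ 2 * s ^+ 2 + 4 * u * s ^+ 3 + s ^+ 4.
  by ring.
have s4 : 0 <= s ^+ 4 by rewrite exprn_even_ge0.
have us4 : 0 <= (u + s) ^+ 4 by rewrite exprn_even_ge0.
rewrite ler_norml.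
have [[h ->]|[h ->]] := posP (u + s); first by lra.
have s0 : s <= 0 by lra.
have : (- (u + s)) ^+ 4 <= (- s) ^+ 4 by rewrite lerXn2r ?nnegrE//; lra.
rewrite (_ : (- (u + s)) ^+ 4 = (u + s) ^+ 4); last by ring.
rewrite (_ : (- s) ^+ 4 = s ^+ 4); last by ring.
by rewrite expr0n/=; lra.
Qed.

(** The second-order expansion of a bump with [a = rho |w|^2], [b = rho |y|^2] and
    [t = rho <w, y>], where [t ^+ 2 <= a * b] is the Cauchy-Schwarz inequality. Three
    regimes: centre outside the support, large increment, small increment. *)
Lemma bump_taylor (a b t : R) : 0 <= a -> 0 <= b -> t ^+ 2 <= a * b ->
  `|pos (1 - a - 2 * t - b) ^+ 4 + pos (1 - a + 2 * t - b) ^+ 4 - 2 * pos (1 - a) ^+ 4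
    - (48 * pos (1 - a) ^+ 2 * t ^+ 2 - 8 * pos (1 - a) ^+ 3 * b)| <= 400 * b ^+ 2.
Proof.
move=> a0 b0 tab.
have b2 := sqr_ge0 b.
have agm v : v ^+ 2 <= a * b -> 0 <= a + b + 2 * v.
  move=> vab; rewrite leNgt; apply/negP => h.
  have s0 : 0 <= a + b by rewrite addr_ge0.
  have X0 : 0 < - (a + b + 2 * v) by lra.
  have h1 : 0 <= - (a + b + 2 * v) * (a + b) by rewrite mulr_ge0// ltW.
  have h2 : 0 < - (a + b + 2 * v) * - (a + b + 2 * v) by rewrite mulr_gt0.
  have := sqr_ge0 (a - b); nra.
have key v : v ^+ 2 <= a * b -> 1 - a <= 0 -> pos (1 - a - 2 * v - b) ^+ 4 <= 16 * b ^+ 2.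
  move=> vab a1; have [[h e]|[_ ->]] := posP (1 - a - 2 * v - b); last first.
    by rewrite expr0n/=; lra.
  rewrite e; set p := 1 - a - 2 * v - b in h e *.
  have p2 : p ^+ 2 <= 4 * b.
    have p1 : p <= 1 by have := agm v vab; rewrite /p; lra.
    have q1 : 0 <= p + a - 1 by lra.
    have q1' : p + a - 1 <= - (2 * v) by rewrite /p; lra.
    have q2 : (p + a - 1) ^+ 2 <= (- (2 * v)) ^+ 2.
      by rewrite lerXn2r ?nnegrE//; lra.
    have q3 : a * p ^+ 2 <= (p + a - 1) ^+ 2.
      have k1 : 0 <= (a - 1) * (p * (2 - p)) by rewrite !mulr_ge0//; lra.
      have := sqr_ge0 (a - 1); nra.
    have a_gt0 : 0 < a by lra.
    rewrite -(ler_pM2l a_gt0); nra.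
  by rewrite (_ : p ^+ 4 = p ^+ 2 * p ^+ 2); [have := sqr_ge0 p; nra|ring].
have [[u0 e]|[u0 e]] := posP (1 - a); rewrite e; last first.
  have k1 := key t tab u0.
  have k2 := key (- t) _ u0; rewrite sqrrN mulrN opprK in k2; have {}k2 := k2 tab.
  have p1 : 0 <= pos (1 - a - 2 * t - b) ^+ 4 by rewrite exprn_ge0.
  have p2 : 0 <= pos (1 - a + 2 * t - b) ^+ 4 by rewrite exprn_ge0.
  by rewrite !expr0n/= ler_norml; lra.
set u := 1 - a in u0 *.
have u1 : u <= 1 by rewrite /u; lra.
have tb : t ^+ 2 <= b by rewrite /u in u0; nra.
have t2 := sqr_ge0 t.
have u2 : 0 <= u ^+ 2 <= 1 by rewrite sqr_ge0 expr_le1.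
have u3 : 0 <= u ^+ 3 <= 1 by rewrite exprn_ge0// expr_le1.
have u4 : 0 <= u ^+ 4 <= 1 by rewrite exprn_ge0// expr_le1.
have [b1|b1] := leP 1 b.
  have le1 v : v ^+ 2 = t ^+ 2 -> 0 <= pos (u - 2 * v - b) ^+ 4 <= 1.
    move=> vt; rewrite exprn_ge0//=.
    have h : u - 2 * v - b <= 1 by have := agm v; rewrite vt /u => /(_ tab); lra.
    by rewrite expr_le1//; have [[_ ->]|[_ ->]] := posP (u - 2 * v - b).
  have k1 := le1 t erefl; have k2 := le1 (- t) (sqrrN t).
  rewrite mulrN opprK in k2.
  have q1 : 0 <= u ^+ 2 * t ^+ 2 <= b by rewrite mulr_ge0//=; nra.
  have q2 : 0 <= u ^+ 3 * b <= b by rewrite mulr_ge0 ?(andP u3).1//=; nra.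
  have bb : b <= b ^+ 2 by rewrite expr2 ler_peMl.
  by rewrite ler_norml; lra.
have T1 := pos4_taylor (- (2 * t) - b) u0; have T2 := pos4_taylor (2 * t - b) u0.
rewrite !addrA in T1 T2.
have bb3 : 0 <= u * b ^+ 3 <= b ^+ 2.
  have h : 0 <= u * b <= 1 by rewrite mulr_ge0//=; nra.
  by rewrite (_ : u * b ^+ 3 = u * b * b ^+ 2); [nra|ring].
have bb2 : 0 <= u ^+ 2 * b ^+ 2 <= b ^+ 2 by nra.
have tbb : 0 <= t ^+ 2 * b <= b ^+ 2 by rewrite mulr_ge0//= expr2 ler_wpM2r.
have utb : 0 <= u * (t ^+ 2 * b) <= b ^+ 2 by nra.
have t4 : 0 <= t ^+ 4 <= b ^+ 2.
  by rewrite (_ : t ^+ 4 = t ^+ 2 * t ^+ 2); [nra|ring].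
have b4 : 0 <= b ^+ 4 <= b ^+ 2.
  have bb1 : b ^+ 2 <= 1 by rewrite expr_le1// ltW.
  by rewrite (_ : b ^+ 4 = b ^+ 2 * b ^+ 2); [rewrite mulr_ge0//= ler_piMl|ring].
have s4 v : (2 * v - b) ^+ 4 <= 8 * (16 * v ^+ 4 + b ^+ 4).
  have h1 : (2 * v - b) ^+ 2 <= 2 * (4 * v ^+ 2 + b ^+ 2).
    by have := sqr_ge0 (2 * v + b); nra.
  have h2 : ((2 * v - b) ^+ 2) ^+ 2 <= (2 * (4 * v ^+ 2 + b ^+ 2)) ^+ 2.
    by rewrite lerXn2r ?nnegrE ?sqr_ge0//; have := sqr_ge0 v; lra.
  have h3 := sqr_ge0 (4 * v ^+ 2 - b ^+ 2).
  by rewrite (_ : (2 * v - b) ^+ 4 = ((2 * v - b) ^+ 2) ^+ 2); [nra|ring].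
have S1 := s4 (- t); have S2 := s4 t.
rewrite mulrN (_ : (- t) ^+ 4 = t ^+ 4) in S1; last by ring.
move: T1 T2; rewrite !ler_norml.
set P1 := pos _ ^+ 4; set P2 := pos _ ^+ 4.
have e1 : u ^+ 4 + 4 * u ^+ 3 * (- (2 * t) - b) + 6 * u ^+ 2 * (- (2 * t) - b) ^+ 2 +
    4 * u * (- (2 * t) - b) ^+ 3 + (u ^+ 4 + 4 * u ^+ 3 * (2 * t - b) +
    6 * u ^+ 2 * (2 * t - b) ^+ 2 + 4 * u * (2 * t - b) ^+ 3) =
  2 * u ^+ 4 + (48 * u ^+ 2 * t ^+ 2 - 8 * u ^+ 3 * b) +
  (12 * (u ^+ 2 * b ^+ 2) - 8 * (u * b ^+ 3) - 96 * (u * (t ^+ 2 * b))) by ring.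
set X := (2 * t - b) ^+ 4 in S2 *.
set Y := (- (2 * t) - b) ^+ 4 in S1 *.
lra.
Qed.

(** Supported in a ball, unlike a Gaussian, so that the mean of a density against it
    only sees nearby values. *)
Definition bump n (rho : R) (x0 x : 'cV[R]_n) : R := pos (1 - rho * nsq (x - x0)) ^+ 4.

Lemma bump_ge0 n (rho : R) (x0 x : 'cV[R]_n) : 0 <= bump rho x0 x.
Proof. by rewrite exprn_ge0. Qed.

Lemma bump_supp n (rho : R) (x0 x : 'cV[R]_n) : 1 <= rho * nsq (x - x0) -> bump rho x0 x = 0.
Proof.
move=> h; rewrite /bump; have [[h' ->]|[_ ->]] := posP (1 - rho * nsq (x - x0)).
  have -> : 1 - rho * nsq (x - x0) = 0 by lra.
  by rewrite expr0n.
by rewrite expr0n.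
Qed.

Lemma vmeas_bump n (rho : R) (x0 : 'cV[R]_n) : vmeas (bump rho x0 : _ -> B).
Proof.
apply: measurable_funX; apply: measurable_maxr; first exact: measurable_cst.
apply: measurable_funB; first exact: measurable_cst.
apply: measurable_funM; first exact: measurable_cst.
have := vmeas_affine 1 (- x0) (@vmeas_nsq R n).
by rewrite /vmeas; under eq_fun do rewrite scale1r.
Qed.

Lemma Int_bump_gt0 n (rho : R) (x0 : 'cV[R]_n) : 0 < rho ->
  (0 < Int (fun x => (bump rho x0 x)%:E))%E.
Proof.
move=> r0; apply: (@Int_gt0 _ _ _ x0 (2^-1 / rho) ((1 / 2) ^+ 4)).
- by rewrite divr_gt0.
- by rewrite exprn_gt0.
- exact: (vmeas_EFin (vmeas_bump rho x0)).
- by move=> x; rewrite lee_fin bump_ge0.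
move=> x; rewrite ltr_pdivlMr// => h; rewrite lee_fin /bump.
have [[_ ->]|[]] := posP (1 - rho * nsq (x - x0)); last lra.
by rewrite lerXn2r ?nnegrE//; lra.
Qed.

Lemma test_fun_bump n (rho : R) (x0 : 'cV[R]_n) : 0 < rho ->
  test_fun (56 * rho) (400 * rho ^+ 2) (bump rho x0).
Proof.
move=> r0; split.
- exact: vmeas_bump.
- move=> x; apply/andP; split; first exact: bump_ge0.
  rewrite /bump expr_le1//.
  have [[_ ->]|[_ ->]] := posP (1 - rho * nsq (x - x0)); last exact: ler01.
  by rewrite gerBl mulr_ge0 ?nsq_ge0// ltW.
move=> x; have [w we] : {w | w = x - x0} by exists (x - x0).
set u := pos (1 - rho * nsq w).
exists ((48 * u ^+ 2 * rho ^+ 2) *: (w *m w^T) - (8 * u ^+ 3 * rho)%:M).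
  move=> i j; rewrite !mxE big_ord1 !mxE.
  have u_bound : u = 0 \/ (0 <= u <= 1 /\ rho * nsq w <= 1).
    rewrite /u; have [[h ->]|[_ ->]] := posP (1 - rho * nsq w); [right|by left].
    by rewrite h; have := mulr_ge0 (ltW r0) (nsq_ge0 w); lra.
  case: u_bound => [->|[u01 wr]].
    by rewrite !expr0n/= !mulr0 !mul0r mul0rn subrr normr0 mulr_ge0// ltW.
  have u2 : 0 <= u ^+ 2 <= 1 by case/andP: u01 => h1 h2; rewrite sqr_ge0 expr_le1.
  have u3 : 0 <= u ^+ 3 <= 1 by case/andP: u01 => h1 h2; rewrite exprn_ge0// expr_le1.
  rewrite (le_trans (ler_normB _ _))// (_ : 56 * rho = 48 * rho + 8 * rho); last by ring.
  apply: lerD.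
    rewrite (_ : 48 * u ^+ 2 * rho ^+ 2 * (w i 0 * w j 0) =
      48 * (u ^+ 2 * (rho ^+ 2 * (w i 0 * w j 0)))); last by ring.
    rewrite normrM ger0_norm// ler_pM2l// normrM ger0_norm; last by case/andP: u2.
    have hw : `|rho ^+ 2 * (w i 0 * w j 0)| <= rho.
      rewrite normrM ger0_norm ?sqr_ge0// expr2 -mulrA -[leRHS]mulr1 ler_pM2l//.
      apply: le_trans wr; rewrite ler_pM2l//.
      have hi := coord_sqr_le w i; have hj := coord_sqr_le w j.
      have e1 := sqr_ge0 (w i 0 + w j 0); have e2 := sqr_ge0 (w i 0 - w j 0).
      by case: (ger0P (w i 0 * w j 0)) => _; nra.
    apply: le_trans hw; rewrite -[leRHS]mul1r ler_wpM2r//; by case/andP: u2.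
  have h3 : 0 <= 8 * u ^+ 3 * rho <= 8 * rho.
    have r00 := ltW r0; case/andP: u3 => h1 h2; apply/andP; split.
      by apply: mulr_ge0 => //; apply: mulr_ge0.
    by rewrite ler_wpM2r// ler_piMr.
  case: (i == j); rewrite ?mulr1n ?mulr0n ?normr0; last by rewrite mulr_ge0// ltW.
  by case/andP: h3 => h1 h2; rewrite ger0_norm.
move=> y.
have := @bump_taylor (rho * nsq w) (rho * nsq y) (rho * dot w y)
  (mulr_ge0 (ltW r0) (nsq_ge0 w)) (mulr_ge0 (ltW r0) (nsq_ge0 y)) _.
have CS : (rho * dot w y) ^+ 2 <= rho * nsq w * (rho * nsq y).
  rewrite exprMn (_ : rho * nsq w * (rho * nsq y) = rho ^+ 2 * (nsq w * nsq y)); last by ring.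
  by rewrite ler_wpM2l ?sqr_ge0 ?dot_CauchySchwarz.
move=> /(_ CS); rewrite /bump -we -/u.
have -> : x + y - x0 = w + y by rewrite we addrAC.
have -> : x - y - x0 = w - y by rewrite we addrAC.
rewrite !nsqD nsqN dotNr.
rewrite (_ : 1 - rho * (nsq w + 2 * dot w y + nsq y) =
  1 - rho * nsq w - 2 * (rho * dot w y) - rho * nsq y); last by ring.
rewrite (_ : 1 - rho * (nsq w + 2 * - dot w y + nsq y) =
  1 - rho * nsq w + 2 * (rho * dot w y) - rho * nsq y); last by ring.
rewrite (_ : 400 * rho ^+ 2 * nsq y ^+ 2 = 400 * (rho * nsq y) ^+ 2); last by ring.
rewrite (_ : qform _ y = 48 * u ^+ 2 * (rho * dot w y) ^+ 2 - 8 * u ^+ 3 * (rho * nsq y))//.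
rewrite qformE mulmxBl -scalemxAl mul_scalar_mx dotDr dotNr !dotZr -nsqE -mulmxA.
have -> : dot y (w *m (w^T *m y)) = dot w y ^+ 2.
  have -> : w^T *m y = (dot w y)%:M.
    apply/matrixP => i j; rewrite !ord1 !mxE eqxx mulr1n.
    by apply: eq_bigr => k _; rewrite mxE.
  by rewrite mul_mx_scalar dotZr dotC expr2.
by ring.
Qed.

End bump.

(** * Feasible tuples of even densities *)

Section blocks.
Context {R : realType}.
Variables (m : nat) (n : 'I_m -> nat).
Local Notation vecs := (forall i, 'cV[R]_(n i)).

Lemma mxcolZ (a : R) (x : vecs) : \mxcol_i (a *: x i) = a *: \mxcol_i x i.
Proof. by apply/matrixP => s j; rewrite !mxE. Qed.

Lemma nsq_mxcol (x : vecs) : nsq (\mxcol_i x i) = \sum_i nsq (x i).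
Proof.
have e k (v : 'cV[R]_k) : nsq v = (v^T *m v) 0 0.
  by rewrite mxE; apply: eq_bigr => i _; rewrite mxE expr2.
rewrite e tr_mxcol mul_mxrow_mxcol summxE.
by apply: eq_bigr => i _; rewrite e.
Qed.

Definition block (x : vecs) (i : 'I_m) : 'cV[R]_(\sum_(i < m) n i) :=
  \mxcol_j (x j *+ (j == i)).

Lemma mxcol_blocks (x : vecs) (s : 'I_m -> R) :
  \mxcol_i (s i *: x i) = \sum_i s i *: block x i.
Proof.
transitivity (\sum_i \mxcol_j (s i *: (x j *+ (j == i)))); last first.
  by apply: eq_bigr => i _; rewrite mxcolZ.
rewrite -mxcol_sum; apply: eq_mxcol => j.
rewrite (bigD1 j)//= eqxx mulr1n big1 ?addr0// => i /negbTE ij.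
by rewrite eq_sym ij mulr0n scaler0.
Qed.

(** By the parallelogram identity one of the two choices of each sign does not
    decrease the form. *)
Lemma qform_signs k (Q : 'M[R]_k) (I : eqType) (b : I -> 'cV[R]_k) (r : seq I) : uniq r ->
  exists2 s : I -> R, (forall i, s i = 1 \/ s i = -1) &
    \sum_(i <- r) qform Q (b i) <= qform Q (\sum_(i <- r) s i *: b i).
Proof.
elim: r => [_|i r IH /= /andP[ir ur]].
  by exists (fun=> 1) => [_|]; [left|rewrite !big_nil qform0].
have [s s1 hs] := IH ur.
have change e : \sum_(j <- r) (if j == i then e else s j) *: b j = \sum_(j <- r) s j *: b j.
  rewrite !big_seq; apply: eq_bigr => j jr.
  by case: eqP => // ji; move: ir; rewrite -ji jr.
set a := \sum_(j <- r) s j *: b j in hs change.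
have par := qform_parallelogram Q (b i) a.
have [h|h] := leP (qform Q (b i) + qform Q a) (qform Q (b i + a)).
- exists (fun j => if j == i then 1 else s j).
    by move=> j; case: ifP => _; [left|exact: s1].
  rewrite !big_cons change eqxx scale1r; apply: le_trans h.
  by rewrite lerD2l.
- exists (fun j => if j == i then -1 else s j).
    by move=> j; case: ifP => _; [right|exact: s1].
  rewrite !big_cons change eqxx scaleN1r.
  have -> : - b i + a = - (b i - a) by rewrite opprB addrC.
  rewrite qformN; lra.
Qed.

End blocks.

Section feasible.
Context {R : realType}.
Variables (m : nat) (n : 'I_m -> nat) (c : 'I_m -> R).
Variable Q : 'M[R]_(\sum_(i < m) n i).
Hypothesis c_gt0 : forall i, 0 < c i.
Local Notation vecs := (forall i, 'cV[R]_(n i)).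
Local Notation funs := (forall i, 'cV[R]_(n i) -> R).

(** The constraint for normalized functions: dividing [f i] by its integral turns an
    upper bound for the product of the integrals into a lower bound for [K]. *)
Definition feasible (K : R) (f : funs) : Prop :=
  [/\ forall i, even_density (f i), 0 < K &
    forall x : vecs, \prod_i f i (x i) `^ c i <= K * expR (- qform Q (\mxcol_i x i))].

Variable delta : R.
Hypothesis delta_gt0 : 0 < delta.
Hypothesis Q_block : forall (x : vecs) i, delta * nsq (x i) <= qform Q (block x i).

(** Scaled so that the product of the powers [c i] is [expR (- delta * |x|^2)], an upper
    bound for the exponential of minus the diagonal blocks. *)
Definition envelope (i : 'I_m) (x : 'cV[R]_(n i)) : R := expR (- (delta / c i * nsq x)).
Arguments envelope : clear implicits.

Definition envelope_mass (i : 'I_m) : R := fine (Int (fun x => (envelope i x)%:E)).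

Let rate_gt0 i : 0 < delta / c i.
Proof. exact: divr_gt0. Qed.

Lemma envelope_gt0 i x : 0 < envelope i x.
Proof. exact: expR_gt0. Qed.

Lemma Int_envelope i : Int (fun x => (envelope i x)%:E) = (envelope_mass i)%:E.
Proof.
rewrite fineK// ge0_fin_numE; first exact: (Int_gauss_fin (n i) (rate_gt0 i)).
by apply: Int_ge0 => x; rewrite lee_fin ltW// envelope_gt0.
Qed.

Lemma vmeas_envelope i : vmeas (fun x => (envelope i x)%:E).
Proof. exact: vmeas_gauss. Qed.

Lemma envelope_mass_gt0 i : 0 < envelope_mass i.
Proof.
rewrite -lte_fin -Int_envelope.
have l0 := rate_gt0 i.
apply: (@Int_gt0 _ _ _ 0 1 (expR (- (delta / c i)))) => //.
- exact: expR_gt0.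
- exact: vmeas_envelope.
- by move=> x; rewrite lee_fin ltW// envelope_gt0.
move=> x; rewrite subr0 lee_fin ler_expR lerN2 => /ltW h.
by rewrite -[leRHS]mulr1 ler_pM2l.
Qed.

Lemma prod_envelope (x : vecs) :
  \prod_i envelope i (x i) `^ c i = expR (- \sum_i delta * nsq (x i)).
Proof.
rewrite -sumrN expR_sum; apply: eq_bigr => i _.
by rewrite /envelope -expRM; congr expR; field; rewrite gt_eqF.
Qed.

(** Flipping the signs of the blocks does not change the left-hand side of the
    constraint, and a good choice of signs bounds the right-hand side by the
    diagonal blocks of the form alone. *)
Lemma feasible_ratio K f : feasible K f -> forall x : vecs,
  \prod_i (f i (x i) / envelope i (x i)) `^ c i <= K.
Proof.
move=> [df K0 fK] x.
have [s s1 hs] := qform_signs Q (block x) (index_enum_uniq 'I_m).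
have := fK (fun i => s i *: x i).
have -> : \prod_i f i (s i *: x i) `^ c i = \prod_i f i (x i) `^ c i.
  apply: eq_bigr => i _; have [_ _ fN _ _] := df i.
  by case: (s1 i) => ->; rewrite ?scale1r ?scaleN1r ?fN.
rewrite mxcol_blocks => h.
have e0 i : 0 < envelope i (x i) by exact: envelope_gt0.
have : \prod_i f i (x i) `^ c i <= K * \prod_i envelope i (x i) `^ c i.
  apply: (le_trans h); rewrite prod_envelope ler_pM2l// ler_expR lerN2.
  by apply: le_trans hs; apply: ler_sum => i _; exact: Q_block.
rewrite -ler_pdivrMr; last by apply: prodr_gt0 => i _; exact: powR_gt0.
apply: le_trans; rewrite -prodfV -big_split/=.
apply: ler_prod => i _; have [_ f0 _ _ _] := df i.
rewrite powR_ge0/= powRM ?invr_ge0 ?(ltW (e0 i))// ler_wpM2l ?powR_ge0//.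
by rewrite -powR_inv1 ?(ltW (e0 i))// -powRrM mulN1r powRN.
Qed.

(** A density below [envelope i / (2 * envelope_mass i)] would have integral at most
    1/2. *)
Lemma ratio_large K f : feasible K f ->
  exists x : vecs, forall i, (2 * envelope_mass i)^-1 < f i (x i) / envelope i (x i).
Proof.
move=> [df _ _].
suff h i : exists x, (2 * envelope_mass i)^-1 < f i x / envelope i x.
  by exists (fun i => projT1 (cid (h i))) => i; case: cid.
apply: contrapT => /forallNP nh.
have [mf f0 _ _ f1] := df i.
have E0 := envelope_mass_gt0 i.
have k0 : 0 <= (2 * envelope_mass i)^-1 by rewrite invr_ge0 mulr_ge0// ltW.
have := @le_Int _ _ (fun x => (f i x)%:E)
  (fun x => (2 * envelope_mass i)^-1%:E * (envelope i x)%:E)%E.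
rewrite f1 IntZl//; last 2 first.
- by move=> x; rewrite lee_fin ltW// envelope_gt0.
- exact: vmeas_envelope.
rewrite Int_envelope -EFinM lee_fin => H.
have : 1 <= (2 * envelope_mass i)^-1 * envelope_mass i.
  apply: H.
  - by move=> x; rewrite lee_fin.
  - exact: vmeas_EFin.
  - by apply: measurable_funeM; exact: vmeas_envelope.
  - move=> x; rewrite -EFinM lee_fin -ler_pdivrMr ?envelope_gt0//.
    by rewrite leNgt; apply/negP; exact: nh.
by rewrite invfM -mulrA mulVf ?gt_eqF// mulr1; lra.
Qed.

Definition cost_floor : R := \prod_i (2 * envelope_mass i)^-1 `^ c i.

Lemma cost_floor_gt0 : 0 < cost_floor.
Proof.
apply: prodr_gt0 => i _; apply: powR_gt0; rewrite invr_gt0 mulr_gt0//.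
exact: envelope_mass_gt0.
Qed.

Lemma cost_floor_le K f : feasible K f -> cost_floor <= K.
Proof.
move=> fK; have [x hx] := ratio_large fK.
apply: le_trans (feasible_ratio fK x); apply: ler_prod => i _.
rewrite powR_ge0/=; apply: ge0_ler_powR; rewrite ?nnegrE ?(ltW (c_gt0 i))//.
- by rewrite invr_ge0 mulr_ge0// ltW// envelope_mass_gt0.
- by apply: (le_trans _ (ltW (hx i))); rewrite invr_ge0 mulr_ge0// ltW// envelope_mass_gt0.
- exact/ltW/hx.
Qed.

(** Freeze all arguments but one at points where the ratios are bounded below. *)
Lemma feasible_le_envelope (M : R) : exists2 S, 0 < S &
  forall K f, feasible K f -> K <= M -> forall i x, f i x <= S * envelope i x.
Proof.
pose P i := \prod_(j | j != i) (2 * envelope_mass j)^-1 `^ c j.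
have a0 j : 0 < (2 * envelope_mass j)^-1.
  by rewrite invr_gt0 mulr_gt0// envelope_mass_gt0.
have P0 i : 0 < P i by apply: prodr_gt0 => j _; exact: powR_gt0.
exists (1 + \sum_i (M / P i) `^ (c i)^-1).
  by rewrite ltr_wpDr// sumr_ge0// => i _; exact: powR_ge0.
move=> K f fK KM i x.
have [df K0 _] := fK; have [_ f0 _ _ _] := df i.
rewrite -ler_pdivrMr ?envelope_gt0//.
apply: (@le_trans _ _ ((M / P i) `^ (c i)^-1)); last first.
  rewrite (bigD1 i)//= addrCA lerDl addr_ge0// sumr_ge0// => j _; exact: powR_ge0.
have r0 : 0 <= f i x / envelope i x by rewrite divr_ge0// ltW// envelope_gt0.
have MP : 0 <= M / P i by rewrite divr_ge0// ltW// (lt_le_trans K0).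
have [z hz] := ratio_large fK.
have := feasible_ratio fK (dfwith z i x).
rewrite (bigD1 i)//= dfwithin => h.
have hP : P i <= \prod_(j | j != i)
    (f j (dfwith z i x j) / envelope j (dfwith z i x j)) `^ c j.
  apply: ler_prod => j ji; rewrite powR_ge0/= dfwithout 1?eq_sym//.
  have h0 := le_trans (ltW (a0 j)) (ltW (hz j)).
  by apply: ge0_ler_powR; rewrite ?nnegrE ?(ltW (c_gt0 j)) ?(ltW (a0 j)) ?(ltW (hz j)).
have h1 : (f i x / envelope i x) `^ c i <= M / P i.
  rewrite ler_pdivlMr//; apply: le_trans KM; apply: le_trans h.
  by rewrite ler_wpM2l// powR_ge0.
have c0 := lt0r_neq0 (c_gt0 i).
rewrite -[leLHS](@powRr1 R)// -(divff c0) powRrM.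
by apply: ge0_ler_powR; rewrite ?nnegrE ?powR_ge0 ?invr_ge0 ?(ltW (c_gt0 i)).
Qed.

(** The reciprocal of the best upper bound for the product of the integrals. *)
Definition cost : R := inf [set K | exists f, feasible K f].

Lemma cost_le K f : feasible K f -> cost <= K.
Proof.
move=> fK; apply: ge_inf; last by exists f.
by exists cost_floor => K' [g gK]; exact: cost_floor_le gK.
Qed.

Lemma cost_gt0 K f : feasible K f -> 0 < cost.
Proof.
move=> fK; apply: (lt_le_trans cost_floor_gt0); apply: lb_le_inf.
  by exists K, f.
by move=> K' [g gK]; exact: cost_floor_le gK.
Qed.

Lemma cost_adherent K f e : feasible K f -> 0 < e ->
  exists K' g, feasible K' g /\ K' <= cost + e.
Proof.
move=> fK e0.
have hi : has_inf [set K | exists f, feasible K f].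
  split; first by exists K, f.
  by exists cost_floor => K' [g gK]; exact: cost_floor_le gK.
have [K' [g gK'] h] := inf_adherent e0 hi.
by exists K', g; split => //; exact: ltW.
Qed.

(** For fixed [x] the functions y |-> f (isqrt2 (x + y)) f (isqrt2 (x - y)) are even,
    whatever [f]; rotation invariance of the form makes the tuple of these
    functions feasible, so the best constant bounds the product of their
    integrals. *)
Lemma feasible_doubling K f : feasible K f ->
  feasible (K ^+ 2 / cost) (fun i => doubling (f i)).
Proof.
move=> fK; have k0 := cost_gt0 fK; have [df K0 hf] := fK.
split.
- by move=> i; exact: even_density_doubling.
- by rewrite divr_gt0// exprn_gt0.
move=> x; pose J i := doubling (f i) (x i).
have J0 i : 0 <= J i := doubling_ge0 (df i) (x i).
have [[i Ji]|Jn] := pselect (exists i, J i = 0).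
  rewrite (bigD1 i)//= -/(J i) Ji powR0 ?gt_eqF// mul0r.
  by rewrite mulr_ge0 ?expR_ge0// divr_ge0 ?sqr_ge0// ltW.
have Jp i : 0 < J i.
  by rewrite lt_neqAle J0 andbT eq_sym; apply/eqP => Ji; apply: Jn; exists i.
pose h i (y : 'cV[R]_(n i)) := (J i)^-1 * (f i (isqrt2 *: (x i + y)) * f i (isqrt2 *: (x i - y))).
pose V := \prod_i J i `^ c i.
have V0 : 0 < V by apply: prodr_gt0 => i _; exact: powR_gt0.
have hh : feasible (K ^+ 2 * expR (- qform Q (\mxcol_i x i)) / V) h.
  split.
  - move=> i; have [mf f0 fN [b fb] f1] := df i.
    have iJ : 0 <= (J i)^-1 by rewrite invr_ge0.
    have b0 : 0 <= b := le_trans (f0 0) (fb 0).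
    split.
    + apply: measurable_funM; first exact: measurable_cst.
      exact: (vmeas2_section (x i) (vmeas2_rot mf)).
    + by move=> y; rewrite mulr_ge0// mulr_ge0.
    + by move=> y; rewrite /h opprK [f i _ * _]mulrC.
    + exists ((J i)^-1 * (b * b)) => y; rewrite /h ler_wpM2l// ler_pM//.
    + under eq_Int do rewrite EFinM.
      rewrite IntZl//; last 2 first.
      * by move=> y; rewrite lee_fin mulr_ge0.
      * exact: vmeas_rot.
      by rewrite -(doublingE (df i)) -EFinM mulVf// gt_eqF// Jp.
  - by rewrite divr_gt0// mulr_gt0 ?exprn_gt0// expR_gt0.
  move=> y.
  have h1 := hf (fun i => isqrt2 *: (x i + y i)); have h2 := hf (fun i => isqrt2 *: (x i - y i)).
  have e : \prod_i h i (y i) `^ c i = V^-1 *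
      (\prod_i f i (isqrt2 *: (x i + y i)) `^ c i * \prod_i f i (isqrt2 *: (x i - y i)) `^ c i).
    rewrite /V -prodfV -!big_split/=; apply: eq_bigr => i _.
    have [_ f0 _ _ _] := df i.
    rewrite /h powRM ?invr_ge0 ?mulr_ge0// powRM//; congr (_ * _).
    by rewrite -powR_inv1// -powRrM mulN1r powRN.
  rewrite e [leLHS]mulrC [leRHS]mulrAC ler_pM2r ?invr_gt0//.
  have p0 (z : vecs) : 0 <= \prod_i f i (z i) `^ c i.
    by apply: prodr_ge0 => i _; exact: powR_ge0.
  apply: (le_trans (ler_pM (p0 _) (p0 _) h1 h2)).
  rewrite mulrACA [K ^+ 2]expr2 -[leRHS]mulrA -!expRD ler_pM2l ?mulr_gt0// ler_expR.
  rewrite -!opprD lerN2 !mxcolZ mxcolD mxcolB.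
  by rewrite (qform_rotate Q _ _ isqrt2_sqr).
have := cost_le hh; rewrite ler_pdivlMr// => h1.
by rewrite -/V mulrAC ler_pdivlMr// mulrC.
Qed.

(** The defect [K / cost] is squared by each doubling. *)
Lemma feasible_iter K f k : feasible K f ->
  feasible (cost * (K / cost) ^+ (2 ^ k)) (fun i => iter k (@doubling R (n i)) (f i)).
Proof.
move=> fK; have k0 := cost_gt0 fK; elim: k => [|k IH].
  by rewrite expn0 expr1 mulrC divfK ?gt_eqF.
have := feasible_doubling IH; rewrite exprMn (_ : _ / cost = cost * (K / cost) ^+ (2 ^ k.+1))//.
rewrite expnS mulnC exprM; field; exact: lt0r_neq0.
Qed.

End feasible.

(** * Near-optimal tuples and their limit *)

Section compactness.
Context {R : realType}.
Local Notation B := (measurableTypeR R).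

(** An ultrafilter makes all entries of all covariance matrices converge at once,
    without extracting subsequences. *)
Lemma ultra_limit (U : set_system nat) (u : nat -> R) (b : R) : UltraFilter U ->
  (forall j, `|u j| <= b) -> exists L, forall e, 0 < e -> U [set j | `|u j - L| < e].
Proof.
move=> UU ub.
have UF : ProperFilter U by exact: ultra_proper.
pose S : set R := [set x | U [set j | x <= u j]].
have Sb : S (- b).
  by apply: (@filterS _ U _ setT) filterT => j _ /=; have := ub j; rewrite ler_norml => /andP[].
have Sub : ubound S b.
  move=> x Sx; have [j /= xj] := filter_ex Sx.
  by apply: (le_trans xj); have := ub j; rewrite ler_norml => /andP[].
have hS : has_sup S by split; [exists (- b)|exists b].
exists (sup S) => e e0.
have [x Sx xe] := sup_adherent e0 hS.
have nS : ~ S (sup S + e).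
  by move=> /(ub_le_sup (proj2 hS)); rewrite gerDl leNgt e0.
have [//|h] := in_ultra_setVsetC [set j | sup S + e <= u j] UU.
apply: (@filterS _ U _ ([set j | x <= u j] `&` ~` [set j | sup S + e <= u j])).
  move=> j /= [h1 h2]; have {}h2 : u j < sup S + e by rewrite ltNge; apply/negP.
  by rewrite ltr_norml; apply/andP; split; lra.
exact: filterI.
Qed.

(** Slabs shrink to a hyperplane, which is a null set; uniformly, a density below a
    fixed Gaussian cannot concentrate there. *)
Lemma slab_small n (v : 'cV[R]_n) (l S : R) : v != 0 -> 0 < l -> 0 < S ->
  exists2 r : R, 0 < r &
    (Int (fun x : 'cV[R]_n => (S * expR (- (l * nsq x)) *
       (`|dot x v| < r)%R%:R)%R%:E) <= (2^-1)%:E)%E.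
Proof.
move=> v0 l0 S0.
pose G (t : n.-tuple B) : R := S * expR (- (l * nsq (col_of_tuple t))).
pose z (t : n.-tuple B) : B := dot (col_of_tuple t) v.
pose A (k : nat) : set (n.-tuple B) := [set t | `|z t| < k.+1%:R^-1].
have mz : measurable_fun setT z by exact: vmeas_dot.
have mA k : measurable (A k).
  rewrite (_ : A k = setT `&` z @^-1` `]- k.+1%:R^-1, k.+1%:R^-1[%classic).
    exact: mz.
  by apply/seteqP; split => t; rewrite /A/= in_itv/= ltr_norml; tauto.
have G0 t : 0 <= G t by rewrite mulr_ge0 ?expR_ge0// ltW.
have mG : measurable_fun setT (EFin \o G).
  apply/measurable_EFinP; apply: measurable_funM; first exact: measurable_cst.
  by apply/measurable_EFinP; exact: (@vmeas_gauss R n l).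
have iG : (lebesgue_tuple R n).-integrable setT (EFin \o G).
  apply/integrableP; split => //.
  under eq_integral do rewrite gee0_abs ?lee_fin//.
  have -> : (\int[lebesgue_tuple R n]_t (EFin \o G) t)%E =
     Int (fun x : 'cV[R]_n => S%:E * (expR (- (l * nsq x)))%:E)%E.
    by apply: eq_integral => t _; rewrite /G/= EFinM.
  rewrite IntZl ?(ltW S0)//; last exact: vmeas_gauss.
  rewrite lte_mul_pinfty ?Int_gauss_fin// lee_fin ltW//.
pose f_ k t := (G t * \1_(A k) t)%:E.
have mf_ k : measurable_fun setT (f_ k).
  apply/measurable_EFinP; apply: measurable_funM; first exact/measurable_EFinP.
  exact: measurable_indic.
have := @dominated_convergence _ _ _ (lebesgue_tuple R n) setT measurableT f_ (cst 0%E)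
  (EFin \o G) mf_ (measurable_cst _) _ iG _.
case.
- exists [set t | z t = 0]; split.
  + rewrite (_ : [set _ | _] = setT `&` z @^-1` [set 0]).
      by apply: mz => //; exact: measurable_set1.
    by apply/seteqP; split => t /=; tauto.
  + exact: hyperplane_null.
  + move=> t /= /not_implyP[_ nt]; apply: contrapT => /eqP zt; apply: nt.
    apply: cvg_near_cst.
    have z0 : 0 < `|z t| by rewrite normr_gt0.
    have := near_infty_natSinv_lt (PosNum z0); apply: filterS => k /= hk.
    rewrite /f_ indicE memNset ?mulr0// /A/= => h.
    by have := lt_trans h hk; rewrite ltxx.
- apply: aeW => t k _; rewrite /f_ /= lee_fin ger0_norm; last exact: (mulr_ge0 (G0 t)).
  by rewrite ler_piMr// indicE; case: (_ \in _).
move=> _ _; rewrite integral0 => cv.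
apply: contrapT => nr.
suff : ((2^-1 : R)%:E <= 0)%E by rewrite lee_fin leNgt invr_gt0 ltr0n.
apply: cvge_ge cv; apply: nearW => k; rewrite leNgt; apply/negP => /ltW h.
apply: nr; exists k.+1%:R^-1; first by rewrite invr_gt0.
apply: le_trans h; rewrite le_eqVlt; apply/orP; left; apply/eqP.
apply: eq_integral => t _; rewrite /f_ /G indicE; congr (_ * _%:R)%:E.
by congr nat_of_bool; apply/idP/idP; rewrite inE.
Qed.

(** Half of the mass lies outside a slab [|<x, v>| < r]. *)
Lemma second_moment_floor n (v : 'cV[R]_n) (l S : R) : v != 0 -> 0 < l -> 0 < S ->
  exists2 e, 0 < e & forall (f : 'cV[R]_n -> R) (D : R), even_density f ->
    (mean f (fun x => (nsq x ^+ 2)%R) <= D%:E)%E ->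
    (forall x, f x <= S * expR (- (l * nsq x))) -> e <= qform (covmx f) v.
Proof.
move=> v0 l0 S0; have [r r0 hr] := slab_small v0 l0 S0.
exists (2^-1 * r ^+ 2); first by rewrite mulr_gt0 ?exprn_gt0// invr_gt0.
move=> f D df fD fS; have [mf f0 _ _ f1] := df.
have [L E] := expect_dot_sqr df fD v.
have r20 : 0 < r ^+ 2 by rewrite exprn_gt0.
have [L' E'] := expectZ (r ^- 2) L.
rewrite -ler_pdivlMr// mulrC -E -E' -lee_fin -mean_expect//.
set H := fun x : 'cV[R]_n => ((S * expR (- (l * nsq x)) * (`|dot x v| < r)%R%:R)%:E).
have mslab : vmeas H.
  pose A : set (n.-tuple B) := [set t | `|dot (col_of_tuple t) v| < r].
  have mA : measurable A.
    rewrite (_ : A = setT `&` (fun t => dot (col_of_tuple t) v) @^-1` `]- r, r[%classic).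
      exact: (vmeas_dot v).
    by apply/seteqP; split => t; rewrite /A/= in_itv/= ltr_norml; tauto.
  rewrite /vmeas (_ : (fun _ => _) = fun t : n.-tuple B =>
     (S * expR (- (l * nsq (col_of_tuple t))) * \1_A t)%:E); last first.
    apply/funext => t; rewrite /H indicE; congr (_ * _%:R)%:E.
    by congr nat_of_bool; apply/idP/idP; rewrite inE.
  apply/measurable_EFinP; apply: measurable_funM; last exact: measurable_indic.
  apply: measurable_funM; first exact: measurable_cst.
  by apply/measurable_EFinP; exact: (@vmeas_gauss R n l).
have H0 x : (0 <= H x)%E by rewrite lee_fin !mulr_ge0 ?expR_ge0// ltW.
have md : vmeas ((fun x => dot x v ^+ 2) : _ -> B).
  by apply: measurable_funX; exact: vmeas_dot.
have mz : vmeas (fun x => (r ^- 2 * dot x v ^+ 2 * f x)%:E).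
  apply/measurable_EFinP; apply: measurable_funM => //.
  by apply: measurable_funM => //; exact: measurable_cst.
have z0 x : (0 <= (r ^- 2 * dot x v ^+ 2 * f x)%:E)%E.
  by rewrite lee_fin; apply: mulr_ge0 => //; apply: mulr_ge0; rewrite ?sqr_ge0// invr_ge0 ltW.
have : (1 <= mean f (fun x => (r ^- 2 * dot x v ^+ 2)%R) + (2^-1)%:E)%E.
  rewrite -f1; apply: (@le_trans _ _ (mean f (fun x => (r ^- 2 * dot x v ^+ 2)%R) + Int H)%E).
    rewrite /mean -IntD//; apply: le_Int.
    - by move=> x; rewrite lee_fin.
    - exact: vmeas_EFin.
    - exact: emeasurable_funD.
    move=> x; rewrite /H -EFinD lee_fin.
    have [h|h] := ltP `|dot x v| r.
      by rewrite mulr1 ler_wpDl// -lee_fin.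
    rewrite mulr0 addr0 ler_peMl// ler_pdivlMl// mulr1.
    by rewrite -[dot x v ^+ 2]real_normK ?num_real// lerXn2r ?nnegrE// ltW.
  by rewrite leeD2l.
rewrite mean_expect// -EFinD !lee_fin; lra.
Qed.

End compactness.

Section bump_means.
Context {R : realType}.
Variables (n : nat) (rho : R) (x0 : 'cV[R]_n).
Hypothesis rho_gt0 : 0 < rho.

Lemma bump_le_gauss x : bump rho x0 x <= expR (- (rho * nsq (x - x0))).
Proof.
have [h|h] := leP 1 (rho * nsq (x - x0)).
  by rewrite bump_supp// expR_ge0.
have a0 : 0 <= rho * nsq (x - x0) by rewrite mulr_ge0 ?nsq_ge0// ltW.
rewrite /bump (_ : Num.max 0 _ = 1 - rho * nsq (x - x0)); last first.
  by apply/max_idPr; rewrite subr_ge0 ltW.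
apply: (@le_trans _ _ (1 - rho * nsq (x - x0))).
  by rewrite -[leRHS]expr1 ler_wiXn2l// ?subr_ge0 ?(ltW h)// gerBl.
exact: expR_ge1Dx.
Qed.

Definition bump_mass : R := fine (Int (fun x => (bump rho x0 x)%:E)).

Lemma Int_bump : Int (fun x => (bump rho x0 x)%:E) = bump_mass%:E.
Proof.
rewrite fineK// ge0_fin_numE; last first.
  by apply: Int_ge0 => x; rewrite lee_fin bump_ge0.
apply: le_lt_trans (Int_gauss_fin n rho_gt0).
rewrite -(@Int_translate _ _ (- x0) (fun x => (expR (- (rho * nsq x)))%:E)).
- apply: le_Int.
  + by move=> x; rewrite lee_fin bump_ge0.
  + exact: (vmeas_EFin (vmeas_bump rho x0)).
  + have := vmeas_affine 1 (- x0) (@vmeas_gauss R n rho).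
    by rewrite /vmeas; under eq_fun do rewrite scale1r.
  + by move=> x; rewrite lee_fin bump_le_gauss.
- exact: vmeas_gauss.
- by move=> x; rewrite lee_fin expR_ge0.
Qed.

Lemma bump_mass_gt0 : 0 < bump_mass.
Proof. by rewrite -lte_fin -Int_bump Int_bump_gt0. Qed.

Variables (P : 'cV[R]_n -> R) (tau : R).
Hypotheses (dP : even_density P) (tau_ge0 : 0 <= tau).

Let mP : vmeas (fun x => (bump rho x0 x * P x)%:E).
Proof.
have [mp _ _ _ _] := dP.
exact: (@vmeas_EFin _ _ (fun x => bump rho x0 x * P x) (measurable_funM (vmeas_bump rho x0) mp)).
Qed.

Let mB : vmeas (fun x => tau%:E * (bump rho x0 x)%:E)%E.
Proof. by apply: measurable_funeM; exact: (vmeas_EFin (vmeas_bump rho x0)). Qed.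

Let IntB : Int (fun x => tau%:E * (bump rho x0 x)%:E)%E = (tau * bump_mass)%:E.
Proof.
rewrite IntZl ?Int_bump//.
- by move=> x; rewrite lee_fin bump_ge0.
- exact: (vmeas_EFin (vmeas_bump rho x0)).
Qed.

Lemma mean_bump_le : (forall x, rho * nsq (x - x0) < 1 -> P x <= tau) ->
  (mean P (bump rho x0) <= (tau * bump_mass)%:E)%E.
Proof.
move=> h; rewrite -IntB; have [_ P0 _ _ _] := dP; apply: le_Int => //.
  by move=> x; rewrite lee_fin mulr_ge0// bump_ge0.
move=> x; rewrite -EFinM lee_fin.
have [hx|hx] := ltP (rho * nsq (x - x0)) 1; last by rewrite bump_supp// mulr0 mul0r.
by rewrite mulrC ler_wpM2r ?bump_ge0// h.
Qed.

Lemma mean_bump_ge : (forall x, rho * nsq (x - x0) < 1 -> tau <= P x) ->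
  ((tau * bump_mass)%:E <= mean P (bump rho x0))%E.
Proof.
move=> h; rewrite -IntB; apply: le_Int => //.
  by move=> x; rewrite -EFinM lee_fin mulr_ge0// bump_ge0.
move=> x; rewrite -EFinM lee_fin.
have [hx|hx] := ltP (rho * nsq (x - x0)) 1; last by rewrite bump_supp// mulr0 mul0r.
by rewrite [leRHS]mulrC ler_wpM2r ?bump_ge0// h.
Qed.

End bump_means.

Section limit.
Context {R : realType}.
Variables (m : nat) (n : 'I_m -> nat) (c : 'I_m -> R).
Variable Q : 'M[R]_(\sum_(i < m) n i).
Hypothesis c_gt0 : forall i, 0 < c i.
Local Notation vecs := (forall i, 'cV[R]_(n i)).
Variable delta : R.
Hypothesis delta_gt0 : 0 < delta.
Hypothesis Q_block : forall (x : vecs) i, delta * nsq (x i) <= qform Q (block x i).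
Local Notation k0 := (cost c Q).

(** Gives one explicit positive lower bound for finitely many positive numbers. *)
Lemma inv_sum_le (I : finType) (u : I -> R) (t : R) i : (forall i, 0 < u i) ->
  \sum_j (u j)^-1 <= t -> t^-1 <= u i.
Proof.
move=> u0 h; have ui : 0 < (u i)^-1 by rewrite invr_gt0.
have uit : (u i)^-1 <= t.
  apply: le_trans h; rewrite (bigD1 i)//= lerDl sumr_ge0// => j _.
  by rewrite invr_ge0 ltW.
by rewrite -[leRHS]invrK lef_pV2// posrE// (lt_le_trans ui).
Qed.

Variables (A : forall i, 'M[R]_(n i)) (D : R).
Hypothesis dA : forall i, posdef_mx (A i).
Hypothesis near_A : forall a e : R, 0 < a -> 0 < e -> exists K g,
  [/\ feasible c Q K g, K <= k0 * (1 + e),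
    (forall i, mean (g i) (fun x => (nsq x ^+ 2)%R) <= D%:E)%E &
    forall i j k, `|cov (g i) j k - invmx (A i) j k| <= a].

(** A neighbourhood average of a density is at most one of its values, so weak
    convergence of the iterated doublings carries the pointwise constraint over
    to the Gaussian limit. *)
Lemma gdens_cost (x : vecs) :
  \prod_i gdens (A i) (x i) `^ c i <= k0 * expR (- qform Q (\mxcol_i x i)).
Proof.
rewrite leNgt; apply/negP.
set T := k0 * _; set Gam := \prod_i _ => TG.
have [K1 [g1 [fg1 _ _ _]]] := near_A ltr01 ltr01.
have k0_gt0 : 0 < k0 := cost_gt0 c_gt0 delta_gt0 Q_block fg1.
have T0 : 0 < T by rewrite mulr_gt0// expR_gt0.
have Gam0 : 0 < Gam := lt_trans T0 TG.
have Gx0 i : 0 < gdens (A i) (x i).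
  by rewrite mulr_gt0 ?invr_gt0 ?gaussian_gt0// integral_gaussian_gt0.
pose sg := \sum_i c i.
have sg0 : 0 <= sg by apply: sumr_ge0 => i _; exact: ltW.
pose lr := ln (Gam / T).
have lr0 : 0 < lr by rewrite ln_gt0// ltr_pdivlMr// mul1r.
have eG : Gam = T * expR lr by rewrite lnK ?posrE ?divr_gt0// mulrC divfK ?gt_eqF.
pose s := lr / (2 * sg + 3).
have den0 : 0 < 2 * sg + 3 by rewrite ltr_wpDl// mulr_ge0.
have s0 : 0 < s by rewrite divr_gt0.
have lrs : lr = s * (2 * sg + 3) by rewrite /s divfK ?gt_eqF.
have gap : T * expR (s + s) < expR (- (2 * s) * sg) * Gam.
  rewrite eG mulrCA -expRD ltr_pM2l// ltr_expR lrs.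
  have : 0 < s * 1 by rewrite mulr1.
  lra.
(* radii on which the Gaussians and the form vary by a factor e^s *)
have s20 : 0 < 2 * s by rewrite mulr_gt0.
have near_i i : exists r, 0 < r /\ forall y, nsq (y - x i) < r ->
    expR (- s) * gdens (A i) (x i) <= gdens (A i) y.
  have [r r0 hr] := qform_near (A i) (x i) s20.
  exists r; split => // y /hr; rewrite ler_norml => /andP[_ h].
  rewrite /gdens mulrCA ler_pM2l ?invr_gt0 ?integral_gaussian_gt0//.
  by rewrite /gaussian -expRD ler_expR; lra.
pose r i := projT1 (cid (near_i i)).
have rP i : 0 < r i /\ forall y, nsq (y - x i) < r i ->
    expR (- s) * gdens (A i) (x i) <= gdens (A i) y by rewrite /r; case: cid.
have [r' r'0 hr'] := qform_near Q (\mxcol_i x i) s0.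
pose rho := \sum_i (r i)^-1 + m%:R / r' + 1.
have sr0 : 0 <= \sum_i (r i)^-1.
  by apply: sumr_ge0 => i _; rewrite invr_ge0 ltW//; have [] := rP i.
have mr0 : 0 <= m%:R / r' by rewrite divr_ge0// ltW.
have rho0 : 0 < rho by rewrite ltr_wpDl// addr_ge0.
have rho_r i y : rho * nsq (y - x i) < 1 -> nsq (y - x i) < r i.
  move=> h; have : rho^-1 <= r i.
    apply: (@inv_sum_le _ r _ i); first by move=> j; have [] := rP j.
    by rewrite /rho; lra.
  by apply: lt_le_trans; rewrite -[ltRHS]mulr1 ltr_pdivlMl.
pose w i := bump_mass rho (x i).
have w0 i : 0 < w i by exact: bump_mass_gt0.
pose eta i := (expR (- s) - expR (- (2 * s))) * gdens (A i) (x i) * w i.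
have eta0 i : 0 < eta i.
  apply: mulr_gt0; last exact: w0.
  by apply: mulr_gt0; [rewrite subr_gt0 ltr_expR; lra|exact: Gx0].
have [DG hDG] : exists DG, forall i,
    (mean (gdens (A i)) (fun x => (nsq x ^+ 2)%R) <= DG%:E)%E.
  pose d i := projT1 (cid (gdens_fourth_moment (dA i))).
  exists (\sum_i `|d i|) => i.
  apply: (@le_trans _ _ (d i)%:E); first by rewrite /d; case: cid.
  rewrite lee_fin (le_trans (ler_norm _))// (bigD1 i)//= lerDl.
  by apply: sumr_ge0 => j _.
pose DD := `|D| + `|DG|.
have DD0 : 0 <= DD by rewrite addr_ge0.
(* the number [k] of doublings is fixed before the distance of the tuple from
   optimality, which has to be small compared with 2 ^- k *)
have [M2 M2E] : {M2 : R | M2 = 56 * rho} by exists (56 * rho).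
have [M4 M4E] : {M4 : R | M4 = 400 * rho ^+ 2} by exists (400 * rho ^+ 2).
have M20 : 0 < M2 by rewrite M2E pmulr_rgt0 ?ltr0n.
have M40 : 0 < M4 by rewrite M4E pmulr_rgt0 ?ltr0n// exprn_gt0.
have test_bump i : test_fun M2 M4 (bump rho (x i)).
  by rewrite M2E M4E; exact: test_fun_bump.
have e20 i : 0 < eta i / (2 * M2) by rewrite divr_gt0// mulr_gt0.
pose a := (\sum_i (eta i / (2 * M2))^-1 + 1)^-1.
have sa0 : 0 <= \sum_i (eta i / (2 * M2))^-1.
  by apply: sumr_ge0 => i _; rewrite invr_ge0 ltW.
have a0 : 0 < a by rewrite invr_gt0 ltr_wpDl.
have aeta i : M2 * a <= eta i / 2.
  have h : a <= eta i / (2 * M2).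
    by apply: (@inv_sum_le _ (fun i => eta i / (2 * M2)) _ i e20); rewrite lerDl.
  apply: (le_trans (ler_wpM2l (ltW M20) h)).
  by rewrite (_ : M2 * (eta i / (2 * M2)) = eta i / 2)//; field; rewrite gt_eqF.
have e4 i : 0 < eta i / (4 * (M4 * (DD + 1))).
  by rewrite divr_gt0// mulr_gt0// mulr_gt0// ltr_wpDl.
pose Z := \sum_i (eta i / (4 * (M4 * (DD + 1))))^-1 + 1.
have Z0 : 0 < Z.
  by rewrite ltr_wpDl// sumr_ge0// => i _; rewrite invr_ge0 ltW.
have [k hk] : exists k : nat, Z <= 2 ^+ k.
  have [k hk] : exists k : nat, Z <= k%:R.
    by exists (Num.bound Z); exact/ltW/archi_boundP/ltW.
  exists k; apply: (le_trans hk).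
  by rewrite -natrX ler_nat ltnW// ltn_expl.
have keta i : M4 * (DD / 2 ^+ k) < eta i / 2.
  have h : Z^-1 <= eta i / (4 * (M4 * (DD + 1))).
    by apply: (@inv_sum_le _ (fun i => eta i / (4 * (M4 * (DD + 1)))) _ i e4); rewrite lerDl.
  have h2 : (2 ^+ k)^-1 <= Z^-1 by rewrite lef_pV2// posrE// exprn_gt0.
  apply: (@le_lt_trans _ _ (M4 * (DD + 1) * (eta i / (4 * (M4 * (DD + 1)))))).
    rewrite -mulrA; apply: (ler_wpM2l (ltW M40)); apply: ler_pM => //.
    - by rewrite lerDl.
    - exact: (le_trans h2 h).
  rewrite (_ : M4 * (DD + 1) * _ = eta i / 4); last first.
    by field; rewrite !gt_eqF// ltr_wpDl.
  by have := eta0 i; lra.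
pose N := \sum_i (n i)%:R * (n i)%:R + 1 : R.
have N0 : 0 < N by rewrite ltr_wpDl// sumr_ge0// => i _; rewrite mulr_ge0.
have aN : 0 < a / N by rewrite divr_gt0.
have k2 : 0 < s / 2 ^+ k by rewrite divr_gt0// exprn_gt0.
have [K [g [fg Kle gD gcov]]] := near_A aN k2.
pose P i := iter k (@doubling R (n i)) (g i).
have [dg Kp _] := fg.
have dP i : even_density (P i) by exact: even_density_iter.
have [_ _ hP] := feasible_iter c_gt0 delta_gt0 Q_block k fg.
(* otherwise the means of the bump against [P i] and against its Gaussian limit would
   differ by at least [eta i], more than the central limit theorem allows *)
have large i : exists y, rho * nsq (y - x i) < 1 /\
    expR (- (2 * s)) * gdens (A i) (x i) <= P i y.
  apply: contrapT => /forallNP ny.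
  have dG := even_density_gdens (dA i).
  have up : (mean (P i) (bump rho (x i)) <=
      (expR (- (2 * s)) * gdens (A i) (x i) * w i)%:E)%E.
    apply: (mean_bump_le rho0 (dP i)); first by rewrite mulr_ge0 ?expR_ge0// ltW.
    move=> y hy; apply/ltW; rewrite ltNge; apply/negP => h; exact: (ny y).
  have lo : ((expR (- s) * gdens (A i) (x i) * w i)%:E <=
      mean (gdens (A i)) (bump rho (x i)))%E.
    apply: (mean_bump_ge rho0 dG); first by rewrite mulr_ge0 ?expR_ge0// ltW.
    by move=> y /rho_r; have [_] := rP i; apply.
  have iterG : iter k (@doubling R (n i)) (gdens (A i)) = gdens (A i).
    by elim: (k) => //= k' ->; exact: doubling_gdens.
  have gD' : (mean (g i) (fun x => (nsq x ^+ 2)%R) <= DD%:E)%E.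
    by apply: (le_trans (gD i)); rewrite lee_fin (le_trans (ler_norm _))// lerDl.
  have GD' : (mean (gdens (A i)) (fun x => (nsq x ^+ 2)%R) <= DD%:E)%E.
    by apply: (le_trans (hDG i)); rewrite lee_fin (le_trans (ler_norm _))// lerDr.
  have cov_a : \sum_j \sum_l `|cov (gdens (A i)) j l - cov (g i) j l| <= a.
    apply: (@le_trans _ _ (\sum_(j < n i) \sum_(l < n i) a / N)).
      apply: ler_sum => j _; apply: ler_sum => l _.
      by rewrite cov_gdens// distrC.
    rewrite !sumr_const !card_ord -mulrnA -[leLHS]mulr_natr natrM mulrAC.
    rewrite ler_pdivrMr// ler_pM2l// /N (bigD1 i)//= -addrA lerDl addr_ge0//.
    by apply: sumr_ge0 => j _; rewrite mulr_ge0.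
  have clt := iter_doubling_mean_le (ltW a0) DD0 dG (dg i)
    (mean_test_fun_le dG (dg i) GD' gD' cov_a) k (ltW M20) (ltW M40)
    (test_bump i).
  rewrite iterG -/(P i) in clt.
  have := le_trans lo (le_trans clt (leeD2r _ up)).
  rewrite -EFinD lee_fin.
  have := keta i; have := aeta i; have := eta0 i.
  rewrite {1 2 3}/eta !mulrBl; lra.
pose y i := projT1 (cid (large i)).
have yP i : rho * nsq (y i - x i) < 1 /\
    expR (- (2 * s)) * gdens (A i) (x i) <= P i (y i) by rewrite /y; case: cid.
have := hP y.
have hlo : expR (- (2 * s) * sg) * Gam <= \prod_i P i (y i) `^ c i.
  have -> : expR (- (2 * s) * sg) * Gam =
      \prod_i (expR (- (2 * s)) * gdens (A i) (x i)) `^ c i.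
    rewrite /sg mulr_sumr expR_sum -big_split/=; apply: eq_bigr => i _.
    by rewrite powRM ?expR_ge0 ?(ltW (Gx0 i))// expRM.
  apply: ler_prod => i _; rewrite powR_ge0/=.
  have [_ h] := yP i; have p0 : 0 <= expR (- (2 * s)) * gdens (A i) (x i).
    by rewrite mulr_ge0 ?expR_ge0// ltW.
  by apply: ge0_ler_powR; rewrite ?nnegrE ?(ltW (c_gt0 i))// (le_trans p0).
move=> /(le_trans hlo); apply/negP; rewrite -ltNge; apply: le_lt_trans gap.
rewrite /T -mulrA -mulrA ler_pM2l// -expRD.
have h1 : (K / k0) ^+ (2 ^ k) <= expR s.
  have -> : expR s = expR (s / 2 ^+ k) ^+ (2 ^ k).
    by rewrite -expRM_natl natrX mulrC divfK// expf_neq0.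
  rewrite lerXn2r ?nnegrE ?expR_ge0 ?divr_ge0 ?(ltW Kp) ?(ltW k0_gt0)//.
  by rewrite ler_pdivrMr// mulrC (le_trans Kle)// ler_wpM2l ?(ltW k0_gt0)// expR_ge1Dx.
apply: (le_trans (ler_wpM2r (expR_ge0 _) h1)); rewrite -expRD ler_expR.
have : nsq (\mxcol_i y i - \mxcol_i x i) < r'.
  rewrite -mxcolB nsq_mxcol.
  apply: (@le_lt_trans _ _ (m%:R * rho^-1)); last first.
    by rewrite ltr_pdivrMr// mulrC -ltr_pdivrMr// /rho; lra.
  rewrite mulr_natl -[X in _ *+ X]card_ord -sumr_const; apply: ler_sum => i _.
  by have [/ltW h _] := yP i; rewrite -[leRHS]mulr1 ler_pdivlMl.
by move=> /hr'; rewrite ler_norml => /andP[h _]; lra.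
Qed.

End limit.

Section optimal_gaussians.
Context {R : realType}.
Variables (m : nat) (n : 'I_m -> nat) (c : 'I_m -> R).
Variable Q : 'M[R]_(\sum_(i < m) n i).
Hypothesis c_gt0 : forall i, 0 < c i.
Local Notation vecs := (forall i, 'cV[R]_(n i)).
Local Notation funs := (forall i, 'cV[R]_(n i) -> R).
Variable delta : R.
Hypothesis delta_gt0 : 0 < delta.
Hypothesis Q_block : forall (x : vecs) i, delta * nsq (x i) <= qform Q (block x i).
Local Notation k0 := (cost c Q).

(** Feasible tuples with constant near [cost] lie below one Gaussian envelope, so
    their covariances are bounded and stay away from degenerate matrices; [A] is the
    inverse of a limit. *)
Lemma near_optimal_limit K f : feasible c Q K f ->
  exists (A : forall i, 'M[R]_(n i)) (D : R), (forall i, posdef_mx (A i)) /\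
  forall a e : R, 0 < a -> 0 < e -> exists K' g,
  [/\ feasible c Q K' g, K' <= k0 * (1 + e),
    (forall i, mean (g i) (fun x => (nsq x ^+ 2)%R) <= D%:E)%E &
    forall i j k, `|cov (g i) j k - invmx (A i) j k| <= a].
Proof.
move=> fK; have k0_gt0 : 0 < k0 := cost_gt0 c_gt0 delta_gt0 Q_block fK.
have seqP (j : nat) : exists g : funs, exists K',
    feasible c Q K' g /\ K' <= k0 * (1 + j.+1%:R^-1).
  have e0 : 0 < k0 * j.+1%:R^-1 by rewrite mulr_gt0// invr_gt0.
  have [K' [g [h1 h2]]] := cost_adherent c_gt0 delta_gt0 Q_block fK e0.
  by exists g, K'; split => //; rewrite mulrDr mulr1.
pose F j := projT1 (cid (seqP j)).
have FP j : exists K', feasible c Q K' (F j) /\ K' <= k0 * (1 + j.+1%:R^-1).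
  by rewrite /F; case: cid.
have [S S0 hS] := feasible_le_envelope c_gt0 delta_gt0 Q_block (k0 * 2).
have FS j i x : F j i x <= S * expR (- (delta / c i * nsq x)).
  have [K' [h1 h2]] := FP j; apply: (hS K') => //.
  apply: (le_trans h2); rewrite ler_pM2l// (_ : 2 = 1 + 1)// lerD2l.
  by rewrite invf_le1// ler1n.
have dF j i : even_density (F j i) by have [K' [[]]] := FP j.
have l0 i : 0 < delta / c i by exact: divr_gt0.
pose Di i := projT1 (cid (gauss_fourth_moment (n i) (l0 i) S0)).
have DiP i (g : 'cV[R]_(n i) -> R) : even_density g ->
    (forall x, g x <= S * expR (- (delta / c i * nsq x))) ->
    (mean g (fun x => (nsq x ^+ 2)%R) <= (Di i)%:E)%E.
  by rewrite /Di; case: cid => D' /= h; exact: h.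
have FDi j i : (mean (F j i) (fun x => (nsq x ^+ 2)%R) <= (Di i)%:E)%E.
  by apply: DiP => // x; exact: FS.
have [U [UU Usub]] := ultraFilterLemma (eventually_filter : ProperFilter eventually).
have UF : ProperFilter U by exact: ultra_proper.
have lim i a b := ultra_limit UU (fun j => cov_le (dF j i) (FDi j i) a b).
pose Sg i : 'M[R]_(n i) := \matrix_(a, b) projT1 (cid (lim i a b)).
have near_Sg e : 0 < e -> U [set j | forall i a b, `|cov (F j i) a b - Sg i a b| < e].
  move=> e0.
  have h i a b : \forall j \near U, `|cov (F j i) a b - Sg i a b| < e.
    by rewrite mxE; case: cid => L /= hL; exact: hL.
  by apply: filter_forall => i; apply: filter_forall => a; apply: filter_forall => b; exact: h.
have Sg_sym i : symmetric_mx (Sg i).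
  apply/matrixP => a b; rewrite mxE; apply: (@eq_of_small _ _ _ 2) => // t t0 _.
  have [j /= hj] := filter_ex (near_Sg _ t0).
  have h1 := hj i a b; have h2 := hj i b a.
  have ecov : cov (F j i) b a = cov (F j i) a b.
    by rewrite /cov; congr (expect _ _); apply/funext => x; rewrite mulrC.
  rewrite ecov in h2; move: h1 h2; rewrite !ltr_norml ler_norml => /andP[? ?] /andP[? ?].
  by apply/andP; split; lra.
have Sg_pd i : posdef_mx (Sg i).
  split; first exact: Sg_sym.
  move=> v v0; have [e e0 he] := second_moment_floor v0 (l0 i) S0.
  pose W := \sum_a \sum_b `|v a 0 * v b 0|.
  have W0 : 0 <= W by apply: sumr_ge0 => a _; apply: sumr_ge0.
  have t0 : 0 < e / (W + 1) by rewrite divr_gt0// ltr_wpDl.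
  have [j /= hj] := filter_ex (near_Sg _ t0).
  have lo := he _ _ (dF j i) (FDi j i) (FS j i).
  have : `|qform (covmx (F j i)) v - qform (Sg i) v| <= e / (W + 1) * W.
    rewrite !qform_sum -sumrB mulr_sumr; apply: (le_trans (ler_norm_sum _ _ _)).
    apply: ler_sum => a _; rewrite -sumrB mulr_sumr; apply: (le_trans (ler_norm_sum _ _ _)).
    apply: ler_sum => b _; rewrite -mulrBl normrM ler_wpM2r// mxE.
    exact/ltW/hj.
  have : e / (W + 1) * W < e.
    by rewrite mulrAC ltr_pdivrMr ?ltr_wpDl// ltr_pM2l// ltrDl.
  by rewrite ler_norml => h1 /andP[h2 h3]; lra.
exists (fun i => invmx (Sg i)), (\sum_i `|Di i|); split.
  by move=> i; exact: posdef_invmx.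
move=> a e a0 e0.
have Ue : U [set j | j.+1%:R^-1 < e].
  by apply: Usub; exact: (near_infty_natSinv_lt (PosNum e0)).
have [j /= [hj1 hj2]] := filter_ex (filterI Ue (near_Sg _ a0)).
have [K' [h1 h2]] := FP j.
exists K', (F j); split => //.
- by apply: (le_trans h2); rewrite ler_pM2l// lerD2l ltW.
- move=> i; apply: (le_trans (FDi j i)); rewrite lee_fin (le_trans (ler_norm _))//.
  by rewrite (bigD1 i)//= lerDl sumr_ge0.
- by move=> i k l; rewrite invmxK; exact/ltW/hj2.
Qed.

(** The limiting Gaussian densities attain [cost]; their normalizing constants are
    read off at 0, and replacing [x] by [t x] with large [t] removes the constant
    from the inequality between the quadratic forms. *)
Theorem Gaussian_saturation_block_pos K f : feasible c Q K f ->
  exists A : forall i, 'M[R]_(n i), [/\ forall i, posdef_mx (A i),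
    dominated c Q (fun i => gaussian (A i)) &
    1 <= K * \prod_i integral_Rn (gaussian (A i)) `^ c i].
Proof.
move=> fK; have k0_gt0 : 0 < k0 := cost_gt0 c_gt0 delta_gt0 Q_block fK.
have [A [D [dA nearA]]] := near_optimal_limit fK.
have main := gdens_cost c_gt0 delta_gt0 Q_block dA nearA.
exists A; split => //; last first.
  have := main (fun=> 0); rewrite mxcol0 qform0 oppr0 expR0 mulr1 => h.
  set V := \prod_i _; have V0 : 0 < V.
    by apply: prodr_gt0 => i _; apply: powR_gt0; exact: integral_gaussian_gt0.
  have e : \prod_i gdens (A i) 0 `^ c i = V^-1.
    rewrite /V -prodfV; apply: eq_bigr => i _.
    have Z0 := ltW (integral_gaussian_gt0 (dA i)).
    rewrite /gdens /gaussian qform0 mulr0 oppr0 expR0 mulr1.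
    by rewrite -powR_inv1// -powRrM mulN1r powRN.
  rewrite e in h.
  rewrite -ler_pdivrMr// mul1r (le_trans h)//; exact: (cost_le c_gt0 delta_gt0 Q_block fK).
move=> x.
pose E (y : vecs) := \sum_i c i * (2^-1 * qform (A i) (y i)).
have gE y : \prod_i gaussian (A i) (y i) `^ c i = expR (- E y).
  rewrite /E -sumrN expR_sum; apply: eq_bigr => i _.
  by rewrite /gaussian -expRM mulNr mulrC.
rewrite gE ler_expR lerN2 leNgt; apply/negP => EQ.
pose V := \prod_i (integral_Rn (gaussian (A i)))^-1 `^ c i.
have V0 : 0 < V.
  by apply: prodr_gt0 => i _; apply: powR_gt0; rewrite invr_gt0 integral_gaussian_gt0.
have ineq t : V * expR (t ^+ 2 * (qform Q (\mxcol_i x i) - E x)) <= k0.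
  have := main (fun i => t *: x i).
  have -> : \prod_i gdens (A i) (t *: x i) `^ c i = V * expR (- E (fun i => t *: x i)).
    rewrite -gE /V -big_split/=; apply: eq_bigr => i _.
    by rewrite /gdens powRM// ?invr_ge0 ?gaussian_ge0// ltW// integral_gaussian_gt0.
  rewrite mxcolZ qformZ (_ : E (fun i => t *: x i) = t ^+ 2 * E x); last first.
    by rewrite /E mulr_sumr; apply: eq_bigr => i _; rewrite qformZ; ring.
  rewrite -ler_pdivrMr ?expR_gt0// -mulrA -expRN opprK -expRD.
  by rewrite (_ : - (t ^+ 2 * E x) + _ = t ^+ 2 * (qform Q (\mxcol_i x i) - E x))//; ring.
set g := _ - E x in ineq; have g0 : 0 < g by rewrite subr_gt0.
pose t := k0 / (V * g) + 1.
have t1 : 1 <= t by rewrite lerDr divr_ge0 ?(ltW k0_gt0)// mulr_ge0// ltW.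
have := ineq t; apply/negP; rewrite -ltNge.
apply: (@lt_le_trans _ _ (V * (1 + t * g))); last first.
  rewrite ler_pM2l//; apply: le_trans (expR_ge1Dx _); rewrite lerD2l ler_pM2r//.
  by rewrite expr2 ler_peMr// (le_trans _ t1).
have -> : V * (1 + t * g) = k0 + V * g + V.
  by rewrite /t; field; rewrite !gt_eqF.
have : 0 < V * g by rewrite mulr_gt0.
lra.
Qed.

End optimal_gaussians.

(** * A negative diagonal block: the supremum is infinite *)

Section elongated.
Context {R : realType}.
Variables (n : nat) (e : 'cV[R]_n) (t : R).
Hypotheses (e_neq0 : e != 0) (t_ge0 : 0 <= t).

(** The form [eps |x|^2 + t |x'|^2], with [x'] the component of [x] orthogonal
    to [e]. *)
Definition elongated (eps : R) : 'M[R]_n :=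
  (eps + t)%:M - (t / nsq e) *: (e *m e^T).

Let ne0 : 0 < nsq e.
Proof. by rewrite nsq_gt0. Qed.

Lemma qform_elongated eps x :
  qform (elongated eps) x = eps * nsq x + t * (nsq x - dot x e ^+ 2 / nsq e).
Proof.
rewrite qformE mulmxBl mul_scalar_mx -scalemxAl dotDr dotNr !dotZr -nsqE -mulmxA.
have -> : e^T *m x = (dot x e)%:M.
  apply/matrixP => i j; rewrite !ord1 !mxE eqxx mulr1n.
  by apply: eq_bigr => k _; rewrite mxE mulrC.
by rewrite mul_mx_scalar dotZr; field; rewrite gt_eqF.
Qed.

Lemma orthogonal_part_ge0 x : 0 <= nsq x - dot x e ^+ 2 / nsq e.
Proof. by rewrite subr_ge0 ler_pdivrMr// dot_CauchySchwarz. Qed.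

Lemma posdef_elongated eps : 0 < eps -> posdef_mx (elongated eps).
Proof.
move=> eps0; split.
  rewrite /symmetric_mx linearB/= linearZ/= tr_scalar_mx trmx_mul trmxK.
  by [].
move=> x x0; rewrite qform_elongated ltr_wpDr ?mulr_ge0 ?orthogonal_part_ge0//.
by rewrite mulr_gt0// nsq_gt0.
Qed.

Let rho := 4 / nsq e.

Let rho0 : 0 < rho.
Proof. exact: divr_gt0. Qed.

(** [rho] makes the supports, of radius |e| / 2, disjoint. *)
Lemma bump_disjoint (N : nat) x :
  \sum_(k < N) bump rho (k%:R *: e) x <= 1.
Proof.
have b1 y : bump rho y x <= 1.
  by apply: (le_trans (bump_le_gauss y rho0 x)); rewrite -expR0 ler_expR oppr_le0 mulr_ge0 ?nsq_ge0// ltW.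
have [[k kx]|none] := pselect (exists k : 'I_N, rho * nsq (x - k%:R *: e) < 1); last first.
  rewrite big1// => k _; apply: bump_supp; rewrite leNgt; apply/negP => h.
  by apply: none; exists k.
rewrite (bigD1 k)//= big1 ?addr0// => l lk; apply: bump_supp.
rewrite leNgt; apply/negP => lx.
have sq_le (y z : 'cV[R]_n) : nsq (y - z) <= 2 * (nsq y + nsq z).
  by have := nsq_ge0 (y + z); rewrite !nsqD nsqN dotNr; lra.
have := sq_le (x - k%:R *: e) (x - l%:R *: e).
have -> : x - k%:R *: e - (x - l%:R *: e) = (l%:R - k%:R) *: e.
  by rewrite scalerBl opprB addrC addrA subrK.
rewrite nsqZ => h.
have lk1 : 1 <= (l%:R - k%:R : R) ^+ 2.
  have [kl|kl] := ltnP k l.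
    have : (k%:R + 1 <= l%:R :> R) by rewrite natr1 ler_nat.
    by nra.
  have {}kl : (l < k)%N by rewrite ltn_neqAle kl andbT; apply: contra lk => /eqP/val_inj/eqP.
  have : (l%:R + 1 <= k%:R :> R) by rewrite natr1 ler_nat.
  by nra.
have h1 : nsq e <= (l%:R - k%:R) ^+ 2 * nsq e by rewrite ler_peMl// ltW.
have kr y : rho * y < 1 -> y < nsq e / 4.
  by rewrite /rho mulrAC ltr_pdivrMr// mul1r => hy; lra.
have := kr _ kx; have := kr _ lx; lra.
Qed.

(** Along [e] the Gaussian is flat up to distance about [N * |e|] when [eps = N.+1 ^- 2],
    so it has mass bounded below near each of [0, e, ..., (N - 1) e]. *)
Lemma Int_elongated_large : exists2 a, 0 < a & forall N : nat,
  N%:R * a <= integral_Rn (gaussian (elongated (N.+1%:R ^- 2))).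
Proof.
pose Th := 2 * nsq e + (2 + t) * (nsq e / 4).
exists (expR (- (2^-1 * Th)) * bump_mass rho (0 : 'cV[R]_n)).
  by rewrite mulr_gt0 ?expR_gt0// bump_mass_gt0.
move=> N; set eps := N.+1%:R ^- 2.
have eps0 : 0 < eps by rewrite invr_gt0 exprn_gt0.
have dA := posdef_elongated eps0.
have eps1 : eps <= 1 by rewrite invf_le1 ?exprn_gt0// exprn_ege1// ler1n.
have shift k : Int (fun x => (bump rho (k *: e) x)%:E) = (bump_mass rho (0 : 'cV[R]_n))%:E.
  rewrite -(Int_bump 0 rho0) -(@Int_translate _ _ (- (k *: e)) (fun x => (bump rho 0 x)%:E)).
  - by apply: eq_Int => x; rewrite /bump subr0.
  - exact: (vmeas_EFin (vmeas_bump rho 0)).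
  - by move=> x; rewrite lee_fin bump_ge0.
rewrite -lee_fin -Int_gaussianE//.
pose b := expR (- (2^-1 * Th)).
apply: (@le_trans _ _ (Int (fun x => (b * \sum_(k < N) bump rho (k%:R *: e) x)%:E))).
  rewrite le_eqVlt; apply/orP; left; apply/eqP.
  under eq_Int do rewrite EFinM -sumEFin.
  rewrite IntZl ?expR_ge0//; last 2 first.
  - by move=> x; rewrite sume_ge0// => k _; rewrite lee_fin bump_ge0.
  - by apply: emeasurable_sum => k; exact: (vmeas_EFin (vmeas_bump rho _)).
  rewrite /Int ge0_integral_sum//; last 2 first.
  - by move=> k; exact: (vmeas_EFin (vmeas_bump rho _)).
  - by move=> k x _; rewrite lee_fin bump_ge0.
  under eq_bigr do rewrite -/(Int (fun x => (bump rho _ x)%:E)) shift.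
  rewrite sumEFin -EFinM; congr (_%:E).
  by rewrite sumr_const card_ord -[bump_mass _ _ *+ N]mulr_natl mulrCA.
apply: le_Int.
- by move=> x; rewrite lee_fin mulr_ge0 ?expR_ge0// sumr_ge0// => k _; exact: bump_ge0.
- apply/measurable_EFinP; apply: measurable_funM; first exact: measurable_cst.
  by apply: measurable_sum => k; exact: vmeas_bump.
- exact: (vmeas_EFin (vmeas_gaussian _)).
move=> x; rewrite lee_fin.
have [[k kx]|none] := pselect (exists k : 'I_N, rho * nsq (x - k%:R *: e) < 1); last first.
  rewrite big1 ?mulr0 ?gaussian_ge0// => k _; apply: bump_supp; rewrite leNgt.
  by apply/negP => h; apply: none; exists k.
apply: (@le_trans _ _ b).
  by rewrite ler_piMr ?expR_ge0// bump_disjoint.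
rewrite /b ler_expR lerN2 ler_pM2l ?invr_gt0// qform_elongated.
have [y ye] : {y | y = x - k%:R *: e} by exists (x - k%:R *: e).
rewrite -ye in kx.
have ex : x = k%:R *: e + y by rewrite ye addrC subrK.
have ny : nsq y <= nsq e / 4.
  by move: kx; rewrite /rho mulrAC ltr_pdivrMr// mul1r; lra.
have orth : nsq x - dot x e ^+ 2 / nsq e = nsq y - dot y e ^+ 2 / nsq e.
  rewrite ex nsqD nsqZ !dotZl dotDl dotZl -nsqE (dotC e y).
  by field; rewrite gt_eqF.
have k2 : eps * (k%:R ^+ 2 * nsq e) <= nsq e.
  rewrite mulrA ler_piMl ?(ltW ne0)// /eps mulrC ler_pdivrMr ?exprn_gt0// mul1r.
  by rewrite lerXn2r ?nnegrE// ler_nat ltnW// ltnW// ltnS.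
have nx : nsq x <= 2 * (k%:R ^+ 2 * nsq e + nsq y).
  rewrite ex -nsqZ; have := nsq_ge0 (k%:R *: e - y).
  by rewrite !nsqD nsqN dotNr; lra.
have e1 : eps * nsq x <= 2 * (nsq e + nsq e / 4).
  apply: (@le_trans _ _ (eps * (2 * (k%:R ^+ 2 * nsq e + nsq y)))).
    by rewrite ler_pM2l.
  have : eps * nsq y <= nsq e / 4.
    by apply: le_trans ny; rewrite ler_piMl ?nsq_ge0.
  lra.
have e2 : t * (nsq x - dot x e ^+ 2 / nsq e) <= t * (nsq e / 4).
  rewrite ler_wpM2l// orth; apply: le_trans ny.
  by rewrite gerBl divr_ge0 ?sqr_ge0// ltW.
rewrite /Th; lra.
Qed.

End elongated.

Section negative_block.
Context {R : realType}.
Variables (m : nat) (n : 'I_m -> nat) (c : 'I_m -> R).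
Variable Q : 'M[R]_(\sum_(i < m) n i).
Hypothesis c_gt0 : forall i, 0 < c i.
Local Notation vecs := (forall i, 'cV[R]_(n i)).

Lemma prod_gaussian (A : forall i, 'M[R]_(n i)) (y : vecs) :
  \prod_i gaussian (A i) (y i) `^ c i = expR (- \sum_i c i * (2^-1 * qform (A i) (y i))).
Proof.
rewrite -sumrN expR_sum; apply: eq_bigr => i _.
by rewrite /gaussian -expRM mulNr mulrC.
Qed.

Lemma scalar_gaussians : exists A : forall i, 'M[R]_(n i),
  (forall i, posdef_mx (A i)) /\ dominated c Q (fun i => gaussian (A i)).
Proof.
have [L L0 hL] := qform_le Q.
have a0 i : 0 < 2 * (L + 1) / c i by rewrite divr_gt0// mulr_gt0// ltr_wpDl.
exists (fun i => (2 * (L + 1) / c i)%:M); split.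
  by move=> i; exact: posdef_scalar.
move=> y; rewrite prod_gaussian ler_expR lerN2.
apply: (le_trans (ler_norm _)); apply: (le_trans (hL _)).
rewrite nsq_mxcol mulr_sumr; apply: ler_sum => i _; rewrite qform_scalar.
have -> : c i * (2^-1 * (2 * (L + 1) / c i * nsq (y i))) = (L + 1) * nsq (y i).
  by field; rewrite gt_eqF.
by rewrite ler_wpM2r ?nsq_ge0// lerDl.
Qed.

(** With [b] the negative block, [qform Q (z b + w) <= K |w|^2] for all [z], so
    a Gaussian may be arbitrarily elongated along [b]. *)
Lemma negative_block_unbounded (x0 : vecs) (i0 : 'I_m) (M : R) :
  qform Q (block x0 i0) < 0 ->
  exists A : forall i, 'M[R]_(n i), [/\ forall i, posdef_mx (A i),
    dominated c Q (fun i => gaussian (A i)) &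
    M <= \prod_i integral_Rn (gaussian (A i)) `^ c i].
Proof.
set b := block x0 i0 => qb; pose e := x0 i0.
have b_out j : j != i0 -> x0 j *+ (j == i0) = 0 by move=> /negbTE ->.
have e0 : e != 0.
  apply/negP => /eqP e0; move: qb; rewrite (_ : b = 0) ?qform0 ?ltxx//.
  transitivity (\mxcol_(j < m) (0 : 'cV[R]_(n j))); last exact: mxcol0.
  apply: eq_mxcol => j.
  by have [->|/b_out//] := eqVneq j i0; rewrite -/e e0 mul0rn.
have ne0 : 0 < nsq e by rewrite nsq_gt0.
pose kap := - qform Q b; have kap0 : 0 < kap by rewrite oppr_gt0.
have [L L0 hL] := qform_le Q.
pose u := Q *m b + Q^T *m b.
pose K := nsq u / (4 * kap) + L + 1.
have K0 : 0 < K by rewrite ltr_wpDl// addr_ge0// divr_ge0 ?nsq_ge0// mulr_ge0// ltW.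
have ub (z : R) w : qform Q (z *: b + w) <= K * nsq w.
  rewrite qformD qformZ -scalemxAr dotZr dotZl.
  have -> : z * dot b (Q *m w) + z * dot w (Q *m b) = z * dot u w.
    by rewrite /u dotDl dot_mulmx (dotC w (Q *m b)); ring.
  have h1 : qform Q w <= L * nsq w by apply: le_trans (hL w); exact: ler_norm.
  have h2 : dot u w ^+ 2 <= nsq u * nsq w by exact: dot_CauchySchwarz.
  have h3 : z * dot u w <= kap * z ^+ 2 + dot u w ^+ 2 / (4 * kap).
    have h := sqr_ge0 (2 * kap * z - dot u w).
    have k4 : 0 < 4 * kap by rewrite mulr_gt0.
    rewrite -(ler_pM2l k4) mulrDr [4 * kap * (_ / _)]mulrC divfK ?gt_eqF//.
    by have : 0 <= 4 * kap ^+ 2 * z ^+ 2 - 4 * kap * z * dot u w + dot u w ^+ 2;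
      [move: h; congr (_ <= _); ring|rewrite -(mulrA _ kap (_ * _)); nra].
  have h4 : dot u w ^+ 2 / (4 * kap) <= nsq u / (4 * kap) * nsq w.
    by rewrite [leRHS]mulrAC ler_wpM2r// invr_ge0 mulr_ge0// ltW.
  rewrite /K; have := nsq_ge0 w.
  have -> : qform Q b = - kap by rewrite opprK.
  lra.
pose T := 2 * K / c i0.
have T0 : 0 <= T by rewrite divr_ge0 ?mulr_ge0// ltW.
have tj0 i : 0 < 2 * K / c i by rewrite divr_gt0// mulr_gt0.
pose A0 i : 'M[R]_(n i) := (2 * K / c i)%:M.
pose A eps := dfwith A0 i0 (elongated e T eps).
have pdA eps : 0 < eps -> forall i, posdef_mx (A eps i).
  move=> eps0 i; rewrite /A; have [->|ii] := eqVneq i i0.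
    by rewrite dfwithin; exact: posdef_elongated.
  by rewrite dfwithout 1?eq_sym//; exact: posdef_scalar.
have domA eps : 0 < eps -> dominated c Q (fun i => gaussian (A eps i)).
  move=> eps0 y; rewrite prod_gaussian ler_expR lerN2.
  pose z := dot (y i0) e / nsq e.
  pose w := \mxcol_j (y j - z *: (x0 j *+ (j == i0))).
  have -> : \mxcol_j y j = z *: b + w.
    rewrite /w mxcolB mxcolZ -/(block x0 i0) -/b.
    by rewrite addrC subrK.
  apply: (le_trans (ub z w)).
  rewrite /w nsq_mxcol mulr_sumr; apply: ler_sum => j _.
  have [->|ji] := eqVneq j i0.
    rewrite /A dfwithin qform_elongated// mulr1n -/e.
    have -> : nsq (y i0 - z *: e) = nsq (y i0) - dot (y i0) e ^+ 2 / nsq e.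
      by rewrite nsqD nsqN nsqZ dotNr dotZr /z; field; rewrite gt_eqF.
    rewrite /T; set o := nsq (y i0) - _.
    have -> : c i0 * (2^-1 * (eps * nsq (y i0) + 2 * K / c i0 * o)) =
      c i0 * 2^-1 * (eps * nsq (y i0)) + K * o by field; rewrite gt_eqF.
    by rewrite lerDr !mulr_ge0// ?nsq_ge0 ?invr_ge0// ltW.
  rewrite /A dfwithout 1?eq_sym// /A0 qform_scalar mulr0n scaler0 subr0.
  have -> // : c j * (2^-1 * (2 * K / c j * nsq (y j))) = K * nsq (y j).
  by field; rewrite gt_eqF.
have [a a0 ha] := Int_elongated_large e0 T0.
pose C := \prod_(j | j != i0) integral_Rn (gaussian (A0 j)) `^ c j.
have C0 : 0 < C.
  by apply: prodr_gt0 => j _; apply/powR_gt0/integral_gaussian_gt0/posdef_scalar.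
pose v := (`|M| / C) `^ (c i0)^-1.
have v0 : 0 <= v by exact: powR_ge0.
have [eps eps0 veps] : exists2 eps : R, 0 < eps &
    v <= integral_Rn (gaussian (elongated e T eps)).
  have [N vN] : exists N : nat, v <= N%:R * a.
    exists (Num.bound (v / a)); rewrite -ler_pdivrMr//.
    by apply/ltW/archi_boundP; rewrite divr_ge0// ltW.
  have eN : 0 < (N.+1%:R ^- 2 : R) by rewrite invr_gt0 exprn_gt0.
  exists (N.+1%:R ^- 2) => //; apply: (le_trans vN); exact: ha.
exists (A eps); split; [exact: pdA|exact: domA|].
rewrite (bigD1 i0)//= /A dfwithin.
have -> : \prod_(i | i != i0) integral_Rn (gaussian (dfwith A0 i0
    (elongated e T eps) i)) `^ c i = C.
  by apply: eq_bigr => j ji; rewrite dfwithout// eq_sym.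
rewrite -ler_pdivrMr//.
apply: (@le_trans _ _ (`|M| / C)).
  by rewrite ler_pM2r ?invr_gt0// ler_norm.
have MC : 0 <= `|M| / C by rewrite divr_ge0// ltW.
have -> : `|M| / C = v `^ c i0.
  by rewrite /v -powRrM mulVf ?powRr1// gt_eqF.
have ci0 : 0 <= c i0 by exact: ltW.
apply: ge0_ler_powR => //; rewrite nnegrE.
exact: (le_trans v0 veps).
Qed.

End negative_block.

(** * Semidefinite diagonal blocks: truncation and regularization *)

Section semidefinite_blocks.
Context {R : realType}.
Local Notation B := (measurableTypeR R).
Variables (m : nat) (n : 'I_m -> nat) (c : 'I_m -> R).
Variable Q : 'M[R]_(\sum_(i < m) n i).
Hypothesis c_gt0 : forall i, 0 < c i.
Local Notation vecs := (forall i, 'cV[R]_(n i)).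
Hypothesis Q_block : forall (x : vecs) i, 0 <= qform Q (block x i).

Lemma nsq_block (x : vecs) i : nsq (block x i) = nsq (x i).
Proof.
rewrite /block nsq_mxcol (bigD1 i)//= eqxx mulr1n big1 ?addr0// => j /negbTE ->.
by rewrite mulr0n nsq0.
Qed.

(** Truncation provides boundedness; with [l = c i] the damping factor pays for
    adding [k.+1%:R^-1%:M] to the form, which makes its diagonal blocks definite. *)
Definition damped (l : R) d (h : 'cV[R]_d -> R) (k : nat) (x : 'cV[R]_d) : R :=
  Num.min (h x) k%:R * expR (- (k.+1%:R^-1 / l * nsq x)).

Section damped_limit.
Variables (l : R) (d : nat) (h : 'cV[R]_d -> R).
Hypotheses (l_gt0 : 0 < l) (mh : vmeas (h : _ -> B)) (h_ge0 : forall x, 0 <= h x).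
Hypothesis h_fin : (Int (fun x => (h x)%:E) < +oo)%E.

Lemma vmeas_damped k : vmeas (damped l h k : _ -> B).
Proof.
apply: measurable_funM; first by apply: measurable_minr => //; exact: measurable_cst.
by apply/measurable_EFinP; exact: (@vmeas_gauss R d).
Qed.

Lemma damped_ge0 k x : 0 <= damped l h k x.
Proof. by apply: mulr_ge0; [rewrite le_min h_ge0 ler0n|exact: expR_ge0]. Qed.

Lemma damped_le k x : damped l h k x <= h x * expR (- (k.+1%:R^-1 / l * nsq x)).
Proof. by apply: ler_wpM2r; [exact: expR_ge0|rewrite ge_min lexx]. Qed.

Let expR_damp_le1 k (x : 'cV[R]_d) : expR (- (k.+1%:R^-1 / l * nsq x)) <= 1.
Proof.
by rewrite -expR0 ler_expR oppr_le0 !mulr_ge0 ?nsq_ge0// invr_ge0 ltW.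
Qed.

Lemma damped_le_height k x : damped l h k x <= k%:R.
Proof.
apply: (@le_trans _ _ (k%:R * expR (- (k.+1%:R^-1 / l * nsq x)))).
  by apply: ler_wpM2r; [exact: expR_ge0|rewrite ge_min lexx orbT].
by rewrite ler_piMr ?expR_damp_le1.
Qed.

Lemma damped_le_self k x : damped l h k x <= h x.
Proof. by apply: (le_trans (damped_le k x)); rewrite ler_piMr ?expR_damp_le1. Qed.

Lemma Int_damped_fin k : (Int (fun x => (damped l h k x)%:E) < +oo)%E.
Proof.
apply: le_lt_trans h_fin; apply: le_Int.
- by move=> x; rewrite lee_fin damped_ge0.
- exact: (vmeas_EFin (vmeas_damped k)).
- exact: vmeas_EFin.
- by move=> x; rewrite lee_fin damped_le_self.
Qed.

(** Dominated convergence, with [h] itself as dominating function. *)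
Lemma Int_damped_cvg :
  fine (Int (fun x => (damped l h k x)%:E)) @[k --> \oo] --> fine (Int (fun x => (h x)%:E)).
Proof.
have h0 : (0 <= Int (fun x => (h x)%:E))%E by apply: Int_ge0 => x; rewrite lee_fin.
apply: fine_cvg; rewrite fineK ?ge0_fin_numE//.
have ih : (lebesgue_tuple R d).-integrable setT (fun t => (h (col_of_tuple t))%:E).
  apply/integrableP; split; first exact: vmeas_EFin.
  by under eq_integral do rewrite gee0_abs ?lee_fin//.
have [] // := @dominated_convergence _ _ _ (lebesgue_tuple R d) setT measurableT
  (fun k t => (damped l h k (col_of_tuple t))%:E) (fun t => (h (col_of_tuple t))%:E)
  (fun t => (h (col_of_tuple t))%:E) _ _ _ ih _.
- by move=> k; exact: (vmeas_EFin (vmeas_damped k)).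
- exact: vmeas_EFin.
- apply: aeW => t _; apply: cvg_EFin; first exact: nearW.
  set x := col_of_tuple t.
  have -> : h x = h x * expR (- (0 / l * nsq x)) by rewrite !mul0r oppr0 expR0 mulr1.
  apply: (@cvgM _ _ _ eventually_filter).
    apply: cvg_near_cst; near=> k; apply/min_idPl.
    near: k; exact: nbhs_infty_ger.
  have lim : - (k.+1%:R^-1 / l * nsq x) @[k --> \oo] --> - (0 / l * nsq x).
    apply: cvgN; apply: cvgMr_tmp; apply: cvgMr_tmp; exact: cvg_harmonic.
  exact: (@cvg_comp _ _ _ _ expR _ _ _ lim (@continuous_expR R _)).
- by apply: aeW => t k _; rewrite /= lee_fin ger0_norm ?damped_ge0// damped_le_self.
Unshelve. all: by end_near. Qed.

End damped_limit.

End semidefinite_blocks.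

Section semidefinite_saturation.
Context {R : realType}.
Local Notation B := (measurableTypeR R).
Variables (m : nat) (n : 'I_m -> nat) (c : 'I_m -> R).
Variable Q : 'M[R]_(\sum_(i < m) n i).
Hypothesis c_gt0 : forall i, 0 < c i.
Local Notation vecs := (forall i, 'cV[R]_(n i)).
Hypothesis Q_block : forall (x : vecs) i, 0 <= qform Q (block x i).

Lemma Int_minorant_fin d (h f : 'cV[R]_d -> R) : vmeas (h : _ -> B) ->
  (forall x, 0 <= h x <= f x) -> integrable_Rn f -> (Int (fun x => (h x)%:E) < +oo)%E.
Proof.
move=> mh hf fint.
have h0 x : 0 <= h x by have /andP[] := hf x.
have hfx x : h x <= f x by have /andP[] := hf x.
have f0 x : 0 <= f x by exact: le_trans (hfx x).
have Borel_eq : (\int[lebesgue_Rn R d]_t (h (col_of_tuple t))%:E)%E =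
    Int (fun x => (h x)%:E).
  apply: (@completed_integral _ _ _ (lebesgue_tuple R d)
    (fun t => (h (col_of_tuple t))%:E)); first exact: vmeas_EFin.
  by move=> t; rewrite lee_fin.
rewrite -Borel_eq; have /integrableP[mf foo] := fint; apply: le_lt_trans foo.
apply: ge0_le_integral; [exact: measurableT| | | |].
- by move=> t _; rewrite lee_fin.
- by apply: (@measurable_fun_cara _ _ _ (lebesgue_tuple R d)); exact: vmeas_EFin.
- exact: measurableT_comp.
- by move=> t _; rewrite /= lee_fin ger0_norm// hfx.
Qed.

(** The integrals of the damped truncations approach those of the [f i]; the form
    regularized accordingly only makes the constraint on Gaussians stronger. *)
Lemma saturation_up_to_factor (f : forall i, 'cV[R]_(n i) -> R) (s : R)
    (f_ge0 : forall i x, 0 <= f i x) (f_even : forall i x, f i (- x) = f i x)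
    (f_L1 : forall i, integrable_Rn (f i)) (f_dom : dominated c Q f)
    (f_gt0 : forall i, 0 < integral_Rn (f i)) (s_gt0 : 0 < s) :
  exists A : forall i, 'M[R]_(n i),
  [/\ forall i, posdef_mx (A i), dominated c Q (fun i => gaussian (A i)) &
    expR (- (s * \sum_i c i)) * \prod_i integral_Rn (f i) `^ c i <=
      \prod_i integral_Rn (gaussian (A i)) `^ c i].
Proof.
pose h i := projT1 (cid (even_Borel_minorant (f_ge0 i) (f_even i) (f_L1 i))).
have hP i : [/\ vmeas (h i : _ -> B), (forall x, 0 <= h i x <= f i x),
    (forall x, h i (- x) = h i x) &
    ((integral_Rn (f i))%:E <= Int (fun x => (h i x)%:E))%E].
  exact: (projT2 (cid (even_Borel_minorant (f_ge0 i) (f_even i) (f_L1 i)))).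
move: h hP => h hP.
have mh i : vmeas (h i : _ -> B) by have [] := hP i.
have h0 i x : 0 <= h i x by have [_ /(_ x)/andP[]] := hP i.
have hf i x : h i x <= f i x by have [_ /(_ x)/andP[]] := hP i.
have hfin i : (Int (fun x => (h i x)%:E) < +oo)%E.
  by apply: Int_minorant_fin (f_L1 i) => //; have [] := hP i.
pose I k i := fine (Int (fun x => (damped (c i) (h i) k x)%:E)).
have [k kP] : exists k, forall i, expR (- s) * integral_Rn (f i) < I k i.
  have : \forall k \near \oo, forall i, expR (- s) * integral_Rn (f i) < I k i.
    apply: filter_forall => i.
    apply: (cvgr_gt _ (Int_damped_cvg (c_gt0 i) (mh i) (h0 i) (hfin i))).
    apply: (@lt_le_trans _ _ (integral_Rn (f i))).
      by rewrite gtr_pMl// -expR0 ltr_expR oppr_lt0.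
    have [_ _ _] := hP i.
    rewrite -(@fineK _ (Int _)) ?lee_fin// ge0_fin_numE//.
    by apply: Int_ge0 => x; rewrite lee_fin.
  by move/filter_ex.
have I0 i : 0 < I k i by apply: le_lt_trans (kP i); rewrite mulr_ge0 ?expR_ge0// ltW.
have dh0 i x : 0 <= damped (c i) (h i) k x by exact: damped_ge0.
have md i : vmeas (damped (c i) (h i) k : _ -> B) by exact: vmeas_damped.
pose g i x := (I k i)^-1 * damped (c i) (h i) k x.
have g_density i : even_density (g i).
  split.
  - by apply: measurable_funM; [exact: measurable_cst|exact: md].
  - by move=> x; rewrite mulr_ge0// invr_ge0 ltW.
  - by move=> x; rewrite /g /damped nsqN; have [_ _ -> _] := hP i.
  - exists ((I k i)^-1 * k%:R) => x.
    by rewrite ler_wpM2l ?invr_ge0 ?damped_le_height// ltW.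
  - under eq_Int do rewrite EFinM.
    rewrite IntZl; last 3 first.
    + by rewrite invr_ge0 ltW.
    + by move=> x; rewrite lee_fin.
    + exact: (vmeas_EFin (md i)).
    have -> : Int (fun x => (damped (c i) (h i) k x)%:E) = (I k i)%:E.
      rewrite fineK// ge0_fin_numE ?Int_damped_fin//.
      by apply: Int_ge0 => x; rewrite lee_fin.
    by rewrite -EFinM mulVf// gt_eqF.
pose D : R := k.+1%:R^-1.
have D0 : 0 < D by rewrite invr_gt0.
pose J := \prod_i I k i `^ c i.
have J0 : 0 < J by apply: prodr_gt0 => i _; exact: powR_gt0.
have g_feasible : feasible c (Q + D%:M) J^-1 g.
  split => // [|x]; first by rewrite invr_gt0.
  have -> : \prod_i g i (x i) `^ c i = J^-1 * \prod_i damped (c i) (h i) k (x i) `^ c i.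
    rewrite /J -prodfV -big_split/=; apply: eq_bigr => i _.
    by rewrite powRM ?invr_ge0 ?(ltW (I0 i))// -powRN -powR_inv1 ?(ltW (I0 i))// -powRrM mulN1r.
  rewrite ler_pM2l ?invr_gt0// qform_add_scalar opprD expRD nsq_mxcol.
  apply: (@le_trans _ _ (\prod_i (f i (x i) `^ c i * expR (- (D * nsq (x i)))))).
    apply: ler_prod => i _; rewrite powR_ge0/=.
    have -> : expR (- (D * nsq (x i))) = expR (- (D / c i * nsq (x i))) `^ c i.
      by rewrite -expRM; congr expR; field; rewrite gt_eqF.
    rewrite -powRM ?expR_ge0//; apply: ge0_ler_powR; rewrite ?nnegrE//.
    - exact: ltW.
    - by rewrite mulr_ge0 ?expR_ge0.
    - by apply: (le_trans (damped_le _ _ _ _)); rewrite ler_wpM2r ?expR_ge0.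
  rewrite big_split/= mulr_sumr -sumrN expR_sum ler_wpM2r//.
  by apply: prodr_ge0 => i _; exact: expR_ge0.
have QD x i : D * nsq (x i) <= qform (Q + D%:M) (block x i).
  by rewrite qform_add_scalar nsq_block lerDr.
have [A [dA domA hA]] := Gaussian_saturation_block_pos c_gt0 D0 QD g_feasible.
exists A; split => //.
  move=> x; apply: (le_trans (domA x)); rewrite ler_expR lerN2 qform_add_scalar.
  by rewrite lerDl mulr_ge0 ?nsq_ge0// ltW.
apply: (@le_trans _ _ J); last by move: hA; rewrite ler_pdivlMl// mulr1.
rewrite mulr_sumr -sumrN expR_sum -big_split/=; apply: ler_prod => i _.
rewrite mulr_ge0 ?expR_ge0 ?powR_ge0//= -mulNr expRM -powRM ?expR_ge0 ?(ltW (f_gt0 i))//.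
apply: ge0_ler_powR; rewrite ?nnegrE ?(ltW (c_gt0 i)) ?(ltW (I0 i)) ?(ltW (kP i))//.
by rewrite mulr_ge0 ?expR_ge0// ltW.
Qed.

End semidefinite_saturation.

(** * Gaussian saturation for even functions *)

Theorem theorem1p1 (R : realType) (m : nat) (n : 'I_m -> nat) (c : 'I_m -> R)
    (Q : 'M[R]_(\sum_(i < m) n i)) (f : forall i : 'I_m, 'cV[R]_(n i) -> R)
    (m_gt0 : (0 < m)%N) (n_gt0 : forall i, (0 < n i)%N)
    (c_gt0 : forall i, 0 < c i)
    (Q_sym : symmetric_mx Q)
    (f_ge0 : forall i x, 0 <= f i x)
    (f_even : forall i x, f i (- x) = f i x)
    (f_L1 : forall i, integrable_Rn (f i))
    (f_dom : dominated c Q f) :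
  ((\prod_(i < m) integral_Rn (f i) `^ c i)%:E <=
   ereal_sup
     [set (\prod_(i < m) integral_Rn (gaussian (A i)) `^ c i)%:E
       | A in [set A : forall i : 'I_m, 'M[R]_(n i) |
           (forall i, posdef_mx (A i)) /\
           dominated c Q (fun i => gaussian (A i))]])%E.
Proof.
set S := ereal_sup _; pose V := \prod_i integral_Rn (f i) `^ c i.
have sup_ge v (A : forall i, 'M[R]_(n i)) : (forall i, posdef_mx (A i)) ->
    dominated c Q (fun i => gaussian (A i)) ->
    v <= \prod_i integral_Rn (gaussian (A i)) `^ c i -> (v%:E <= S)%E.
  move=> dA domA vA.
  apply: (@le_trans _ _ (\prod_i integral_Rn (gaussian (A i)) `^ c i)%:E).
    by rewrite lee_fin.
  by apply: ereal_sup_ubound; exists A.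
clearbody S; change (V%:E <= S)%E.
have prod_ge0 (A : forall i, 'M[R]_(n i)) :
    0 <= \prod_i integral_Rn (gaussian (A i)) `^ c i.
  by apply: prodr_ge0 => j _; exact: powR_ge0.
have S_ge0 : (0 <= S)%E.
  by have [A [dA domA]] := scalar_gaussians Q c_gt0; exact: sup_ge (prod_ge0 A).
have [[x [i neg]]|Q_block] := pselect (exists x i, qform Q (block x i) < 0).
  have [A [dA domA VA]] := negative_block_unbounded c_gt0 V neg.
  exact: sup_ge VA.
have {}Q_block x i : 0 <= qform Q (block x i).
  by rewrite leNgt; apply/negP => neg; apply: Q_block; exists x, i.
have If_ge0 i : 0 <= integral_Rn (f i) by apply: Rintegral_ge0 => t _; exact: f_ge0.
have [[i If0]|If_neq0] := pselect (exists i, integral_Rn (f i) = 0).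
  suff -> : V = 0 by exact: S_ge0.
  by rewrite /V (bigD1 i)//= If0 powR0 ?mul0r// gt_eqF.
have If_gt0 i : 0 < integral_Rn (f i).
  by rewrite lt_neqAle If_ge0 andbT eq_sym; apply/eqP => If0; apply: If_neq0; exists i.
have V_gt0 : 0 < V by apply: prodr_gt0 => i _; exact: powR_gt0.
pose C := \sum_i c i.
have C_gt0 : 0 < C.
  rewrite /C (bigD1 (Ordinal m_gt0))//= ltr_wpDr// sumr_ge0// => i _; exact: ltW.
have near_S s : 0 < s -> ((expR (- (s * C)) * V)%:E <= S)%E.
  move=> s0; have [A [dA domA VA]] :=
    saturation_up_to_factor c_gt0 Q_block f_ge0 f_even f_L1 f_dom If_gt0 s0.
  exact: sup_ge dA domA VA.
clearbody V C; apply/lee_addgt0Pr => e e0.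
have [le_eV|Ve] := leP V e.
  by apply: (@le_trans _ _ (0 + e%:E)%E); [rewrite add0e lee_fin|rewrite leeD2r].
pose s := ln (V / (V - e)) / C.
have s0 : 0 < s.
  rewrite divr_gt0// ln_gt0// ltr_pdivlMr ?subr_gt0// mul1r.
  by rewrite ltrBlDr ltrDl.
have Ve0 : 0 < V / (V - e) by rewrite divr_gt0// subr_gt0.
have sC : expR (- (s * C)) * V = V - e.
  by rewrite /s divfK ?gt_eqF// expRN lnK ?posrE// invf_div divfK ?gt_eqF.
rewrite -leeBlDr// -EFinB -sC; exact: near_S.
Qed.
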